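(* There are no minimal $\mathsf{tRI}$ theories with respect to interpretation: for every $\mathsf{tRI}$ theory $U$ one can effectively find (from an index of $U$) a $\mathsf{tRI}$ theory $T$ with $T\lhd U$, i.e. $T$ is interpretable in $U$ but $U$ is not interpretable in $T$.
   Context: All theories are first-order with finite signature and are identified with their sets of theorems (coded by Gödel numbers). For a consistent r.e. theory $T$, $T_P=\{\ulcorner\phi\urcorner: T\vdash\phi\}$ and $T_R=\{\ulcorner\phi\urcorner: T\vdash\neg\phi\}$. A consistent r.e. theory $T$ is $\mathsf{tRI}$ if there is no recursive set $X$ of sentences with $T_P\subseteq X$, $X\cap T_R=\emptyset$, and $X$ closed under conjunction and deduction (if $\phi,\psi\in X$ then $\phi\wedge\psi\in X$; if $\phi\in X$ and $\phi\vdash\psi$ then $\psi\in X$). Interpretations are one-dimensional, parameter-free, one-piece relative interpretations: $S\unlhd T$ means $S$ is interpretable in $T$, and $S\lhd T$ means $S\unlhd T$ but not $T\unlhd S$. *)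

(* Defs.v *)
From mathcomp Require Import all_boot.
From Stdlib Require List Cantor.

Set Implicit Arguments.
Unset Strict Implicit.
Unset Printing Implicit Defensive.

Definition npair (a b : nat) : nat := Cantor.to_nat (a, b).
Definition nunpair (n : nat) : nat * nat := Cantor.of_nat n.

Definition code_seq (s : seq nat) : nat := foldr (fun a c => (npair a c).+1) 0 s.

(* Kleene's partial recursive functions, presented as unary functions: the
   n-ary ones are obtained through [npair]. *)
Inductive prog : Type :=
| PZero
| PSucc
| PLeft
| PRight
| PPair of prog & prog
| PComp of prog & prog
| PRec of prog & prog
| PMu of prog.

(* [eval p n m]: the program [p] halts on input [n] with output [m].
   - [PRec f g] computes h <a, 0> = f a, h <a, k+1> = g <a, <k, h <a, k>>>;
   - [PMu f] maps n to the least k with f <n, k> = 0, all the values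
     f <n, j> with j < k being defined. *)
Fixpoint eval (p : prog) (n m : nat) {struct p} : Prop :=
  match p with
  | PZero => m = 0
  | PSucc => m = n.+1
  | PLeft => m = (nunpair n).1
  | PRight => m = (nunpair n).2
  | PPair f g => exists a b, [/\ eval f n a, eval g n b & m = npair a b]
  | PComp f g => exists2 k, eval g n k & eval f k m
  | PRec f g =>
      let a := (nunpair n).1 in
      (fix rec (k r : nat) {struct k} : Prop :=
         if k is k'.+1 then
           exists2 i, rec k' i & eval g (npair a (npair k' i)) r
         else eval f a r) (nunpair n).2 m
  | PMu f =>
      eval f (npair n m) 0 /\
      (forall k, k < m -> exists r, eval f (npair n k) r.+1)
  end.

Definition halts (p : prog) (n : nat) : Prop := exists m, eval p n m.

Fixpoint code_prog (p : prog) : nat :=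
  match p with
  | PZero => npair 0 0
  | PSucc => npair 1 0
  | PLeft => npair 2 0
  | PRight => npair 3 0
  | PPair f g => npair 4 (npair (code_prog f) (code_prog g))
  | PComp f g => npair 5 (npair (code_prog f) (code_prog g))
  | PRec f g => npair 6 (npair (code_prog f) (code_prog g))
  | PMu f => npair 7 (code_prog f)
  end.

Definition recursive (X : nat -> Prop) : Prop :=
  exists p, forall n, (X n -> eval p n 1) /\ (~ X n -> eval p n 0).

Definition enumerates (p : prog) (X : nat -> Prop) : Prop :=
  forall n, X n <-> halts p n.

(* A finite signature: the arities of the function symbols 0, 1, ... and those
   of the relation symbols 0, 1, ...; constants are function symbols of
   arity 0. *)
Record signature : Type := Signature { funs : seq nat; rels : seq nat }.

Definition code_sig (S : signature) : nat :=
  npair (code_seq (funs S)) (code_seq (rels S)).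

(* Raw syntax, common to all signatures, with de Bruijn indices. *)
Inductive term : Type :=
| Var of nat
| Fun of nat & seq term.

Inductive form : Type :=
| Bot
| Eq of term & term
| Rel of nat & seq term
| Imp of form & form
| All of form.

Definition Neg (phi : form) : form := Imp phi Bot.
Definition Top : form := Neg Bot.
Definition And (phi psi : form) : form := Neg (Imp phi (Neg psi)).
Definition Ex (phi : form) : form := Neg (All (Neg phi)).

Fixpoint code_term (t : term) : nat :=
  match t with
  | Var x => npair 0 x
  | Fun f ts => npair 1 (npair f (code_seq (map code_term ts)))
  end.

Fixpoint code_form (phi : form) : nat :=
  match phi with
  | Bot => npair 0 0
  | Eq s t => npair 1 (npair (code_term s) (code_term t))
  | Rel r ts => npair 2 (npair r (code_seq (map code_term ts)))
  | Imp phi psi => npair 3 (npair (code_form phi) (code_form psi))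
  | All phi => npair 4 (code_form phi)
  end.

Definition codes (X : form -> Prop) : nat -> Prop :=
  fun n => exists2 phi, X phi & n = code_form phi.

Fixpoint term_in (S : signature) (t : term) : bool :=
  match t with
  | Var _ => true
  | Fun f ts => (onth (funs S) f == Some (size ts)) && all (term_in S) ts
  end.

Fixpoint form_in (S : signature) (phi : form) : bool :=
  match phi with
  | Bot => true
  | Eq s t => term_in S s && term_in S t
  | Rel r ts => (onth (rels S) r == Some (size ts)) && all (term_in S) ts
  | Imp phi psi => form_in S phi && form_in S psi
  | All phi => form_in S phi
  end.

(* The free variables are among 0, ..., k-1. *)
Fixpoint term_bound (k : nat) (t : term) : bool :=
  match t with
  | Var x => x < k
  | Fun _ ts => all (term_bound k) ts
  end.

Fixpoint form_bound (k : nat) (phi : form) : bool :=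
  match phi with
  | Bot => true
  | Eq s t => term_bound k s && term_bound k t
  | Rel _ ts => all (term_bound k) ts
  | Imp phi psi => form_bound k phi && form_bound k psi
  | All phi => form_bound k.+1 phi
  end.

Definition sentence (S : signature) (phi : form) : bool :=
  form_in S phi && form_bound 0 phi.

Fixpoint subst_term (sigma : nat -> term) (t : term) : term :=
  match t with
  | Var x => sigma x
  | Fun f ts => Fun f (map (subst_term sigma) ts)
  end.

Definition lift_term : term -> term := subst_term (fun x => Var x.+1).

Definition up (sigma : nat -> term) (x : nat) : term :=
  if x is y.+1 then lift_term (sigma y) else Var 0.

Fixpoint subst_form (sigma : nat -> term) (phi : form) : form :=
  match phi with
  | Bot => Bot
  | Eq s t => Eq (subst_term sigma s) (subst_term sigma t)
  | Rel r ts => Rel r (map (subst_term sigma) ts)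
  | Imp phi psi => Imp (subst_form sigma phi) (subst_form sigma psi)
  | All phi => All (subst_form (up sigma) phi)
  end.

Definition lift_form : form -> form := subst_form (fun x => Var x.+1).

Definition subst0 (t : term) : form -> form :=
  subst_form (fun x => if x is y.+1 then Var y else t).

(* Classical natural deduction with equality.  The side conditions keep every
   formula of a derivation in the signature [S]. *)
Inductive prv (S : signature) : seq form -> form -> Prop :=
| prv_ax G phi : List.In phi G -> prv S G phi
| prv_impI G phi psi : form_in S phi ->
    prv S (phi :: G) psi -> prv S G (Imp phi psi)
| prv_impE G phi psi : prv S G (Imp phi psi) -> prv S G phi -> prv S G psi
| prv_dne G phi : prv S G (Neg (Neg phi)) -> prv S G phi
| prv_allI G phi : prv S (map lift_form G) phi -> prv S G (All phi)
| prv_allE G phi t : term_in S t ->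
    prv S G (All phi) -> prv S G (subst0 t phi)
| prv_eqI G t : term_in S t -> prv S G (Eq t t)
| prv_eqE G phi s t : form_in S phi ->
    prv S G (Eq s t) -> prv S G (subst0 s phi) -> prv S G (subst0 t phi).

(* Derivability from a set [T] of sentences.  If [phi] has free variables, this
   amounts to the derivability of its universal closure. *)
Definition provable (S : signature) (T : form -> Prop) (phi : form) : Prop :=
  exists2 G, (forall psi, List.In psi G -> T psi) & prv S G phi.

Record theory : Type := Theory {
  sig : signature;
  thm :> form -> Prop;
  thm_sentence : forall phi, thm phi -> sentence sig phi;
  thm_closed : forall phi, sentence sig phi -> provable sig thm phi -> thm phi
}.

Definition proves (T : theory) (phi : form) : Prop := provable (sig T) T phi.

Definition consistent (T : theory) : Prop := ~ proves T Bot.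

(* An index of a theory consists of its signature and of an index of its set of
   theorems: the signature cannot be computed from the latter alone. *)
Definition theory_index (e : nat) (T : theory) : Prop :=
  exists2 p, e = npair (code_sig (sig T)) (code_prog p)
           & enumerates p (codes T).

Definition re_theory (T : theory) : Prop := exists e, theory_index e T.

Definition T_P (T : theory) (phi : form) : Prop :=
  sentence (sig T) phi /\ proves T phi.

Definition T_R (T : theory) (phi : form) : Prop :=
  sentence (sig T) phi /\ proves T (Neg phi).

Definition tRI (T : theory) : Prop :=
  [/\ consistent T,
      re_theory T
    & ~ exists X : form -> Prop,
        (forall phi, X phi -> sentence (sig T) phi) /\
        recursive (codes X) /\
        (forall phi, T_P T phi -> X phi) /\
        (forall phi, ~ (X phi /\ T_R T phi)) /\
        (forall phi psi, X phi -> X psi -> X (And phi psi)) /\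
        (forall phi psi, X phi -> sentence (sig T) psi ->
           prv (sig T) [:: phi] psi -> X psi)].

(* One-dimensional, parameter-free, one-piece relative translations.  The
   formulas use the following free variables: 0 for the domain, 0 and 1 for the
   equality, 0, ..., n-1 for an n-ary relation symbol; for an n-ary function
   symbol, 0, ..., n-1 are the arguments and n is the value. *)
Record translation : Type := Translation {
  tr_dom : form;
  tr_eq : form;
  tr_fun : nat -> form;
  tr_rel : nat -> form
}.

Definition wf_translation (I : translation) (S S' : signature) : Prop :=
  let wf k phi := form_in S' phi && form_bound k phi in
  [/\ wf 1 (tr_dom I),
      wf 2 (tr_eq I),
      forall f n, onth (funs S) f = Some n -> wf n.+1 (tr_fun I f)
    & forall r n, onth (rels S) r = Some n -> wf n (tr_rel I r)].

(* [phi] with its free variables 0, 1, ... renamed to the entries of [xs]. *)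
Definition inst (phi : form) (xs : seq nat) : form :=
  subst_form (fun x => Var (nth 0 xs x)) phi.

Definition dom_at (I : translation) (x : nat) : form := inst (tr_dom I) [:: x].
Definition eq_at (I : translation) (x y : nat) : form :=
  inst (tr_eq I) [:: x; y].

Definition allD (I : translation) (phi : form) : form :=
  All (Imp (dom_at I 0) phi).
Definition exD (I : translation) (phi : form) : form :=
  Ex (And (dom_at I 0) phi).

(* The conjunction of the F t_j (i + j), for ts = [:: t_0; t_1; ...]. *)
Definition conj_args (F : term -> nat -> form) : seq term -> nat -> form :=
  fix go ts i := if ts is t :: ts' then And (F t i) (go ts' i.+1) else Top.

(* Function symbols are eliminated as usual, by introducing a new variable for
   the value of each subterm.  [tr_graph I d t y] translates "t = y", where y is
   a variable and the variables of t are to be shifted by d, the number of new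
   quantifiers in the scope of which t has been moved. *)
Fixpoint tr_graph (I : translation) (d : nat) (t : term) (y : nat) : form :=
  match t with
  | Var x => eq_at I (x + d) y
  | Fun f ts =>
      let n := size ts in
      iter n (exD I)
        (And (conj_args (tr_graph I (d + n)) ts 0)
             (inst (tr_fun I f) (rcons (iota 0 n) (y + n))))
  end.

Fixpoint tr_form (I : translation) (phi : form) : form :=
  match phi with
  | Bot => Bot
  | Eq s t => exD I (And (tr_graph I 1 s 0) (tr_graph I 1 t 0))
  | Rel r ts =>
      let n := size ts in
      iter n (exD I)
        (And (conj_args (tr_graph I n) ts 0) (inst (tr_rel I r) (iota 0 n)))
  | Imp phi psi => Imp (tr_form I phi) (tr_form I psi)
  | All phi => allD I (tr_form I phi)
  end.

Definition imps (hyps : seq form) (phi : form) : form := foldr Imp phi hyps.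
Definition doms (I : translation) (n : nat) : seq form :=
  [seq dom_at I x | x <- iota 0 n].

Definition refl_ax (I : translation) : form := imps (doms I 1) (eq_at I 0 0).

Definition congr_ax (I : translation) (phi : form) (n : nat) : form :=
  imps (doms I (n + n) ++ [seq eq_at I x (n + x) | x <- iota 0 n] ++
        [:: inst phi (iota 0 n)])
    (inst phi (iota n n)).

Definition total_ax (I : translation) (f n : nat) : form :=
  imps (doms I n) (exD I (inst (tr_fun I f) (rcons (iota 1 n) 0))).

Definition unique_ax (I : translation) (f n : nat) : form :=
  imps (doms I n.+2 ++ [:: inst (tr_fun I f) (rcons (iota 0 n) n);
                           inst (tr_fun I f) (rcons (iota 0 n) n.+1)])
    (eq_at I n n.+1).

(* Symmetry and transitivity of the equality of [I] follow from reflexivity and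
   from its congruence with respect to itself. *)
Definition interpretation (I : translation) (T U : theory) : Prop :=
  wf_translation I (sig T) (sig U) /\
  proves U (refl_ax I) /\
  proves U (congr_ax I (tr_eq I) 2) /\
  (forall r n, onth (rels (sig T)) r = Some n ->
     proves U (congr_ax I (tr_rel I r) n)) /\
  (forall f n, onth (funs (sig T)) f = Some n ->
     [/\ proves U (congr_ax I (tr_fun I f) n.+1),
         proves U (total_ax I f n)
       & proves U (unique_ax I f n)]) /\
  (forall phi, T phi -> proves U (tr_form I phi)).

Definition interpretable (T U : theory) : Prop :=
  exists I, interpretation I T U.

Definition strictly_interpretable (T U : theory) : Prop :=
  interpretable T U /\ ~ interpretable U T.

(* Main.v *)
(* A theory is tRI iff it is essentially undecidable.  Let [M_a], for [a] in the
   Cantor space, be an equivalence relation with exactly one class of [n+1]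
   elements for every [n] such that [a n], and with infinite classes otherwise.
   By a back-and-forth argument the truth of a sentence in [M_a] depends on a
   finite part of [a] only, and is computable from it.  If [a] is eventually zero,
   the theory of [M_a] is therefore decidable, and no translation can make all the
   theorems of [U] true in [M_a]: the sentences whose translation holds in [M_a]
   would be a decidable consistent extension of [U].  Hence one may compute coding locations
   [n_0 < n_1 < ...] that are so sparse that, if [a] vanishes off the locations, the
   [i]-th translation is refuted in [M_a] by the values of [a] below some location,
   whatever [a] is at the locations.  Requiring [a n_i = 1] or [a n_i = 0] according
   to whether the [i]-th program halts on [i] with value [0] or not [0] gives a
   class of structures whose common theory [W] is essentially undecidable and does
   not interpret [U].  The theory [T] is the meet of [U] and [W]: the sentences that
   hold both in all models of [U] and in all these structures. *)
Require Import Defs.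
From mathcomp Require Import all_boot.
From mathcomp Require Import zify.
From Stdlib Require Import Classical ClassicalEpsilon FunctionalExtensionality.
From Stdlib Require List Cantor.

Set Implicit Arguments.
Unset Strict Implicit.
Unset Printing Implicit Defensive.

(** Taking a meet makes interpretability in [U] immediate: [U] interprets it with the new relation
    empty, whatever the structures satisfy. The burden moves to essential undecidability. A
    recursive separating set for the meet may mix the two components, so a sentence that
    distinguishes them splits the argument. If the set contains its negation, its part in the old
    signature separates the theorems of [U] from the refutable sentences; if not, the set decides
    enough about the structures to be defeated by diagonalization.

    Enumerability is the other obstacle, for [W] is given by a class of structures and not by
    axioms. The class is effectively closed in the Cantor space, and the truth of a fixed sentence
    is locally constant there; compactness turns truth throughout the class into a finite check.

    The construction reads only an index of [U]. That [U] is tRI enters the verification alone: it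
    makes each search for the next location end, and it excludes the first case above. *)

Notation L n := (nunpair n).1.
Notation R n := (nunpair n).2.

Lemma npairK a b : nunpair (npair a b) = (a, b).
Proof. exact: Cantor.cancel_of_to. Qed.

Lemma npairL a b : L (npair a b) = a.
Proof. by rewrite npairK. Qed.

Lemma npairR a b : R (npair a b) = b.
Proof. by rewrite npairK. Qed.

Lemma nunpairK n : npair (L n) (R n) = n.
Proof.
by rewrite /npair /nunpair -surjective_pairing; exact: Cantor.cancel_to_of.
Qed.

Lemma npair_ge a b : a + b <= npair a b.
Proof.
have := Cantor.to_nat_non_decreasing a b; rewrite -/(npair a b); lia.
Qed.

Lemma npair_inj a b c d : npair a b = npair c d -> a = c /\ b = d.
Proof. by move=> e; have := npairK a b; rewrite e npairK => -[]. Qed.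

#[global] Opaque npair nunpair.
#[global] Arguments npair : simpl never.
#[global] Arguments nunpair : simpl never.
Definition npairE := (npairL, npairR).

Lemma eval_rec f g n m : eval (PRec f g) n m <->
  match R n with
  | 0 => eval f (L n) m
  | k.+1 => exists2 i, eval (PRec f g) (npair (L n) k) i
                     & eval g (npair (L n) (npair k i)) m
  end.
Proof. by rewrite /=; case: (R n) => [|k]; rewrite ?npairK. Qed.

Lemma eval_fun p n m m' : eval p n m -> eval p n m' -> m = m'.
Proof.
elim: p n m m' => [||||f IHf g IHg|f IHf g IHg|f IHf g IHg|f IHf] n m m';
  try by move=> /= -> ->.
- move=> [a [b [fa gb ->]]] [a' [b' [fa' gb' ->]]].
  by rewrite (IHf _ _ _ fa fa') (IHg _ _ _ gb gb').
- by move=> [k gk fk] [k' gk']; rewrite -(IHg _ _ _ gk gk'); exact: IHf fk.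
- rewrite -(nunpairK n); elim: (R n) m m' => [|k IHk] m m'.
    by rewrite !eval_rec !npairE; exact: IHf.
  rewrite !eval_rec !npairE => -[i /IHk hi gi] [i' /hi <-].
  exact: IHg gi.
- move=> [f0 fm] [f0' fm'].
  case: (ltngtP m m') => // lt_m.
    by have [r fr] := fm' _ lt_m; have := IHf _ _ _ f0 fr.
  by have [r fr] := fm _ lt_m; have := IHf _ _ _ f0' fr.
Qed.

(** * Computable operators *)

Fixpoint kprog k := if k is k'.+1 then PComp PSucc (kprog k') else PZero.

Lemma eval_kprog k n : eval (kprog k) n k.
Proof. by elim: k => //= k IHk; exists k. Qed.

(* An operator on functions is computable if a program for it can be found
   computably in, and substitutively for, any program [h] for its argument. *)
Definition comp_op (F : (nat -> nat) -> nat -> nat) : Prop :=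
  exists (B : prog -> prog) (c : prog),
    (forall h, eval c (code_prog h) (code_prog (B h))) /\
    (forall g h, (forall n, eval h n (g n)) -> forall n, eval (B h) n (F g n)).

Lemma op_ext F G : comp_op F -> (forall g n, F g n = G g n) -> comp_op G.
Proof.
move=> Fop FG; suff <- : F = G by [].
by do 2!apply: functional_extensionality => ?.
Qed.

Definition comp_fun (f : nat -> nat) : Prop := comp_op (fun _ => f).

Lemma comp_funP f : comp_fun f <-> exists p, forall n, eval p n (f n).
Proof.
split=> [[B [c [_ Bh]]]|[p fp]].
  by exists (B PZero) => n; exact: (Bh (fun=> 0)).
by exists (fun=> p), (kprog (code_prog p)); split=> // h; exact: eval_kprog.
Qed.

Lemma op_const k : comp_op (fun _ _ => k).
Proof. by apply/comp_funP; exists (kprog k) => n; exact: eval_kprog. Qed.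

(** The identity is not among the basic programs; re-pairing the two projections gives it because
    the pairing is onto. *)
Definition pid := PPair PLeft PRight.

Lemma eval_pid n : eval pid n n.
Proof. by exists (L n), (R n); split=> //; rewrite nunpairK. Qed.

Lemma op_id : comp_op (fun _ n => n).
Proof. by apply/comp_funP; exists pid; exact: eval_pid. Qed.

(** Combines programs for the codes of two parts into one for the code of the compound program; [k]
    is the tag of its constructor in [code_prog]. *)
Definition ptag k c d := PPair (kprog k) (PPair c d).

Lemma eval_ptag k c d n a b :
  eval c n a -> eval d n b -> eval (ptag k c d) n (npair k (npair a b)).
Proof.
move=> ca db; exists k, (npair a b); split=> //; first exact: eval_kprog.
by exists a, b.
Qed.

Lemma op_pair F G : comp_op F -> comp_op G ->
  comp_op (fun g n => npair (F g n) (G g n)).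
Proof.
move=> [B [c [cB BP]]] [B' [c' [cB' BP']]].
exists (fun h => PPair (B h) (B' h)), (ptag 4 c c'); split=> [h|g h hg n].
  exact: eval_ptag.
by exists (F g n), (G g n); split; [exact: BP|exact: BP'|].
Qed.

Lemma op_comp F G : comp_op F -> comp_op G ->
  comp_op (fun g n => F g (G g n)).
Proof.
move=> [B [c [cB BP]]] [B' [c' [cB' BP']]].
exists (fun h => PComp (B h) (B' h)), (ptag 5 c c'); split=> [h|g h hg n].
  exact: eval_ptag.
by exists (G g n); [exact: BP'|exact: BP].
Qed.

Lemma op_fun f F : comp_fun f -> comp_op F -> comp_op (fun g n => f (F g n)).
Proof. exact: op_comp. Qed.

Lemma op_oracle F : comp_op F -> comp_op (fun g n => g (F g n)).
Proof.
apply: (@op_comp (fun g n => g n)).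
by exists id, pid; split=> // h; exact: eval_pid.
Qed.

Lemma op_left F : comp_op F -> comp_op (fun g n => L (F g n)).
Proof. by apply: (@op_fun (fun n => L n)); apply/comp_funP; exists PLeft. Qed.

Lemma op_right F : comp_op F -> comp_op (fun g n => R (F g n)).
Proof. by apply: (@op_fun (fun n => R n)); apply/comp_funP; exists PRight. Qed.

Lemma op_succ F : comp_op F -> comp_op (fun g n => (F g n).+1).
Proof. by apply: (@op_fun succn); apply/comp_funP; exists PSucc. Qed.

Fixpoint prec (f : nat) (s : nat -> nat -> nat) (k : nat) : nat :=
  if k is k'.+1 then s k' (prec f s k') else f.

Lemma op_prec F S K : comp_op F -> comp_op K ->
  comp_op (fun g z => S g (L z) (L (R z)) (R (R z))) ->
  comp_op (fun g n => prec (F g n) (S g n) (K g n)).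
Proof.
move=> [B [c [cB BP]]] Kop [B' [c' [cB' BP']]].
pose P g z := prec (F g (L z)) (S g (L z)) (R z).
suff Pop : comp_op P.
  apply: (op_ext (op_comp Pop (op_pair op_id Kop))).
  by move=> g n; rewrite /P !npairE.
exists (fun h => PRec (B h) (B' h)), (ptag 6 c c'); split=> [h|g h hg n].
  exact: eval_ptag.
rewrite -(nunpairK n) /P !npairE; elim: (R n) => [|k IHk].
  by rewrite eval_rec !npairE; exact: BP.
rewrite eval_rec !npairE; eexists; first exact: IHk.
by have := BP' g h hg (npair (L n) (npair k (prec (F g (L n)) (S g (L n)) k)));
  rewrite !npairE.
Qed.

Lemma op_fun2 f F G : comp_fun (fun z => f (L z) (R z)) ->
  comp_op F -> comp_op G -> comp_op (fun g n => f (F g n) (G g n)).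
Proof.
move=> fop Fop Gop; apply: (op_ext (op_fun fop (op_pair Fop Gop))).
by move=> g n; rewrite !npairE.
Qed.

Lemma op_fun3 f F G H : comp_fun (fun z => f (L z) (L (R z)) (R (R z))) ->
  comp_op F -> comp_op G -> comp_op H ->
  comp_op (fun g n => f (F g n) (G g n) (H g n)).
Proof.
move=> fop Fop Gop Hop; apply: (op_ext (op_fun fop (op_pair Fop (op_pair Gop Hop)))).
by move=> g n; rewrite !npairE.
Qed.

Lemma op_fun4 f F G H K :
  comp_fun (fun z => f (L z) (L (R z)) (L (R (R z))) (R (R (R z)))) ->
  comp_op F -> comp_op G -> comp_op H -> comp_op K ->
  comp_op (fun g n => f (F g n) (G g n) (H g n) (K g n)).
Proof.
move=> fop Fop Gop Hop Kop.
apply: (op_ext (op_fun fop (op_pair Fop (op_pair Gop (op_pair Hop Kop))))).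
by move=> g n; rewrite !npairE.
Qed.

Definition ncase (a f : nat) (c : nat -> nat) : nat :=
  if a is k.+1 then c k else f.

Lemma op_ncase A F C : comp_op A -> comp_op F ->
  comp_op (fun g z => C g (L z) (R z)) ->
  comp_op (fun g n => ncase (A g n) (F g n) (C g n)).
Proof.
move=> Aop Fop Cop.
have : comp_op (fun g n => prec (F g n) (fun k _ => C g n k) (A g n)).
  apply: op_prec => //.
  have zop : comp_op (fun _ z => npair (L z) (L (R z))).
    apply: op_pair; first exact: op_left op_id.
    exact: op_left (op_right op_id).
  apply: (op_ext (op_comp Cop zop)).
  by move=> g n; rewrite !npairE.
by move/op_ext; apply=> g n; case: (A g n).
Qed.

Lemma op_if (b : _ -> _ -> bool) F G : comp_op (fun g n => b g n) ->
  comp_op F -> comp_op G ->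
  comp_op (fun g n => if b g n then F g n else G g n).
Proof.
move=> bop Fop Gop.
have : comp_op (fun g n => ncase (b g n) (G g n) (fun _ => F g n)).
  by apply: op_ncase => //; exact: op_comp Fop (op_left op_id).
by move/op_ext; apply=> g n; case: (b g n).
Qed.

Lemma op_predn F : comp_op F -> comp_op (fun g n => (F g n).-1).
Proof.
apply: (@op_fun predn).
have : comp_fun (fun n => ncase n 0 id).
  apply: op_ncase; [exact: op_id|exact: op_const|exact: op_right op_id].
by move/op_ext; apply=> _ [].
Qed.

Lemma op_addn F G : comp_op F -> comp_op G ->
  comp_op (fun g n => F g n + G g n).
Proof.
apply: (@op_fun2 addn).
have : comp_fun (fun n => prec (L n) (fun _ r => r.+1) (R n)).
  apply: op_prec; [exact: op_left op_id|exact: op_right op_id|].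
  exact: op_succ (op_right (op_right op_id)).
move/op_ext; apply=> _ n.
by elim: (R n) => [|k IHk] /=; rewrite ?addn0 // addnS IHk.
Qed.

Lemma op_subn F G : comp_op F -> comp_op G ->
  comp_op (fun g n => F g n - G g n).
Proof.
apply: (@op_fun2 subn).
have : comp_fun (fun n => prec (L n) (fun _ r => r.-1) (R n)).
  apply: op_prec; [exact: op_left op_id|exact: op_right op_id|].
  exact: op_predn (op_right (op_right op_id)).
move/op_ext; apply=> _ n.
by elim: (R n) => [|k IHk] /=; rewrite ?subn0 // subnS IHk.
Qed.

Lemma op_muln F G : comp_op F -> comp_op G ->
  comp_op (fun g n => F g n * G g n).
Proof.
apply: (@op_fun2 muln).
have : comp_fun (fun n => prec 0 (fun _ r => L n + r) (R n)).
  apply: op_prec; [exact: op_const|exact: op_right op_id|].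
  by apply: op_addn; [exact: op_left (op_left op_id)
    |exact: op_right (op_right op_id)].
move/op_ext; apply=> _ n.
by elim: (R n) => [|k IHk] /=; rewrite ?muln0 // mulnS IHk.
Qed.

Lemma op_not (b : _ -> _ -> bool) : comp_op (fun g n => b g n) ->
  comp_op (fun g n => ~~ b g n).
Proof.
move=> bop; have : comp_op (fun g n => 1 - b g n).
  by apply: op_subn => //; exact: op_const.
by move/op_ext; apply=> g n; case: (b g n).
Qed.

Lemma op_and (b c : _ -> _ -> bool) : comp_op (fun g n => b g n) ->
  comp_op (fun g n => c g n) -> comp_op (fun g n => b g n && c g n).
Proof.
move=> bop cop; have := op_muln bop cop.
by move/op_ext; apply=> g n; rewrite mulnb.
Qed.

Lemma op_or (b c : _ -> _ -> bool) : comp_op (fun g n => b g n) ->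
  comp_op (fun g n => c g n) -> comp_op (fun g n => b g n || c g n).
Proof.
move=> bop cop; have := op_not (op_and (op_not bop) (op_not cop)).
by move/op_ext; apply=> g n; rewrite negb_and !negbK.
Qed.

Lemma op_eq0 F : comp_op F -> comp_op (fun g n => F g n == 0).
Proof.
move=> Fop; have : comp_op (fun g n => 1 - F g n).
  by apply: op_subn => //; exact: op_const.
by move/op_ext; apply=> g n; case: (F g n).
Qed.

Lemma op_leq F G : comp_op F -> comp_op G ->
  comp_op (fun g n => F g n <= G g n).
Proof. by move=> Fop Gop; exact: op_eq0 (op_subn Fop Gop). Qed.

Lemma op_eq F G : comp_op F -> comp_op G ->
  comp_op (fun g n => F g n == G g n).
Proof.
move=> Fop Gop; have := op_and (op_leq Fop Gop) (op_leq Gop Fop).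
by move/op_ext; apply=> g n; rewrite -eqn_leq.
Qed.

Lemma op_beq (b c : _ -> _ -> bool) : comp_op (fun g n => b g n) ->
  comp_op (fun g n => c g n) -> comp_op (fun g n => b g n == c g n).
Proof.
move=> bop cop; have := op_eq bop cop.
by move/op_ext; apply=> g n; case: (b g n); case: (c g n).
Qed.

Lemma op_expn F G : comp_op F -> comp_op G ->
  comp_op (fun g n => F g n ^ G g n).
Proof.
apply: (@op_fun2 expn).
have : comp_fun (fun n => prec 1 (fun _ r => L n * r) (R n)).
  apply: op_prec; [exact: op_const|exact: op_right op_id|].
  by apply: op_muln; [exact: op_left (op_left op_id)
    |exact: op_right (op_right op_id)].
move/op_ext; apply=> _ n.
by elim: (R n) => [|k IHk] /=; rewrite ?expn0 // expnS IHk.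
Qed.

Lemma op_odd F : comp_op F -> comp_op (fun g n => odd (F g n)).
Proof.
apply: (@op_fun (fun n => odd n)).
have : comp_fun (fun n => prec 0 (fun _ r => 1 - r) n).
  apply: op_prec; [exact: op_const|exact: op_id|].
  apply: op_subn; first exact: op_const.
  exact: op_right (op_right op_id).
move/op_ext; apply=> _.
by elim=> [|k IHk] //=; rewrite IHk; case: odd.
Qed.

Lemma op_half F : comp_op F -> comp_op (fun g n => (F g n)./2).
Proof.
apply: (@op_fun half).
have : comp_fun (fun n => prec 0 (fun k r => odd k + r) n).
  apply: op_prec; [exact: op_const|exact: op_id|].
  apply: op_addn; first exact: op_odd (op_left (op_right op_id)).
  exact: op_right (op_right op_id).
move/op_ext; apply=> _.
by elim=> [|k IHk] //=; rewrite IHk uphalf_half.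
Qed.

Lemma op_iter S F K : comp_op F -> comp_op K ->
  comp_op (fun g z => S g (L z) (R z)) ->
  comp_op (fun g n => iter (K g n) (S g n) (F g n)).
Proof.
move=> Fop Kop Sop.
have : comp_op (fun g n => prec (F g n) (fun _ r => S g n r) (K g n)).
  apply: op_prec => //.
  have zop : comp_op (fun _ z => npair (L z) (R (R z))).
    apply: op_pair; first exact: op_left op_id.
    exact: op_right (op_right op_id).
  apply: (op_ext (op_comp Sop zop)).
  by move=> g n; rewrite !npairE.
move/op_ext; apply=> g n.
by elim: (K g n) => //= k ->.
Qed.

Definition ball (n : nat) (P : nat -> bool) : bool := all P (iota 0 n).
Definition bex (n : nat) (P : nat -> bool) : bool := has P (iota 0 n).

Lemma ballP n (P : nat -> bool) : reflect (forall k, k < n -> P k) (ball n P).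
Proof.
apply: (iffP allP) => PP k; first by move=> kn; apply: PP; rewrite mem_iota.
by rewrite mem_iota => /PP.
Qed.

Lemma bexP n (P : nat -> bool) : reflect (exists2 k, k < n & P k) (bex n P).
Proof.
apply: (iffP hasP) => -[k kn Pk]; exists k => //; last by rewrite mem_iota.
by move: kn; rewrite mem_iota.
Qed.

Lemma ballS n (P : nat -> bool) : ball n.+1 P = ball n P && P n.
Proof. by rewrite /ball -addn1 iotaD all_cat /= andbT. Qed.

Lemma op_ball K (P : _ -> _ -> _ -> bool) : comp_op K ->
  comp_op (fun g z => P g (L z) (R z)) ->
  comp_op (fun g n => ball (K g n) (P g n)).
Proof.
move=> Kop Pop.
have : comp_op (fun g n => prec true (fun k r => P g n k * r) (K g n)).
  apply: op_prec => //; first exact: op_const.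
  have zop : comp_op (fun _ z => npair (L z) (L (R z))).
    apply: op_pair; first exact: op_left op_id.
    exact: op_left (op_right op_id).
  apply: (op_ext (op_muln (op_comp Pop zop) (op_right (op_right op_id)))).
  by move=> g n; rewrite !npairE.
move/op_ext; apply=> g n.
elim: (K g n) => //= k ->.
by rewrite ballS mulnb andbC.
Qed.

Lemma op_bex K (P : _ -> _ -> _ -> bool) : comp_op K ->
  comp_op (fun g z => P g (L z) (R z)) ->
  comp_op (fun g n => bex (K g n) (P g n)).
Proof.
move=> Kop Pop; have := op_not (@op_ball _ (fun g n k => ~~ P g n k) Kop (op_not Pop)).
move/op_ext; apply=> g n.
rewrite /ball /bex -[in RHS](negbK (has _ _)) -all_predC.
by congr (nat_of_bool (~~ _)).
Qed.

Create HintDb comp.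

(** Syntax-directed: the head symbol selects the closure lemma, and named functions of up to four
    arguments are looked up in the hint database. Conditionals and calls to the oracle [g] come last
    and are left to unification. *)
Ltac comp_step :=
  match goal with
  | |- comp_op (fun g n => n) => exact op_id
  | |- comp_op (fun g n => ?k) => exact (op_const k)
  | |- comp_op (fun g n => npair (@?F g n) (@?G g n)) =>
      refine (@op_pair F G _ _)
  | |- comp_op (fun g n => (nunpair (@?F g n)).1) => refine (@op_left F _)
  | |- comp_op (fun g n => (nunpair (@?F g n)).2) => refine (@op_right F _)
  | |- comp_op (fun g n => S (@?F g n)) => refine (@op_succ F _)
  | |- comp_op (fun g n => predn (@?F g n)) => refine (@op_predn F _)
  | |- comp_op (fun g n => addn (@?F g n) (@?G g n)) =>
      refine (@op_addn F G _ _)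
  | |- comp_op (fun g n => subn (@?F g n) (@?G g n)) =>
      refine (@op_subn F G _ _)
  | |- comp_op (fun g n => muln (@?F g n) (@?G g n)) =>
      refine (@op_muln F G _ _)
  | |- comp_op (fun g n => expn (@?F g n) (@?G g n)) =>
      refine (@op_expn F G _ _)
  | |- comp_op (fun g n => half (@?F g n)) => refine (@op_half F _)
  | |- comp_op (fun g n => iter (@?K g n) (@?S g n) (@?F g n)) =>
      refine (@op_iter S F K _ _ _)
  | |- comp_op (fun g n => prec (@?F g n) (@?S g n) (@?K g n)) =>
      refine (@op_prec F S K _ _ _)
  | |- comp_op (fun g n => ncase (@?A g n) (@?F g n) (@?C g n)) =>
      refine (@op_ncase A F C _ _ _)
  | |- comp_op (fun g n => nat_of_bool (~~ (@?b g n))) =>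
      refine (@op_not b _)
  | |- comp_op (fun g n => nat_of_bool (andb (@?b g n) (@?c g n))) =>
      refine (@op_and b c _ _)
  | |- comp_op (fun g n => nat_of_bool (orb (@?b g n) (@?c g n))) =>
      refine (@op_or b c _ _)
  | |- comp_op (fun g n => nat_of_bool (odd (@?F g n))) =>
      refine (@op_odd F _)
  | |- comp_op (fun g n => nat_of_bool (leq (@?F g n) (@?G g n))) =>
      refine (@op_leq F G _ _)
  | |- comp_op (fun g n => nat_of_bool (@eq_op _ (@?F g n) (@?G g n))) =>
      first [refine (@op_eq F G _ _) | refine (@op_beq F G _ _)]
  | |- comp_op (fun g n => nat_of_bool (ball (@?K g n) (@?P g n))) =>
      refine (@op_ball K P _ _)
  | |- comp_op (fun g n => nat_of_bool (bex (@?K g n) (@?P g n))) =>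
      refine (@op_bex K P _ _)
  | |- comp_op (fun g n => nat_of_bool (?f (@?F g n))) =>
      refine (@op_fun (fun x => nat_of_bool (f x)) F _ _);
      [solve [trivial with comp] | ..]
  | |- comp_op (fun g n => nat_of_bool (?f (@?F g n) (@?G g n))) =>
      refine (@op_fun2 (fun x y => nat_of_bool (f x y)) F G _ _ _);
      [solve [trivial with comp] | ..]
  | |- comp_op (fun g n => nat_of_bool (?f (@?F g n) (@?G g n) (@?H g n))) =>
      refine (@op_fun3 (fun x y z => nat_of_bool (f x y z)) F G H _ _ _ _);
      [solve [trivial with comp] | ..]
  | |- comp_op (fun g n =>
         nat_of_bool (?f (@?F g n) (@?G g n) (@?H g n) (@?K g n))) =>
      refine (@op_fun4 (fun x y z t => nat_of_bool (f x y z t)) F G H K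
        _ _ _ _ _); [solve [trivial with comp] | ..]
  | |- comp_op (fun g n => ?f (@?F g n)) =>
      refine (@op_fun f F _ _); [solve [trivial with comp] | ..]
  | |- comp_op (fun g n => ?f (@?F g n) (@?G g n)) =>
      refine (@op_fun2 f F G _ _ _); [solve [trivial with comp] | ..]
  | |- comp_op (fun g n => ?f (@?F g n) (@?G g n) (@?H g n)) =>
      refine (@op_fun3 f F G H _ _ _ _); [solve [trivial with comp] | ..]
  | |- comp_op (fun g n => ?f (@?F g n) (@?G g n) (@?H g n) (@?K g n)) =>
      refine (@op_fun4 f F G H K _ _ _ _ _); [solve [trivial with comp] | ..]
  | |- _ => first [refine (op_if _ _ _) | refine (op_oracle _)]
  end; cbv beta.

Ltac comp := unfold comp_fun; cbv beta; repeat comp_step.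

(** * A universal machine *)

(** States of a stack machine: [ev] is about to run a program, [ret] hands a value to the stack [K].
    A frame has a tag and data: 0 and 1 wait for the first and the second component of a [PPair], 2
    for the inner value of a [PComp], 3 for the previous value of a [PRec], 4 for a test of a [PMu].
    The empty stack is [0]. *)
Definition ev (p n K : nat) : nat := npair 0 (npair p (npair n K)).
Definition ret (m K : nat) : nat := npair 1 (npair m K).
Definition push (t a K : nat) : nat := (npair (npair t a) K).+1.

Definition step_ev (p n K : nat) : nat :=
  if L p == 0 then ret 0 K else if L p == 1 then ret n.+1 K
  else if L p == 2 then ret (L n) K else if L p == 3 then ret (R n) K
  else if L p == 4 then ev (L (R p)) n (push 0 (npair (R (R p)) n) K)
  else if L p == 5 then ev (R (R p)) n (push 2 (L (R p)) K)
  else if L p == 6 then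
    ncase (R n) (ev (L (R p)) (L n) K)
      (fun k => ev p (npair (L n) k)
                  (push 3 (npair (R (R p)) (npair (L n) k)) K))
  else ev (R p) (npair n 0) (push 4 (npair (R p) (npair n 0)) K).

Definition step_ret (m F K : nat) : nat :=
  if L F == 0 then ev (L (R F)) (R (R F)) (push 1 m K)
  else if L F == 1 then ret (npair (R F) m) K
  else if L F == 2 then ev (R F) m K
  else if L F == 3 then
    ev (L (R F)) (npair (L (R (R F))) (npair (R (R (R F))) m)) K
  else ncase m (ret (R (R (R F))) K)
    (fun _ => ev (L (R F)) (npair (L (R (R F))) (R (R (R F))).+1)
       (push 4 (npair (L (R F)) (npair (L (R (R F))) (R (R (R F))).+1)) K)).

Definition step (s : nat) : nat :=
  if L s == 0 then step_ev (L (R s)) (L (R (R s))) (R (R (R s)))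
  else ncase (R (R s)) s (fun K => step_ret (L (R s)) (L K) (R K)).

Definition halted (s : nat) : bool := (L s != 0) && (R (R s) == 0).

(* Here [c] is the code of a program, [n] its input and [k] a number of steps. *)
Definition run (c n k : nat) : nat := iter k step (ev c n 0).
Definition stops (c n k : nat) : bool := halted (run c n k).
Definition outp (c n k : nat) : nat := L (R (run c n k)).

Lemma comp_step_ev :
  comp_fun (fun z => step_ev (L z) (L (R z)) (R (R z))).
Proof. rewrite /step_ev /ev /ret /push; comp. Qed.

Lemma comp_step_ret :
  comp_fun (fun z => step_ret (L z) (L (R z)) (R (R z))).
Proof. rewrite /step_ret /ev /ret /push; comp. Qed.
#[global] Hint Resolve comp_step_ev comp_step_ret : comp.

Lemma comp_run : comp_fun (fun z => run (L z) (L (R z)) (R (R z))).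
Proof. rewrite /run /step /ev; comp. Qed.
#[global] Hint Resolve comp_run : comp.

Lemma comp_stops : comp_fun (fun z => stops (L z) (L (R z)) (R (R z))).
Proof. rewrite /stops /halted; comp. Qed.

Lemma comp_outp : comp_fun (fun z => outp (L z) (L (R z)) (R (R z))).
Proof. rewrite /outp; comp. Qed.
#[global] Hint Resolve comp_stops comp_outp : comp.

Lemma step_evE p n K : step (ev (code_prog p) n K) =
  match p with
  | PZero => ret 0 K
  | PSucc => ret n.+1 K
  | PLeft => ret (L n) K
  | PRight => ret (R n) K
  | PPair f g =>
      ev (code_prog f) n (push 0 (npair (code_prog g) n) K)
  | PComp f g => ev (code_prog g) n (push 2 (code_prog f) K)
  | PRec f g =>
      if R n is k.+1 then
        ev (code_prog p) (npair (L n) k)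
          (push 3 (npair (code_prog g) (npair (L n) k)) K)
      else ev (code_prog f) (L n) K
  | PMu f =>
      ev (code_prog f) (npair n 0)
        (push 4 (npair (code_prog f) (npair n 0)) K)
  end.
Proof.
rewrite /step /ev !npairE eqxx -/(ev _ _ _) /step_ev.
by case: p => [||||f g|f g|f g|f] /=; rewrite ?npairE //=; case: (R n).
Qed.

Lemma step_retE m t a K : step (ret m (push t a K)) = step_ret m (npair t a) K.
Proof. by rewrite /step /ret /push !npairE /= !npairE. Qed.

Lemma halted_ev p n K : halted (ev p n K) = false.
Proof. by rewrite /halted /ev npairE eqxx. Qed.

Lemma halted_push m t a K : halted (ret m (push t a K)) = false.
Proof. by rewrite /halted /ret /push !npairE. Qed.

Lemma halted_ret m : halted (ret m 0).
Proof. by rewrite /halted /ret !npairE. Qed.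

Lemma step_halted s : halted s -> step s = s.
Proof.
by rewrite /step /halted => /andP[/negbTE -> /eqP ->].
Qed.

Lemma iter_halted k s : halted s -> iter k step s = s.
Proof. by move=> hs; elim: k => //= k ->; exact: step_halted. Qed.

Definition reaches (s s' : nat) : Prop := exists k, iter k step s = s'.

Lemma reaches_trans s2 s1 s3 : reaches s1 s2 -> reaches s2 s3 -> reaches s1 s3.
Proof. by move=> [k <-] [l <-]; exists (l + k); rewrite iterD. Qed.

Lemma reaches_step s s' : reaches (step s) s' -> reaches s s'.
Proof. by move=> [k <-]; exists k.+1; rewrite iterSr. Qed.

Lemma eval_reaches p n m K :
  eval p n m -> reaches (ev (code_prog p) n K) (ret m K).
Proof.
elim: p n m K => [||||f IHf g IHg|f IHf g IHg|f IHf g IHg|f IHf] n m K.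
- by move=> /= ->; exists 1; exact: (step_evE PZero).
- by move=> /= ->; exists 1; exact: (step_evE PSucc).
- by move=> /= ->; exists 1; exact: (step_evE PLeft).
- by move=> /= ->; exists 1; exact: (step_evE PRight).
- move=> [a [b [fa gb ->]]]; apply: reaches_step; rewrite step_evE.
  apply: reaches_trans (IHf _ _ _ fa) _; apply: reaches_step.
  rewrite step_retE /step_ret !npairE /=.
  apply: reaches_trans (IHg _ _ _ gb) _; apply: reaches_step.
  by rewrite step_retE /step_ret !npairE /=; exists 0.
- move=> [k gk fk]; apply: reaches_step; rewrite step_evE.
  apply: reaches_trans (IHg _ _ _ gk) _; apply: reaches_step.
  by rewrite step_retE /step_ret !npairE /=; exact: IHf.
- rewrite -(nunpairK n); elim: (R n) m K => [|k IHk] m K.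
    rewrite eval_rec !npairE => fm; apply: reaches_step.
    by rewrite step_evE !npairE; exact: IHf.
  rewrite eval_rec !npairE => -[i hi gm]; apply: reaches_step.
  rewrite step_evE !npairE.
  apply: reaches_trans (IHk _ _ hi) _; apply: reaches_step.
  by rewrite step_retE /step_ret !npairE /=; exact: IHg.
- move=> [fm flt]; apply: reaches_step; rewrite step_evE.
  have loop j : j <= m ->
      reaches (ev (code_prog f) (npair n 0)
                (push 4 (npair (code_prog f) (npair n 0)) K))
              (ev (code_prog f) (npair n j)
                (push 4 (npair (code_prog f) (npair n j)) K)).
    elim: j => [|j IHj] lt_jm; first by exists 0.
    apply: reaches_trans (IHj (ltnW lt_jm)) _.
    have [r fr] := flt _ lt_jm.
    apply: reaches_trans (IHf _ _ _ fr) _; apply: reaches_step.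
    by rewrite step_retE /step_ret !npairE /=; exists 0.
  apply: reaches_trans (loop m (leqnn m)) _.
  apply: reaches_trans (IHf _ _ _ fm) _; apply: reaches_step.
  by rewrite step_retE /step_ret !npairE /=; exists 0.
Qed.

(** Induction on the number of steps. The strict inequality [l < k] for the part of the run that
    remains after [p] has returned makes the induction hypothesis available for the next
    subprogram. *)
Lemma halted_eval k p n K : halted (iter k step (ev (code_prog p) n K)) ->
  exists m l, [/\ l < k, eval p n m & halted (iter l step (ret m K))].
Proof.
elim/ltn_ind: k p n K => k IH p n K.
case: k IH => [|k] IH; first by rewrite /= halted_ev.
rewrite iterSr step_evE.
case: p => [||||f g|f g|f g|f] => hk.
- by exists 0, k.
- by exists n.+1, k.
- by exists (L n), k.
- by exists (R n), k.
- have [a [l [ltlk fa]]] := IH k (ltnSn k) _ _ _ hk.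
  case: l ltlk => [|l] ltlk; first by rewrite /= halted_push.
  rewrite iterSr step_retE /step_ret !npairE /= => hl.
  have [|b [l' [ltl'l gb]]] := IH l _ _ _ _ hl; first lia.
  case: l' ltl'l => [|l'] ltl'l; first by rewrite /= halted_push.
  rewrite iterSr step_retE /step_ret !npairE /= => hl'.
  exists (npair a b), l'; split=> //; first lia.
  by exists a, b.
- have [a [l [ltlk ga]]] := IH k (ltnSn k) _ _ _ hk.
  case: l ltlk => [|l] ltlk; first by rewrite /= halted_push.
  rewrite iterSr step_retE /step_ret !npairE /= => hl.
  have [|b [l' [ltl'l fb hl']]] := IH l _ _ _ _ hl; first lia.
  exists b, l'; split=> //; first lia.
  by exists a.
- rewrite -(nunpairK n) in hk *; move: hk; rewrite !npairE.
  case En : (R n) => [|j] hk.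
    have [a [l [ltlk fa hl]]] := IH k (ltnSn k) _ _ _ hk.
    exists a, l; split=> //; first lia.
    by rewrite eval_rec !npairE.
  have [a [l [ltlk fa]]] := IH k (ltnSn k) _ _ _ hk.
  case: l ltlk => [|l] ltlk; first by rewrite /= halted_push.
  rewrite iterSr step_retE /step_ret !npairE /= => hl.
  have [|b [l' [ltl'l gb hl']]] := IH l _ _ _ _ hl; first lia.
  exists b, l'; split=> //; first lia.
  by apply/eval_rec; rewrite !npairE; exists a.
- have loop l j : l <= k -> (forall i, i < j -> exists r, eval f (npair n i) r.+1) ->
      halted (iter l step (ev (code_prog f) (npair n j)
                (push 4 (npair (code_prog f) (npair n j)) K))) ->
      exists m l', [/\ l' < k.+1, eval (PMu f) n m
                     & halted (iter l' step (ret m K))].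
    elim/ltn_ind: l j => l IHl j lelk fj hl.
    have [|a [l1 [ltl1 fa]]] := IH l _ _ _ _ hl; first lia.
    case: l1 ltl1 => [|l1] ltl1; first by rewrite /= halted_push.
    rewrite iterSr step_retE /step_ret !npairE /=.
    case: a fa => [|a] fa /= hl1.
      by exists j, l1; split=> //; first lia.
    apply: (IHl l1 _ j.+1) => //; try lia.
    move=> i; rewrite ltnS leq_eqVlt => /orP[/eqP ->|]; last exact: fj.
    by exists a.
  exact: (loop k 0).
Qed.

Lemma stopsP p n m :
  eval p n m <-> exists2 k, stops (code_prog p) n k & outp (code_prog p) n k = m.
Proof.
have fwd m' : eval p n m' -> exists k, run (code_prog p) n k = ret m' 0.
  by move=> /(eval_reaches 0).
split=> [/fwd[k rk]|[k sk <-]].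
  exists k; rewrite /stops /outp rk ?halted_ret //.
  by rewrite /ret !npairE.
have [m' [l [_ em' _]]] := halted_eval sk.
have [k' rk'] := fwd _ em'.
suff -> : outp (code_prog p) n k = m' by [].
rewrite /outp; suff -> : run (code_prog p) n k = ret m' 0.
  by rewrite /ret !npairE.
rewrite -(iter_halted k' sk) /run -iterD addnC iterD -/(run _ _ _) rk'.
exact: iter_halted (halted_ret m').
Qed.

Lemma stops_mono c n k k' : k <= k' -> stops c n k -> stops c n k'.
Proof.
move=> le_kk' sk; rewrite /stops /run -(subnK le_kk') iterD.
by rewrite iter_halted.
Qed.

Lemma outp_stable c n k k' : stops c n k -> stops c n k' ->
  outp c n k = outp c n k'.
Proof.
wlog le_kk' : k k' / k <= k'.
  by move=> W; case: (leqP k k') => [/W//|/ltnW/W H sk sk']; rewrite H.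
by move=> sk _; rewrite /outp /run -(subnK le_kk') iterD (iter_halted _ sk).
Qed.

Lemma eval_mu p t n m : (forall z, eval p z (t z)) ->
  eval (PMu p) n m <->
  t (npair n m) = 0 /\ forall k, k < m -> t (npair n k) <> 0.
Proof.
move=> pt; split=> /= -[t0 tlt].
  split=> [|k ltkm]; first exact: eval_fun t0.
  by have [r /(eval_fun (pt _)) ->] := tlt k ltkm.
split=> [|k ltkm]; first by rewrite -t0.
by exists (t (npair n k)).-1; case: (t _) (tlt k ltkm) (pt (npair n k)).
Qed.

Lemma search (P : nat -> nat -> bool) :
  comp_fun (fun z => P (L z) (R z)) -> exists p,
  (forall n, halts p n <-> exists k, P n k) /\
  (forall n m, eval p n m -> P n m).
Proof.
move=> /op_not/comp_funP[p pP]; exists (PMu p); split=> [n|n m].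
  split=> [[m /(eval_mu _ _ pP)]|ex].
    by rewrite !npairE => -[Pm _]; exists m; case: (P n m) Pm.
  exists (ex_minn ex); apply/(eval_mu _ _ pP); rewrite !npairE.
  case: ex_minnP => m Pm minm; split=> [|k ltkm]; first by rewrite Pm.
  rewrite !npairE; case E: (P n k) => //.
  by have := minm _ E; rewrite leqNgt ltkm.
by move=> /(eval_mu _ _ pP); rewrite !npairE => -[Pm _]; case: (P n m) Pm.
Qed.

Lemma universal : exists u,
  forall p n m, eval p n m <-> eval u (npair (code_prog p) n) m.
Proof.
have sop : comp_fun (fun z => stops (L (L z)) (R (L z)) (R z)) by comp.
have [q [qh qs]] := @search (fun z k => stops (L z) (R z) k) sop.
have [o oP] : exists o, forall z, eval o z (outp (L (L z)) (R (L z)) (R z)).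
  by apply/comp_funP; comp.
pose u := PComp o (PPair pid q).
have uE z m : eval u z m <->
    exists2 k, eval q z k & outp (L z) (R z) k = m.
  split=> [[w [a [k [/= az qk ->]]]]|[k qk <-]].
    rewrite -(eval_fun (eval_pid z) az) => om; exists k => //.
    by have := eval_fun om (oP _); rewrite !npairE.
  exists (npair z k); first by exists z, k; split=> //; exact: eval_pid.
  by have := oP (npair z k); rewrite !npairE.
exists u => p n m; rewrite uE stopsP; split=> -[k sk om].
  have : halts q (npair (code_prog p) n).
    by apply/qh; exists k; rewrite !npairE.
  move=> [k' qk']; exists k' => //; rewrite !npairE -om.
  by apply: outp_stable sk; have := qs _ _ qk'; rewrite !npairE.
by exists k; [have := qs _ _ sk|]; move: om; rewrite !npairE.
Qed.

(* Recursion on the fuel [k], with arbitrary calls at fuel [k.-1]; the value is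
   [0] when the fuel is exhausted. *)
Definition frec (F : (nat -> nat) -> nat -> nat) (k x : nat) : nat :=
  iter k F (fun=> 0) x.
#[global] Arguments frec : simpl never.

Lemma frecS F k x : frec F k.+1 x = F (frec F k) x.
Proof. by []. Qed.

(** A program for the [k]-th iterate is [B] applied [k] times. Its code is obtained by primitive
    recursion from [c], and the universal machine runs it; this is why [comp_op] asks for [c] as
    well as for [B]. *)
Lemma comp_frec F : comp_op F -> comp_fun (fun z => frec F (L z) (R z)).
Proof.
move=> [B [c [cB BP]]]; have [u uP] := universal; apply/comp_funP.
have cop : comp_fun (fun n => code_prog PZero) by exact: op_const.
pose h k := iter k B PZero.
have hP k x : eval (h k) x (frec F k x).
  by elim: k x => [|k IHk] x //; exact: BP.
pose r := PRec (kprog (code_prog PZero)) (PComp c (PComp PRight PRight)).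
have rP k : eval r (npair 0 k) (code_prog (h k)).
  elim: k => [|k IHk]; rewrite eval_rec !npairE; first exact: eval_kprog.
  eexists; first exact: IHk.
  exists (code_prog (h k)); last exact: cB.
  by exists (npair k (code_prog (h k))); rewrite /= !npairE.
exists (PComp u (PPair (PComp r (PPair PZero PLeft)) PRight)) => z.
exists (npair (code_prog (h (L z))) (R z)); last exact: (uP _ _ _).1 (hP _ _).
exists (code_prog (h (L z))), (R z); split=> //.
by exists (npair 0 (L z)) => //; exists 0, (L z).
Qed.

#[global] Opaque frec.

Ltac comp_frec := match goal with
  | |- comp_op (fun g n => frec ?F (@?K g n) (@?G g n)) =>
    refine (@op_fun2 (frec F) K G (comp_frec _) _ _);
    [solve [trivial with comp] | ..]; cbv beta
  end.

Ltac comp ::= unfold comp_fun; cbv beta; repeat first [comp_frec | comp_step].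

(** * Syntax *)

Fixpoint forall_terms (P : term -> Prop) (ts : seq term) : Prop :=
  if ts is t :: ts' then P t /\ forall_terms P ts' else True.

Lemma nested_term_ind (P : term -> Prop) :
  (forall x, P (Var x)) ->
  (forall f ts, forall_terms P ts -> P (Fun f ts)) -> forall t, P t.
Proof.
move=> PV PF; fix IH 1 => -[x|f ts]; first exact: PV.
apply: PF; elim: ts => [|t ts IHts]; first exact: I.
by split; [exact: IH|exact: IHts].
Qed.

Lemma eq_map_terms T (f g : term -> T) ts :
  forall_terms (fun t => f t = g t) ts -> map f ts = map g ts.
Proof. by elim: ts => //= t ts IH [-> /IH ->]. Qed.

Lemma sub_terms (P Q : term -> Prop) ts :
  (forall t, P t -> Q t) -> forall_terms P ts -> forall_terms Q ts.
Proof. by move=> PQ; elim: ts => //= t ts IH [/PQ ? /IH]. Qed.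

Lemma all_terms (P : term -> Prop) (p : pred term) ts :
  forall_terms (fun t => p t -> P t) ts -> all p ts -> forall_terms P ts.
Proof. by elim: ts => //= t ts IH [pP /IH Ps] /andP[/pP ? /Ps]. Qed.

Lemma all_sub_terms (p q : pred term) ts :
  forall_terms (fun t => p t -> q t) ts -> all p ts -> all q ts.
Proof. by elim: ts => //= t ts IH [pq /IH IH'] /andP[/pq -> /IH']. Qed.

Lemma forall_terms_all (P : term -> Prop) ts :
  (forall t, P t) -> forall_terms P ts.
Proof. by move=> aP; elim: ts. Qed.

Lemma subst_term_comp s1 s2 t :
  subst_term s2 (subst_term s1 t) = subst_term (fun x => subst_term s2 (s1 x)) t.
Proof.
elim/nested_term_ind: t => //= f ts IH; congr Fun; rewrite -map_comp.
exact: eq_map_terms.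
Qed.

Lemma subst_term_id t : subst_term Var t = t.
Proof.
elim/nested_term_ind: t => //= f ts IH; congr Fun.
by rewrite -[RHS]map_id; exact: eq_map_terms.
Qed.

Lemma up_comp s1 s2 :
  (fun x => subst_term (up s2) (up s1 x)) = up (fun x => subst_term s2 (s1 x)).
Proof.
apply: functional_extensionality => -[|x] //=.
by rewrite /lift_term !subst_term_comp.
Qed.

Lemma up_Var : up Var = Var.
Proof. by apply: functional_extensionality => -[]. Qed.

Lemma map_subst_comp s1 s2 ts : map (subst_term s2) (map (subst_term s1) ts) =
  map (subst_term (fun x => subst_term s2 (s1 x))) ts.
Proof. by rewrite -map_comp; apply: eq_map => t /=; exact: subst_term_comp. Qed.

Lemma subst_form_comp s1 s2 phi :
  subst_form s2 (subst_form s1 phi) =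
  subst_form (fun x => subst_term s2 (s1 x)) phi.
Proof.
elim: phi s1 s2 => [|s t|r ts|p IHp q IHq|p IHp] s1 s2 //=.
- by rewrite !subst_term_comp.
- by rewrite map_subst_comp.
- by rewrite IHp IHq.
- by rewrite IHp up_comp.
Qed.

Lemma subst_form_id phi : subst_form Var phi = phi.
Proof.
elim: phi => [|s t|r ts|p IHp q IHq|p IHp] //=.
- by rewrite !subst_term_id.
- by rewrite (eq_map subst_term_id) map_id.
- by rewrite IHp IHq.
- by rewrite up_Var IHp.
Qed.

Lemma subst_lift s phi :
  subst_form (up s) (lift_form phi) = lift_form (subst_form s phi).
Proof. by rewrite /lift_form !subst_form_comp. Qed.

Lemma subst_subst0 s t phi :
  subst_form s (subst0 t phi) = subst0 (subst_term s t) (subst_form (up s) phi).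
Proof.
rewrite /subst0 !subst_form_comp; congr subst_form.
apply: functional_extensionality => -[|x] //=.
by rewrite /lift_term subst_term_comp subst_term_id.
Qed.

Definition sub_in (S : signature) (s : nat -> term) : Prop :=
  forall x, term_in S (s x).

Lemma term_in_subst S s t : sub_in S s ->
  term_in S t -> term_in S (subst_term s t).
Proof.
move=> sS; elim/nested_term_ind: t => //= f ts IH /andP[fS tsS].
by rewrite size_map fS /= all_map; apply: all_sub_terms tsS.
Qed.

Lemma up_in S s : sub_in S s -> sub_in S (up s).
Proof. by move=> sS [|x] //=; exact: term_in_subst. Qed.

Lemma form_in_subst S s phi : sub_in S s ->
  form_in S phi -> form_in S (subst_form s phi).
Proof.
have all_in s' ts : sub_in S s' -> all (term_in S) ts ->
    all (term_in S) (map (subst_term s') ts).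
  move=> sS; rewrite all_map; apply: all_sub_terms.
  by apply: forall_terms_all => t; exact: term_in_subst.
elim: phi s => [|u v|r ts|p IHp q IHq|p IHp] s sS //=.
- by move=> /andP[uS vS]; rewrite !term_in_subst.
- by move=> /andP[rS tsS]; rewrite size_map rS all_in.
- by move=> /andP[pS qS]; rewrite IHp // IHq.
- by apply: IHp; exact: up_in.
Qed.

Lemma eq_subst_term k s1 s2 t : (forall x, x < k -> s1 x = s2 x) ->
  term_bound k t -> subst_term s1 t = subst_term s2 t.
Proof.
move=> s12; elim/nested_term_ind: t => /= [x /s12 //|f ts IH kts].
by congr Fun; apply: eq_map_terms; apply: all_terms kts.
Qed.

Lemma eq_subst_form k s1 s2 phi : (forall x, x < k -> s1 x = s2 x) ->
  form_bound k phi -> subst_form s1 phi = subst_form s2 phi.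
Proof.
elim: phi k s1 s2 => [|u v|r ts|p IHp q IHq|p IHp] k s1 s2 s12 //=.
- by move=> /andP[ku kv]; rewrite !(eq_subst_term s12).
- move=> kts; congr Rel; apply: eq_map_terms; apply: all_terms kts.
  by apply: forall_terms_all => t; exact: eq_subst_term.
- by move=> /andP[kp kq]; rewrite (IHp k s1 s2) // (IHq k s1 s2).
- move=> kp; rewrite (IHp k.+1 (up s1) (up s2)) // => -[|x] //= lt_xk.
  by rewrite s12.
Qed.

Lemma subst_closed s phi : form_bound 0 phi -> subst_form s phi = phi.
Proof.
by move=> b; rewrite -[RHS]subst_form_id; apply: eq_subst_form b.
Qed.

Lemma term_bound_mono k l t : k <= l -> term_bound k t -> term_bound l t.
Proof.
move=> le_kl; elim/nested_term_ind: t => /= [x|f ts]; first lia.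
exact: all_sub_terms.
Qed.

Lemma form_bound_mono k l phi : k <= l -> form_bound k phi -> form_bound l phi.
Proof.
elim: phi k l => [|u v|r ts|p IHp q IHq|p IHp] k l le_kl //=.
- by move=> /andP[ku kv]; rewrite !(@term_bound_mono k l).
- apply: all_sub_terms; apply: forall_terms_all => t.
  exact: term_bound_mono.
- by move=> /andP[kp kq]; rewrite (IHp k) // (IHq k).
- exact: IHp.
Qed.

Lemma terms_bound_ex ts :
  forall_terms (fun t => exists k, term_bound k t) ts ->
  exists k, all (term_bound k) ts.
Proof.
elim: ts => [|t ts IH] /=; first by exists 0.
move=> [[k kt] /IH[l lts]]; exists (maxn k l).
rewrite (term_bound_mono (leq_maxl k l) kt) /=.
apply: all_sub_terms lts; apply: forall_terms_all => u.
exact: term_bound_mono (leq_maxr k l).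
Qed.

Lemma term_bound_ex t : exists k, term_bound k t.
Proof.
elim/nested_term_ind: t => [x|f ts] /=; first by exists x.+1.
exact: terms_bound_ex.
Qed.

Lemma form_bound_ex phi : exists k, form_bound k phi.
Proof.
elim: phi => [|u v|r ts|p [k kp] q [l lq]|p [k kp]] /=.
- by exists 0.
- have [k ku] := term_bound_ex u; have [l lv] := term_bound_ex v.
  exists (maxn k l); rewrite (term_bound_mono _ ku) ?leq_maxl //.
  exact: term_bound_mono (leq_maxr k l) lv.
- exact: terms_bound_ex (forall_terms_all _ term_bound_ex).
- exists (maxn k l); rewrite (form_bound_mono _ kp) ?leq_maxl //.
  exact: form_bound_mono (leq_maxr k l) lq.
- by exists k; apply: form_bound_mono kp.
Qed.

Lemma forms_bound_ex (G : seq form) : exists k, all (form_bound k) G.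
Proof.
elim: G => [|phi G [k kG]]; first by exists 0.
have [l lp] := form_bound_ex phi; exists (maxn l k) => /=.
rewrite (form_bound_mono (leq_maxl l k) lp) /=; apply: sub_all kG => psi.
exact: form_bound_mono (leq_maxr l k).
Qed.

(** * Derivations *)

Section Derivations.
Variable S : signature.

Lemma prv_weaken G H phi :
  (forall psi, List.In psi G -> List.In psi H) -> prv S G phi -> prv S H phi.
Proof.
move=> GH Gp; elim: Gp H GH => {G phi}.
- by move=> G phi Gp H GH; apply: prv_ax; exact: GH.
- move=> G phi psi phiS _ IH H GH; apply: prv_impI => //; apply: IH => chi /=.
  by move=> [->|/GH]; [left|right].
- by move=> G phi psi _ IH1 _ IH2 H GH; apply: prv_impE (IH1 _ GH) (IH2 _ GH).
- by move=> G phi _ IH H GH; apply: prv_dne; exact: IH.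
- move=> G phi _ IH H GH; apply: prv_allI; apply: IH => chi.
  by move=> /List.in_map_iff[psi [<- /GH]]; exact: List.in_map.
- by move=> G phi t tS _ IH H GH; apply: prv_allE => //; exact: IH.
- by move=> G t tS H GH; exact: prv_eqI.
- move=> G phi s t phiS _ IH1 _ IH2 H GH.
  by apply: prv_eqE (IH1 _ GH) (IH2 _ GH).
Qed.

Lemma prv_subst s G phi : sub_in S s -> prv S G phi ->
  prv S (map (subst_form s) G) (subst_form s phi).
Proof.
move=> sS Gp; elim: Gp s sS => {G phi}.
- by move=> G phi Gp s sS; apply: prv_ax; exact: List.in_map.
- move=> G phi psi phiS _ IH s sS /=; apply: prv_impI; last exact: IH.
  exact: form_in_subst.
- by move=> G phi psi _ IH1 _ IH2 s sS; apply: prv_impE (IH1 _ sS) (IH2 _ sS).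
- by move=> G phi _ IH s sS; apply: prv_dne; exact: IH.
- move=> G phi _ IH s sS; apply: prv_allI; have := IH _ (up_in sS).
  congr prv; rewrite -!map_comp; apply: eq_map => psi /=.
  exact: subst_lift.
- move=> G phi t tS _ IH s sS; rewrite subst_subst0; apply: prv_allE.
    exact: term_in_subst.
  exact: IH.
- by move=> G t tS s sS; apply: prv_eqI; exact: term_in_subst.
- move=> G phi u v phiS _ IH1 _ IH2 s sS; rewrite subst_subst0.
  apply: prv_eqE (IH1 _ sS) _; last by rewrite -subst_subst0; exact: IH2.
  by apply: form_in_subst phiS; exact: up_in.
Qed.

(** Generalization on a named variable. The substitution [s] sends the fresh [k] to the variable
    about to be bound and shifts all others: it acts as [lift_form] on [G] and undoes the
    instantiation of [phi]. *)
Lemma prv_gen G phi k : all (form_bound k) G -> form_bound k.+1 phi ->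
  prv S G (subst0 (Var k) phi) -> prv S G (All phi).
Proof.
move=> kG kphi Gp; apply: prv_allI.
pose s x := if x == k then Var 0 else Var x.+1.
have sS : sub_in S s by move=> x; rewrite /s; case: ifP.
have := prv_subst sS Gp; congr prv.
  elim: {Gp} G kG => //= psi G IH /andP[kpsi /IH ->]; congr cons.
  by apply: eq_subst_form kpsi => x ltxk; rewrite /s ltn_eqF.
rewrite /subst0 subst_form_comp -[RHS]subst_form_id.
apply: eq_subst_form kphi => -[|x] /=; first by rewrite /s eqxx.
by rewrite ltnS => ltxk; rewrite /s ltn_eqF.
Qed.

Lemma prv_botE G phi : form_in S phi -> prv S G Bot -> prv S G phi.
Proof.
move=> phiS Gb; apply: prv_dne; apply: prv_impI; first by rewrite /= phiS.
by apply: prv_weaken Gb => psi; right.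
Qed.

Lemma prv_ax0 G phi : prv S (phi :: G) phi.
Proof. by apply: prv_ax; left. Qed.

End Derivations.

(** * Structures *)

(* Equality is interpreted by an arbitrary congruence, which saves us from
   taking quotients. *)
Record structure : Type := Structure {
  carrier :> Type;
  eqs : carrier -> carrier -> Prop;
  funs_of : nat -> seq carrier -> carrier;
  rels_of : nat -> seq carrier -> Prop
}.

Fixpoint eqs_seq (M : structure) (xs ys : seq M) : Prop :=
  match xs, ys with
  | [::], [::] => True
  | x :: xs', y :: ys' => eqs x y /\ eqs_seq xs' ys'
  | _, _ => False
  end.

Record congruent (S : signature) (M : structure) : Prop := Congruent {
  eqs_refl : forall x : M, eqs x x;
  eqs_sym : forall x y : M, eqs x y -> eqs y x;
  eqs_trans : forall y x z : M, eqs x y -> eqs y z -> eqs x z;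
  funs_congr : forall f (xs ys : seq M), onth (funs S) f = Some (size xs) ->
    eqs_seq xs ys -> eqs (funs_of f xs) (funs_of f ys);
  rels_congr : forall r (xs ys : seq M), onth (rels S) r = Some (size xs) ->
    eqs_seq xs ys -> rels_of r xs -> rels_of r ys
}.

Definition scons T (x : T) (rho : nat -> T) (n : nat) : T :=
  if n is k.+1 then rho k else x.

Fixpoint value (M : structure) (rho : nat -> M) (t : term) : M :=
  match t with
  | Var x => rho x
  | Fun f ts => funs_of f (map (value rho) ts)
  end.

Fixpoint sat (M : structure) (rho : nat -> M) (phi : form) : Prop :=
  match phi with
  | Bot => False
  | Eq s t => eqs (value rho s) (value rho t)
  | Rel r ts => rels_of r (map (value rho) ts)
  | Imp phi psi => sat rho phi -> sat rho psi
  | All phi => forall x, sat (scons x rho) phi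
  end.

Definition models (M : structure) (T : form -> Prop) : Prop :=
  forall phi, T phi -> forall rho : nat -> M, sat rho phi.

Section Semantics.
Variable M : structure.
Implicit Types (rho : nat -> M) (phi : form).

Lemma value_subst rho s t :
  value rho (subst_term s t) = value (fun x => value rho (s x)) t.
Proof.
elim/nested_term_ind: t => //= f ts IH; congr funs_of.
by rewrite -map_comp; exact: eq_map_terms.
Qed.

Lemma sat_subst rho s phi :
  sat rho (subst_form s phi) <-> sat (fun x => value rho (s x)) phi.
Proof.
elim: phi rho s => [|u v|r ts|p IHp q IHq|p IHp] rho s //=.
- by rewrite !value_subst.
- rewrite -map_comp; suff -> : map (value rho \o subst_term s) ts =
    map (value (fun x => value rho (s x))) ts by [].
  by apply: eq_map => t /=; exact: value_subst.
- by rewrite IHp IHq.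
- suff E x : (fun n => value (scons x rho) (up s n)) =
      scons x (fun n => value rho (s n)).
    by split=> sp x; have := sp x; rewrite IHp E.
  apply: functional_extensionality => -[|n] //=.
  by rewrite value_subst.
Qed.

Lemma sat_lift rho x phi : sat (scons x rho) (lift_form phi) <-> sat rho phi.
Proof. exact: sat_subst. Qed.

Lemma sat_subst0 rho t phi :
  sat rho (subst0 t phi) <-> sat (scons (value rho t) rho) phi.
Proof.
rewrite /subst0 sat_subst.
have -> : (fun x => value rho (if x is y.+1 then Var y else t)) =
    scons (value rho t) rho by apply: functional_extensionality => -[].
by [].
Qed.

Lemma sat_neg rho phi : sat rho (Neg phi) <-> ~ sat rho phi.
Proof. by []. Qed.

Lemma sat_and rho phi psi :
  sat rho (And phi psi) <-> sat rho phi /\ sat rho psi.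
Proof.
split=> /= [h|[hp hq]]; last by move/(_ hp).
by split; apply: NNPP => n; apply: h => //; move=> hp /n.
Qed.

Lemma sat_ex rho phi : sat rho (Ex phi) <-> exists x, sat (scons x rho) phi.
Proof.
split=> /= [h|[x hx]]; last by move/(_ x).
by apply: NNPP => n; apply: h => x hx; apply: n; exists x.
Qed.

Lemma eq_value rho rho' k t : (forall x, x < k -> rho x = rho' x) ->
  term_bound k t -> value rho t = value rho' t.
Proof.
move=> rr'; elim/nested_term_ind: t => /= [x /rr' //|f ts IH kts].
by congr funs_of; apply: eq_map_terms; apply: all_terms kts.
Qed.

Lemma eq_sat rho rho' k phi : (forall x, x < k -> rho x = rho' x) ->
  form_bound k phi -> sat rho phi <-> sat rho' phi.
Proof.
elim: phi k rho rho' => [|u v|r ts|p IHp q IHq|p IHp] k rho rho' rr' //=.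
- by move=> /andP[ku kv]; rewrite !(eq_value rr').
- move=> kts; rewrite (@eq_map_terms _ (value rho) (value rho')) //.
  apply: all_terms kts; apply: forall_terms_all => t; exact: eq_value.
- by move=> /andP[kp kq]; rewrite (IHp k rho rho') // (IHq k rho rho').
- move=> kp; split=> h x; have := h x; rewrite (IHp k.+1 _ (scons x rho')) //;
    by move=> [|y] //= /rr'.
Qed.

Variable S : signature.
Hypothesis MS : congruent S M.

Lemma value_congr rho rho' t : (forall x, eqs (rho x) (rho' x)) ->
  term_in S t -> eqs (value rho t) (value rho' t).
Proof.
move=> rr'; elim/nested_term_ind: t => //= f ts IH /andP[/eqP fS tsS].
apply: (funs_congr MS); first by rewrite size_map.
elim: {fS} ts IH tsS => //= t ts IHts [IHt IH] /andP[tS tsS].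
by split; [exact: IHt|exact: IHts].
Qed.

Lemma sat_congr rho rho' phi : (forall x, eqs (rho x) (rho' x)) ->
  form_in S phi -> sat rho phi -> sat rho' phi.
Proof.
elim: phi rho rho' => [|u v|r ts|p IHp q IHq|p IHp] rho rho' rr' //=.
- move=> /andP[uS vS] uv; have u1 := value_congr rr' uS.
  have v1 := value_congr rr' vS.
  exact: (eqs_trans MS) (eqs_sym MS u1) (eqs_trans MS uv v1).
- move=> /andP[/eqP rS tsS]; apply: (rels_congr MS); first by rewrite size_map.
  elim: {rS} ts tsS => //= t ts IHts /andP[tS tsS].
  by split; [exact: value_congr|exact: IHts].
- move=> /andP[pS qS] pq /(IHp _ rho) sp; apply: (IHq _ _ rr' qS (pq _)).
  by apply: sp => // x; exact: (eqs_sym MS).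
- move=> pS h x; apply: (IHp _ _ _ pS (h x)) => -[|n] //=; exact: (eqs_refl MS).
Qed.

Lemma soundness G phi rho : prv S G phi ->
  (forall psi, List.In psi G -> sat rho psi) -> sat rho phi.
Proof.
move=> Gp; elim: Gp rho => {G phi}.
- by move=> G phi Gp rho; apply.
- move=> G phi psi _ _ IH rho hG hphi; apply: IH => chi /= [<-|/hG] //.
- by move=> G phi psi _ IH1 _ IH2 rho hG; apply: (IH1 _ hG) (IH2 _ hG).
- by move=> G phi _ IH rho hG; apply: NNPP; exact: IH.
- move=> G phi _ IH rho hG x; apply: IH => chi.
  by move=> /List.in_map_iff[psi [<- /hG]]; rewrite sat_lift.
- by move=> G phi t _ _ IH rho hG; rewrite sat_subst0; exact: IH.
- by move=> G t _ rho _; exact: (eqs_refl MS).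
- move=> G phi s t phiS _ IH1 _ IH2 rho hG; rewrite sat_subst0.
  have := IH2 _ hG; rewrite sat_subst0; apply: sat_congr phiS => -[|n] /=.
    exact: IH1.
  exact: (eqs_refl MS).
Qed.

Lemma provable_sound (T : form -> Prop) phi :
  models M T -> provable S T phi -> forall rho, sat rho phi.
Proof.
by move=> MT [G GT Gp] rho; apply: soundness Gp _ => psi /GT /MT.
Qed.

End Semantics.

Lemma In_cat T (x : T) s1 s2 :
  List.In x (s1 ++ s2) <-> List.In x s1 \/ List.In x s2.
Proof. by elim: s1 => /= [|y s1 ->]; tauto. Qed.

(** * Injectivity of the coding of terms and formulas *)

Lemma code_seq_inj T (c : T -> nat) s1 s2 :
  (forall x y, List.In x s1 -> c x = c y -> x = y) ->
  code_seq (map c s1) = code_seq (map c s2) -> s1 = s2.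
Proof.
elim: s1 s2 => [|x s1 IH] [|y s2] //= inj [/npair_inj[xy s12]].
have -> : x = y by apply: inj xy; left.
by congr cons; apply: IH s12 => u v us; apply: inj; right.
Qed.

Lemma forall_terms_In (P : term -> Prop) ts :
  forall_terms P ts <-> forall t, List.In t ts -> P t.
Proof.
elim: ts => //= t ts IH; split; first by move=> [Pt /IH Ps] u [<-|/Ps].
by move=> h; split; [apply: h; left|apply/IH => u us; apply: h; right].
Qed.

Lemma code_term_inj t u : code_term t = code_term u -> t = u.
Proof.
elim/nested_term_ind: t u => [x|f ts IH] [y|g us] /= /npair_inj[] // _.
  by move=> ->.
move=> /npair_inj[-> e]; congr Fun; apply: code_seq_inj e => t u ti.
by move/forall_terms_In: IH => /(_ t ti u).
Qed.

Lemma code_form_inj phi psi : code_form phi = code_form psi -> phi = psi.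
Proof.
elim: phi psi => [|s t|r ts|p IHp q IHq|p IHp] [|s' t'|r' ts'|p' q'|p'] //=;
  move=> /npair_inj[] // _.
- by move=> /npair_inj[/code_term_inj -> /code_term_inj ->].
- move=> /npair_inj[-> e]; congr Rel; apply: code_seq_inj e => t u _.
  exact: code_term_inj.
- by move=> /npair_inj[/IHp -> /IHq ->].
- by move=> /IHp ->.
Qed.

(** * Completeness *)

Section Completeness.
Variables (S : signature) (T : form -> Prop) (phi0 : form).
Hypothesis TS : forall phi, T phi -> sentence S phi.
Hypothesis phi0S : form_in S phi0.

(** The theory is kept apart from the finite list [G]. As [T] consists of sentences, only [G] has
    free variables, so a fresh variable always exists and can serve as a Henkin constant. *)
Definition entails (G : seq form) (phi : form) : Prop :=
  exists2 H, (forall psi, List.In psi H -> T psi) & prv S (H ++ G) phi.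

Lemma ent_weaken G G' phi : (forall psi, List.In psi G -> List.In psi G') ->
  entails G phi -> entails G' phi.
Proof.
move=> GG' [H HT Hp]; exists H => //; apply: prv_weaken Hp => psi.
by rewrite !In_cat => -[|/GG']; [left|right].
Qed.

Lemma ent_ax G phi : List.In phi G -> entails G phi.
Proof. by move=> Gp; exists [::] => //; exact: prv_ax. Qed.

Lemma ent_thm G phi : T phi -> entails G phi.
Proof.
by move=> Tp; exists [:: phi]; [move=> psi [<-|]|exact: prv_ax0].
Qed.

Lemma ent_impI G phi psi : form_in S phi ->
  entails (phi :: G) psi -> entails G (Imp phi psi).
Proof.
move=> phiS [H HT Hp]; exists H => //; apply: prv_impI => //.
apply: prv_weaken Hp => chi; rewrite !In_cat /= In_cat; tauto.
Qed.

Lemma ent_impE G phi psi :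
  entails G (Imp phi psi) -> entails G phi -> entails G psi.
Proof.
move=> [H HT Hp] [K KT Kp]; exists (H ++ K).
  by move=> chi; rewrite In_cat => -[/HT|/KT].
apply: (@prv_impE _ _ phi).
  by apply: prv_weaken Hp => chi; rewrite !In_cat; tauto.
by apply: prv_weaken Kp => chi; rewrite !In_cat; tauto.
Qed.

Lemma ent_prv1 G phi psi : (forall H, prv S H phi -> prv S H psi) ->
  entails G phi -> entails G psi.
Proof. by move=> h [H HT Hp]; exists H => //; exact: h. Qed.

Lemma ent_gen G phi k : all (form_bound k) G -> form_bound k.+1 phi ->
  entails G (subst0 (Var k) phi) -> entails G (All phi).
Proof.
move=> kG kphi [H HT Hp]; exists H => //; apply: prv_gen Hp => //.
rewrite all_cat kG andbT; elim: H HT => //= psi H IH HT.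
rewrite IH ?andbT; last by move=> chi Hc; apply: HT; right.
have /TS/andP[_] : T psi by apply: HT; left.
exact: form_bound_mono.
Qed.

Lemma ent_botE G phi : form_in S phi -> entails G Bot -> entails G phi.
Proof. by move=> phiS e; apply: ent_prv1 e => H; exact: prv_botE. Qed.

Definition form_at (n : nat) : form :=
  if excluded_middle_informative (exists phi, code_form phi = n) is left ex
  then proj1_sig (constructive_indefinite_description _ ex) else Bot.

Lemma form_at_code phi : form_at (code_form phi) = phi.
Proof.
rewrite /form_at; destruct (excluded_middle_informative _) as [ex|[]]; last by exists phi.
exact: code_form_inj (proj2_sig (constructive_indefinite_description _ ex)).
Qed.

Definition fresh (G : seq form) : nat :=
  proj1_sig (constructive_indefinite_description _ (forms_bound_ex G)).

Lemma freshP G : all (form_bound (fresh G)) G.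
Proof. 
exact: (proj2_sig (constructive_indefinite_description _ (forms_bound_ex G))).
Qed.

Definition witness (k : nat) (phi : form) : seq form :=
  if phi is Imp (All psi) Bot then [:: Neg (subst0 (Var k) psi)] else [::].

Definition extend (G : seq form) (phi : form) : seq form :=
  if excluded_middle_informative (form_in S phi /\ ~ entails (phi :: G) Bot)
  then witness (fresh (phi :: G)) phi ++ phi :: G else G.

Lemma extendP G phi :
  [/\ form_in S phi, ~ entails (phi :: G) Bot
    & extend G phi = witness (fresh (phi :: G)) phi ++ phi :: G] \/
  ~ (form_in S phi /\ ~ entails (phi :: G) Bot) /\ extend G phi = G.
Proof.
rewrite /extend.
by destruct (excluded_middle_informative _) as [[]|]; [left|right].
Qed.

Fixpoint stage (n : nat) : seq form :=
  if n is k.+1 then extend (stage k) (form_at k) else [:: Neg phi0].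

Definition limit (phi : form) : Prop := exists n, entails (stage n) phi.

Lemma stageS n psi : List.In psi (stage n) -> List.In psi (stage n.+1).
Proof.
move=> psin /=; case: (extendP (stage n) (form_at n)) => [[_ _ ->]|[_ -> //]].
by rewrite In_cat /=; right; right.
Qed.

Lemma stage_mono m n phi : m <= n -> entails (stage m) phi ->
  entails (stage n) phi.
Proof.
move=> le_mn; apply: ent_weaken => psi; rewrite -(subnK le_mn).
by elim: (n - m) => //= k IH /IH; exact: stageS.
Qed.

Lemma limit_impE phi psi : limit (Imp phi psi) -> limit phi -> limit psi.
Proof.
move=> [m hm] [n hn]; exists (maxn m n).
by apply: ent_impE; [exact: stage_mono (leq_maxl m n) hm
                    |exact: stage_mono (leq_maxr m n) hn].
Qed.

Lemma limit_prv1 phi psi : (forall H, prv S H phi -> prv S H psi) ->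
  limit phi -> limit psi.
Proof. by move=> h [n hn]; exists n; exact: ent_prv1 hn. Qed.

Lemma limit_prv0 phi : prv S [::] phi -> limit phi.
Proof. by move=> p; exists 0, [::] => //; apply: prv_weaken p. Qed.

Hypothesis unprovable : ~ provable S T phi0.

Lemma stage_consistent n : ~ entails (stage n) Bot.
Proof.
elim: n => [|n IH] /=.
  move=> e; apply: unprovable.
  have : entails [::] phi0.
    apply: (@ent_prv1 _ _ _ (fun H => @prv_dne S H phi0)).
    by apply: ent_impI e; rewrite /= phi0S.
  by move=> [H HT Hp]; exists H => //; move: Hp; rewrite cats0.
case: (extendP (stage n) (form_at n)) => [[phiS cons ->]|[_ -> //]].
move: phiS cons; set phi := form_at n; set k := fresh _.
have := freshP (phi :: stage n); rewrite -/k.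
case: phi @k => [|??|??|[|??|??|??|psi] [|??|??|??|?]|?] k //= /andP[kpsi kG] psiS cons e.
(* If adding the witness were inconsistent, [psi] would be derivable at the fresh variable [k],
   hence for all values, against the hypothesis [Neg (All psi)]. *)
rewrite !andbT in kpsi psiS; apply: cons.
apply: (@ent_impE _ (All psi)); first by apply: ent_ax; left.
apply: (@ent_gen _ _ k) => //; first by rewrite /= kpsi kG.
apply: (@ent_prv1 _ _ _ (fun H => @prv_dne S H _)); apply: ent_impI e.
by rewrite /= andbT; apply: form_in_subst psiS; case.
Qed.

Lemma limit_consistent phi : limit phi -> ~ limit (Neg phi).
Proof.
by move=> h /limit_impE/(_ h)[n]; exact: stage_consistent.
Qed.

Lemma limit_total phi : form_in S phi -> limit phi \/ limit (Neg phi).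
Proof.
move=> phiS; case: (classic (entails (phi :: stage (code_form phi)) Bot)).
  by move=> e; right; exists (code_form phi); exact: ent_impI.
move=> cons; left; exists (code_form phi).+1 => /=.
rewrite form_at_code.
case: (extendP (stage (code_form phi)) phi) => [[_ _ ->]|[[]//]].
by apply: ent_ax; rewrite In_cat /=; right; left.
Qed.

Lemma limit_henkin psi : form_in S psi -> limit (Neg (All psi)) ->
  exists k, limit (Neg (subst0 (Var k) psi)).
Proof.
move=> psiS lpsi; pose phi := Neg (All psi); pose n := code_form phi.
exists (fresh (phi :: stage n)); exists n.+1 => /=.
rewrite form_at_code; case: (extendP (stage n) phi) => [[_ _ ->]|[[]]].
  by apply: ent_ax; left.
split; first by rewrite /= psiS.
move=> e; apply: (limit_consistent lpsi); exists n.
by apply: ent_impI e; rewrite /= psiS.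
Qed.

Lemma limit_imp p q : form_in S p -> form_in S q ->
  limit (Imp p q) <-> (limit p -> limit q).
Proof.
move=> pS qS; split; first exact: limit_impE.
case: (limit_total pS) => [lp /(_ lp)|lnp _].
  move=> [n e]; exists n; apply: ent_impI => //.
  by apply: ent_weaken e => psi; right.
case: lnp => n e; exists n; apply: ent_impI => //; apply: ent_botE => //.
apply: (@ent_impE _ p); last by apply: ent_ax; left.
by apply: ent_weaken e => psi; right.
Qed.

Lemma limit_all p : form_in S p ->
  limit (All p) <-> (forall t, term_in S t -> limit (subst0 t p)).
Proof.
move=> pS; split=> [l t tS|l].
  by apply: limit_prv1 l => H; exact: prv_allE.
case: (@limit_total (All p)) => // /(limit_henkin pS)[k lk].
by case: (limit_consistent (l (Var k) isT) lk).
Qed.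

(** The term model lives on all raw terms; reading those outside the signature as a variable avoids
    a subset type. *)
Definition in_sig (t : term) : term := if term_in S t then t else Var 0.

Lemma in_sigP t : term_in S (in_sig t).
Proof. by rewrite /in_sig; case: ifP. Qed.

Lemma in_sig_id t : term_in S t -> in_sig t = t.
Proof. by rewrite /in_sig => ->. Qed.

Lemma all_in_sig ts : all (term_in S) (map in_sig ts).
Proof. by elim: ts => //= t ts ->; rewrite in_sigP. Qed.

Definition term_model : structure := {|
  carrier := term;
  eqs := fun s t => limit (Eq (in_sig s) (in_sig t));
  funs_of := fun f ts => Fun f (map in_sig ts);
  rels_of := fun r ts => limit (Rel r (map in_sig ts))
|}.

Lemma limit_refl t : term_in S t -> limit (Eq t t).
Proof. by move=> tS; apply: limit_prv0; exact: prv_eqI. Qed.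

Lemma limit_leibniz phi s t : form_in S phi -> limit (Eq s t) ->
  limit (subst0 s phi) -> limit (subst0 t phi).
Proof.
move=> phiS [m [H HT Hp]] [n [K KT Kp]]; exists (maxn m n); exists (H ++ K).
  by move=> chi; rewrite In_cat => -[/HT|/KT].
have mono i : i <= maxn m n ->
    forall psi, List.In psi (stage i) -> List.In psi (stage (maxn m n)).
  move=> le_in psi; rewrite -(subnK le_in).
  by elim: (maxn m n - i) => //= k IH /IH; exact: stageS.
apply: prv_eqE phiS _ _.
  apply: prv_weaken Hp => psi; rewrite !In_cat => -[|/(mono _ (leq_maxl m n))]; tauto.
apply: prv_weaken Kp => psi; rewrite !In_cat => -[|/(mono _ (leq_maxr m n))]; tauto.
Qed.

Lemma subst_lift_term t u :
  subst_term (fun x => if x is y.+1 then Var y else t) (lift_term u) = u.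
Proof. by rewrite /lift_term subst_term_comp subst_term_id. Qed.

Lemma all_lift_in ts : all (term_in S) ts -> all (term_in S) (map lift_term ts).
Proof.
rewrite all_map; apply: all_sub_terms; apply: forall_terms_all => t.
by apply: term_in_subst.
Qed.

(** The arguments are replaced one at a time; [pre] collects those already replaced. [K'] is the
    context [K] lifted so that [Var 0] may mark the place of the replacement. *)
Lemma limit_leibniz_seq (K K' : seq term -> form) (xs ys : seq term_model) pre :
  (forall t ts, subst0 t (K' ts) =
     K (map (subst_term (fun x => if x is y.+1 then Var y else t)) ts)) ->
  (forall ts, all (term_in S) ts -> size ts = size pre + size xs ->
     form_in S (K' ts)) ->
  all (term_in S) pre -> eqs_seq xs ys ->
  limit (K (pre ++ map in_sig xs)) -> limit (K (pre ++ map in_sig ys)).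
Proof.
move=> hK; elim: xs ys pre => [|x xs IH] [|y ys] pre //= hS preS [xy xys] l.
have subst_lift_id t ts :
    map (subst_term (fun x => if x is y.+1 then Var y else t))
      (map lift_term ts) = ts.
  rewrite -map_comp -[RHS]map_id; apply: eq_map => u /=.
  exact: subst_lift_term.
have : limit (K (rcons pre (in_sig y) ++ map in_sig xs)).
  have := @limit_leibniz
    (K' (map lift_term pre ++ Var 0 :: map lift_term (map in_sig xs)))
    (in_sig x) (in_sig y).
  rewrite !hK !map_cat /= !subst_lift_id cat_rcons; apply=> //.
  apply: hS; last by rewrite size_cat /= !size_map.
  by rewrite all_cat /= !all_lift_in // all_in_sig.
rewrite -cat_rcons; apply: IH xys => //.
  by move=> ts tsS sz; apply: hS; rewrite // sz size_rcons addSnnS.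
by rewrite all_rcons in_sigP.
Qed.

Lemma term_model_congruent : congruent S term_model.
Proof.
have sym s t : term_in S s -> limit (Eq s t) -> limit (Eq t s).
  move=> sS st; have := @limit_leibniz (Eq (Var 0) (lift_term s)) s t.
  rewrite /subst0 /= !subst_lift_term; apply=> //.
    by rewrite /= term_in_subst.
  exact: limit_refl.
split=> /=.
- by move=> x; apply: limit_refl; exact: in_sigP.
- by move=> x y; apply: sym; exact: in_sigP.
- move=> y x z xy yz.
  have := @limit_leibniz (Eq (lift_term (in_sig x)) (Var 0)) (in_sig y) (in_sig z).
  rewrite /subst0 /= !subst_lift_term; apply=> //.
  by rewrite /= term_in_subst // in_sigP.
- move=> f xs ys fS xys.
  have sz : size ys = size xs.
    elim: xs ys xys {fS} => [|x xs IH] [|y ys] //= [_ /IH ->] //.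
  have inS (zs : seq term_model) : size zs = size xs ->
      term_in S (Fun f (map in_sig zs)).
    by move=> szz; rewrite /= size_map szz fS eqxx all_in_sig.
  rewrite !in_sig_id ?inS //.
  have := @limit_leibniz_seq (fun ts => Eq (Fun f (map in_sig xs)) (Fun f ts))
    (fun ts => Eq (lift_term (Fun f (map in_sig xs))) (Fun f ts)) xs ys [::].
  apply=> //.
  - by move=> t ts; congr Eq; exact: subst_lift_term.
  - move=> ts tsS szt; rewrite /= in szt *; rewrite szt fS eqxx tsS !size_map.
    by rewrite eqxx all_lift_in // all_in_sig.
  - by apply: limit_refl; exact: inS.
- move=> r xs ys rS xys.
  apply: (@limit_leibniz_seq (Rel r) (Rel r) xs ys [::]) => //.
  by move=> ts tsS /= ->; rewrite rS eqxx.
Qed.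

Lemma term_model_sat (rho : nat -> term_model) phi : form_in S phi ->
  sat rho phi <-> limit (subst_form (fun x => in_sig (rho x)) phi).
Proof.
have valueE (r : nat -> term_model) t : term_in S t ->
    in_sig (value r t) = subst_term (fun x => in_sig (r x)) t.
  elim/nested_term_ind: t => //= f ts IH /andP[fS tsS].
  rewrite -map_comp (@eq_map_terms _ _ (subst_term (fun x => in_sig (r x)))).
    rewrite in_sig_id //= size_map fS /= all_map; apply: all_sub_terms tsS.
    apply: forall_terms_all => t; apply: term_in_subst => x.
    exact: in_sigP.
  exact: all_terms tsS.
elim: phi rho => [|s t|r ts|p IHp q IHq|p IHp] rho //=.
- by move=> _; split=> // -[n]; exact: stage_consistent.
- by move=> /andP[sS tS]; rewrite !valueE.
- move=> /andP[_ tsS]; rewrite -map_comp.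
  rewrite (@eq_map_terms _ _ (subst_term (fun x => in_sig (rho x)))) //.
  by apply: all_terms tsS; apply: forall_terms_all => t; exact: valueE.
- move=> /andP[pS qS]; rewrite IHp // IHq // limit_imp //.
    by apply: form_in_subst => // x; exact: in_sigP.
  by apply: form_in_subst => // x; exact: in_sigP.
- move=> pS; rewrite limit_all; last first.
    by apply: form_in_subst pS; apply: up_in => x; exact: in_sigP.
  have E t : (fun x => in_sig (scons t rho x)) =
      (fun x => subst_term (fun y => if y is z.+1 then Var z else in_sig t)
         (up (fun x => in_sig (rho x)) x)).
    apply: functional_extensionality => -[|x] //=.
    by rewrite /lift_term subst_term_comp subst_term_id.
  split=> [h t tS|h t].
    by have := h t; rewrite IHp // E /subst0 subst_form_comp in_sig_id.
  rewrite IHp // E; have := h _ (in_sigP t).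
  by rewrite /subst0 subst_form_comp.
Qed.

Lemma term_model_refutes : exists M, [/\ congruent S M, models M T
  & exists rho : nat -> M, ~ sat rho phi0].
Proof.
exists term_model; split; first exact: term_model_congruent.
  move=> phi Tphi rho; have /andP[phiS phi_cl] := TS Tphi.
  rewrite term_model_sat // subst_closed //.
  by exists 0; exact: ent_thm.
exists Var; rewrite term_model_sat //.
have -> : (fun x => in_sig (Var x)) = Var by [].
rewrite subst_form_id => /limit_consistent; apply.
by exists 0; apply: ent_ax; left.
Qed.

End Completeness.

(** Lets the deductive closure of the meet and all the obligations of an interpretation be checked
    in models instead of by derivations. *)
Theorem completeness S (T : form -> Prop) phi :
  (forall psi, T psi -> sentence S psi) -> form_in S phi ->
  (forall M : structure, congruent S M -> models M T ->
     forall rho : nat -> M, sat rho phi) -> provable S T phi.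
Proof.
move=> TS phiS valid; apply: NNPP.
by move=> /(term_model_refutes TS phiS)[M [MS MT [rho []]]]; exact: valid.
Qed.

(** * Equivalence relations with prescribed finite classes *)

(* The element [npair n j] lies in class number [n], which has [n.+1] elements
   if [a n] holds, and infinitely many otherwise. *)
Definition same (a : nat -> bool) (x y : nat) : bool :=
  (L x == L y) &&
  (if a (L x) then minn (R x) (L x) == minn (R y) (L x) else R x == R y).

Definition pt : nat := npair 0 0.

(** The carrier does not depend on [a]: classes are made finite by the equality [same] alone.
    Reading every binary symbol as the class relation and every function as a constant gives a
    structure for all signatures at once. *)
Definition Mod (a : nat -> bool) : structure := {|
  carrier := nat;
  eqs := fun x y => same a x y;
  funs_of := fun _ _ => pt;
  rels_of := fun _ xs => if xs is [:: x; y] then L x = L y else False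
|}.

Lemma same_refl a x : same a x x.
Proof. by rewrite /same !eqxx; case: ifP. Qed.

Lemma same_sym a x y : same a x y -> same a y x.
Proof.
by rewrite /same => /andP[/eqP ->]; rewrite eqxx /=; case: ifP => _ /eqP ->.
Qed.

Lemma same_symE a x y : same a x y = same a y x.
Proof. by apply/idP/idP; exact: same_sym. Qed.

Lemma same_trans a y x z : same a x y -> same a y z -> same a x z.
Proof.
rewrite /same => /andP[/eqP ->] h /andP[/eqP yz]; rewrite yz eqxx /= in h *.
by case: ifP h => _ /eqP -> /eqP ->.
Qed.

Lemma same_class a x y : same a x y -> L x = L y.
Proof. by move=> /andP[/eqP]. Qed.

Lemma eq_same a a' x y : a (L x) = a' (L x) -> same a x y = same a' x y.
Proof. by rewrite /same => ->. Qed.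

Lemma Mod_congruent S a : congruent S (Mod a).
Proof.
split=> /=; [exact: same_refl|exact: same_sym| | |].
- by move=> y x z; exact: same_trans.
- by move=> f xs ys _ _; exact: same_refl.
- move=> r [|x [|y [|? ?]]] [|x' [|y' [|? ?]]] _ //=; try tauto.
  by move=> [/same_class -> [/same_class -> _]].
Qed.

Fixpoint qr (phi : form) : nat :=
  match phi with
  | Imp phi psi => maxn (qr phi) (qr psi)
  | All phi => (qr phi).+1
  | _ => 0
  end.

(** Lets the code of a sentence replace its quantifier rank in the bounds, so that the rank never
    has to be computed. *)
Lemma qr_code phi : qr phi <= code_form phi.
Proof.
elim: phi => //= [p IHp q IHq|p IHp].
  have := npair_ge 3 (npair (code_form p) (code_form q)).
  have := npair_ge (code_form p) (code_form q).
  lia.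
by have := npair_ge 4 (code_form p); lia.
Qed.

Definition vval (env : seq nat) (t : term) : nat :=
  if t is Var x then nth pt env x else pt.

(** Satisfaction in [Mod a] with quantifiers relativized to [D], which becomes decidable for finite
    [D]. The environment is a list, so that it can be coded; variables beyond its end denote
    [pt]. *)
Fixpoint bsat (a : nat -> bool) (D : pred nat) (env : seq nat) (phi : form) :
    Prop :=
  match phi with
  | Bot => False
  | Eq s t => same a (vval env s) (vval env t)
  | Rel r ts => if ts is [:: s; t] then L (vval env s) = L (vval env t) else False
  | Imp phi psi => bsat a D env phi -> bsat a D env psi
  | All phi => forall x, D x -> bsat a D (x :: env) phi
  end.

Lemma scons_nth x env : scons x (nth pt env) = nth pt (x :: env).
Proof. by apply: functional_extensionality => -[]. Qed.

Lemma bsatT a env phi : @sat (Mod a) (nth pt env) phi <-> bsat a predT env phi.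
Proof.
have valE e t : @value (Mod a) (nth pt e) t = vval e t by case: t.
elim: phi env => [|s t|r [|s [|t [|? ?]]]|p IHp q IHq|p IHp] env //=.
- by rewrite !valE.
- by rewrite !valE.
- by rewrite IHp IHq.
- split=> h x; first by move=> _; rewrite -IHp -scons_nth; exact: h.
  by rewrite scons_nth IHp; exact: h.
Qed.

(** * Back-and-forth between structures whose parameters agree below a threshold *)

Definition below (N : option nat) (x : nat) : bool :=
  if N is Some n then (L x < n) && (R x < n) else true.

Lemma avoid (l : seq nat) s t : size l < t ->
  exists n, [/\ s <= n, n < s + t & n \notin l].
Proof.
move=> lt; apply: NNPP => h.
have : size (iota s t) <= size l.
  apply: uniq_leq_size; first exact: iota_uniq.
  move=> n; rewrite mem_iota => /andP[sn nt]; apply: contraT => nl.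
  by case: h; exists n.
by rewrite size_iota leqNgt lt.
Qed.

Section BackAndForth.
Variable t : nat.

Definition small (a : nat -> bool) (n : nat) : bool := a n && (n < t).

(** A position of the game. Elements of classes of at most [t] elements are matched with themselves.
    Those of larger classes, finite or not, are matched only up to the pattern of equalities and of
    classes, because fewer than [t] choices cannot exhaust such a class. *)
Record related (a a' : nat -> bool) (u v : nat -> nat) : Prop := Related {
  rel_small : forall i, small a (L (u i)) || small a' (L (v i)) ->
    same a (u i) (v i);
  rel_class : forall i j, (L (u i) == L (u j)) = (L (v i) == L (v j));
  rel_same : forall i j, same a (u i) (u j) = same a' (v i) (v j)
}.

Lemma related_cons a a' u v x y : related a a' u v ->
  (small a (L x) || small a' (L y) -> same a x y) ->
  (forall i, (L x == L (u i)) = (L y == L (v i))) ->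
  (forall i, same a x (u i) = same a' y (v i)) ->
  related a a' (scons x u) (scons y v).
Proof.
move=> [hsm hc hs] xsm xc xs; split.
- by move=> [|i] //=; exact: hsm.
- by move=> [|i] [|j] //=; rewrite ?eqxx // ?xc // eq_sym xc eq_sym.
- by move=> [|i] [|j] //=; rewrite ?same_refl // same_symE xs same_symE.
Qed.

Lemma related_sym a a' u v : (forall n, n < t -> a n = a' n) ->
  related a a' u v -> related a' a v u.
Proof.
move=> aa' [hsm hc hs]; split=> // i; rewrite orbC => si.
have si' := hsm i si; apply: same_sym; rewrite -(@eq_same a) //.
apply: aa'; move: si; rewrite /small -(same_class si').
by case/orP => /andP[].
Qed.

(** The answer to [x] is [x] itself, normalized, if its class is small; the old partner, if [x]
    equals an old element; a new element of the partner class, if only the class is old; otherwise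
    an element of a new large class. The default [pt] of the environments counts as one more old
    element, hence the successor in the size bound. *)
Lemma forth a a' N' env env' x : (forall n, n < t -> a n = a' n) ->
  (if N' is Some n then t + t <= n else true) ->
  size env = size env' -> (size env').+1 < t -> all (below N') env' ->
  related a a' (nth pt env) (nth pt env') ->
  exists2 y, below N' y & related a a' (nth pt (x :: env)) (nth pt (y :: env')).
Proof.
move=> aa' N't ss lt_t inN' rel; have [hsm hc hs] := rel.
set u := nth pt env in rel hsm hc hs *; set v := nth pt env' in rel hsm hc hs *.
have vN' i : below N' (v i).
  rewrite /v; case: (ltnP i (size env')) => [lt|ge].
    exact: (allP inN') (mem_nth _ lt).
  rewrite nth_default //; case: N' N't {inN'} => //= n.
  by rewrite /pt !npairE; lia.
have v_in i : v i \in pt :: env'.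
  rewrite /v inE; case: (ltnP i (size env')) => [lt|ge].
    by rewrite mem_nth // orbT.
  by rewrite nth_default // eqxx.
have smE n : small a n = small a' n.
  by rewrite /small; case: ltnP => [/aa' ->|]; rewrite ?andbF.
have cons y : below N' y ->
    (small a (L x) || small a' (L y) -> same a x y) ->
    (forall i, (L x == L (u i)) = (L y == L (v i))) ->
    (forall i, same a x (u i) = same a' y (v i)) ->
    exists2 y, below N' y & related a a' (nth pt (x :: env)) (nth pt (y :: env')).
  move=> yN' h1 h2 h3; exists y => //; rewrite -!scons_nth.
  exact: related_cons.
case: (boolP (small a (L x))) => [sx|nsx].
  have /andP[ax xt] := sx.
  (* The truncation leaves [y] equal to [x] in the sense of [same] and brings it below [N']. *)
  pose y := npair (L x) (minn (R x) (L x)).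
  have xy : same a x y by rewrite /same /y !npairE eqxx ax -minnA minnn eqxx.
  have Ly : L y = L x by rewrite npairE.
  have uv i : (L x == L (u i)) || (L x == L (v i)) -> same a (u i) (v i).
    by move=> h; apply: hsm; rewrite -smE; case/orP: h => /eqP <-; rewrite sx ?orbT.
  apply: (cons y); rewrite ?Ly //.
  - case: N' N't {inN' vN' cons} => //= n; rewrite /y !npairE; lia.
  - move=> i; apply/idP/idP => h.
      by rewrite -(same_class (uv i _)) ?h.
    by rewrite (same_class (uv i _)) ?h ?orbT.
  - move=> i; rewrite -(@eq_same a) ?Ly ?aa' //; apply/idP/idP => h.
      have ui := uv i; rewrite (same_class h) eqxx in ui.
      exact: same_trans (same_trans (same_sym xy) h) (ui isT).
    have ui := uv i; rewrite -Ly (same_class h) eqxx orbT in ui.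
    exact: same_trans (same_trans xy h) (same_sym (ui isT)).
have nsv i : L x = L (u i) -> ~~ small a (L (v i)).
  move=> xi; apply/negP => sv; have /same_class e : same a (u i) (v i).
    by apply: hsm; rewrite -smE sv orbT.
  by rewrite xi e sv in nsx.
case: (classic (exists i, same a x (u i))) => [[i xi]|nsame].
  apply: (cons (v i)) => //.
  - rewrite -smE (negbTE nsx) (negbTE (nsv i _)) //; exact: same_class xi.
  - by move=> j; rewrite -hc (same_class xi).
  - move=> j; rewrite -hs; apply/idP/idP => h.
      exact: same_trans (same_sym xi) h.
    exact: same_trans xi h.
have nsame' i : same a x (u i) = false by apply/negP => h; apply: nsame; exists i.
case: (classic (exists i, L x = L (u i))) => [[i xi]|nclass].
  have := nsv i xi; rewrite smE => nsvi.
  pose R' z := if a' (L z) then minn (R z) (L z) else R z.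
  (* The class of [v i] is infinite or has more than [t] elements, so its coordinates below [t] are
     pairwise distinct, and fewer than [t] of them are taken. *)
  have [|j [_ ltj nj]] := @avoid (map R' (pt :: env')) 0 t.
    by rewrite size_map.
  apply: (cons (npair (L (v i)) j)); rewrite ?npairE //.
  - have := vN' i; case: N' N't {inN' vN' cons} => //= n; rewrite !npairE.
    lia.
  - by rewrite (negbTE nsx) (negbTE nsvi).
  - by move=> k; rewrite -hc xi.
  - move=> k; rewrite nsame'; apply/esym/negP => h; case/negP: nj.
    suff -> : j = R' (v k) by apply: map_f.
    move: h; rewrite /same !npairE /R' => /andP[/eqP <-].
    case: ifP nsvi => [a'v|_ _ /eqP //]; rewrite /small a'v -leqNgt => le_t.
    by move=> /eqP <-; rewrite (minn_idPl _) //; lia.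
(* A class number from [t] on is never small, and [t] candidates suffice; staying below [t + t] is
   what the lower bound on [N'] allows for. *)
have [|n [tn ltn nn]] := @avoid (map (fun z => L z) (pt :: env')) t t.
  by rewrite size_map.
have nclass' i : (L x == L (u i)) = false.
  by apply/eqP => h; apply: nclass; exists i.
have nv i : (n == L (v i)) = false.
  by apply/eqP => h; case/negP: nn; rewrite h; exact: (map_f (fun z => L z)).
apply: (cons (npair n 0)); rewrite ?npairE.
- case: N' N't {inN' vN' cons} => //= m; rewrite !npairE; lia.
- by rewrite (negbTE nsx) /small ltnNge tn andbF.
- by move=> i; rewrite nclass' nv.
- by move=> i; rewrite nsame' /same npairE nv.
Qed.

(** Independent bounds on the two sides give two facts in one induction: truth depends on finitely
    many values of [a], and unbounded quantifiers may be replaced by bounded ones. *)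
Lemma related_bsat a a' N N' env env' phi : (forall n, n < t -> a n = a' n) ->
  (if N is Some n then t + t <= n else true) ->
  (if N' is Some n then t + t <= n else true) ->
  size env = size env' -> (size env').+1 + qr phi < t ->
  all (below N) env -> all (below N') env' ->
  related a a' (nth pt env) (nth pt env') ->
  bsat a (below N) env phi <-> bsat a' (below N') env' phi.
Proof.
have idx w (s : term) : vval w s = nth pt w (if s is Var x then x else size w).
  by case: s => //= f ts; rewrite nth_default.
elim: phi env env' => [|s s'|r ts|p IHp q IHq|p IHp] env env' aa' Nt N't se
  lt_t inN inN' rel; have [hsm hc hs] := rel => //=.
- by rewrite !idx se hs.
- case: ts lt_t => [|s [|s' [|? ?]]] // _; rewrite !idx se.
  by split=> /eqP h; apply/eqP; [rewrite -hc|rewrite hc].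
- rewrite /= in lt_t.
  have -> : bsat a (below N) env p <-> bsat a' (below N') env' p.
    by apply: IHp => //; lia.
  have -> // : bsat a (below N) env q <-> bsat a' (below N') env' q.
  by apply: IHq => //; lia.
- rewrite /= in lt_t; split=> h y yN.
    have a'a n (ltn : n < t) := esym (aa' n ltn).
    have [|x xN rel'] := @forth _ _ _ _ _ y a'a Nt (esym se) _ inN
      (related_sym aa' rel); first by lia.
    apply/(IHp (x :: env)); rewrite /= ?se ?xN ?yN //; try lia.
      exact: related_sym a'a rel'.
    exact: h.
  have [|x xN rel'] := @forth _ _ _ _ _ y aa' N't se _ inN' rel; first by lia.
  apply/(IHp _ (x :: env')); rewrite /= ?se ?xN ?yN //; try lia.
  exact: h.
Qed.

End BackAndForth.

Definition truth (a : nat -> bool) (phi : form) : Prop :=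
  @sat (Mod a) (fun _ => pt) phi.

Lemma truth_bsat a a' N phi : (forall n, n < N -> a n = a' n) ->
  2 * code_form phi + 4 <= N ->
  truth a phi <-> bsat a' (below (Some N)) [::] phi.
Proof.
move=> aa' leN; have := qr_code phi => qrp.
have -> : truth a phi <-> bsat a (below None) [::] phi.
  rewrite /truth -[X in _ <-> X]bsatT.
  suff -> : (fun=> pt) = nth pt [::] by [].
  by apply: functional_extensionality => i; rewrite nth_nil.
(* The threshold leaves room for [pt] and for one element per nested quantifier. Its double is at
   most [2 * code_form phi + 4], the bound used from here on. *)
apply: (@related_bsat (qr phi).+2) => //=; try lia.
  by move=> n ltn; apply: aa'; lia.
by split=> [i|i j|i j]; rewrite !nth_nil ?eqxx ?same_refl.
Qed.

Lemma truth_agree a a' phi :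
  (forall n, n < 2 * code_form phi + 4 -> a n = a' n) ->
  truth a phi <-> truth a' phi.
Proof. by move=> aa'; rewrite !(truth_bsat (a' := a') _ (leqnn _)). Qed.

(** * Sentences that express the values of [a] *)

Definition env_cat T (ys : seq T) (rho : nat -> T) : nat -> T :=
  foldr (@scons T) rho ys.

Lemma env_cat_lt T d (ys : seq T) rho i : i < size ys ->
  env_cat ys rho i = nth d ys i.
Proof. by elim: ys i => //= y ys IH [|i] //= /IH. Qed.

Lemma env_cat_ge T (ys : seq T) rho i : env_cat ys rho (i + size ys) = rho i.
Proof. by elim: ys => /= [|y ys IH]; rewrite ?addn0 // addnS. Qed.

Lemma env_cat_rcons T (ys : seq T) y rho :
  env_cat (rcons ys y) rho = env_cat ys (scons y rho).
Proof. by rewrite /env_cat -cats1 foldr_cat. Qed.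

Lemma sat_iter_ex (M : structure) (rho : nat -> M) k phi :
  sat rho (iter k Ex phi) <->
  exists2 ys : seq M, size ys = k & sat (env_cat ys rho) phi.
Proof.
elim: k rho => [|k IH] rho.
  by split=> [h|[[|//]]]; [exists [::]|].
rewrite iterS sat_ex; split.
  move=> [x /IH[ys sz h]]; exists (rcons ys x); rewrite ?size_rcons ?sz //.
  by rewrite env_cat_rcons.
move=> [ys]; case/lastP: ys => // ys x; rewrite size_rcons env_cat_rcons.
by move=> [sz] h; exists x; apply/IH; exists ys.
Qed.

Definition conj (l : seq form) : form := foldr And Top l.

Lemma sat_conj (M : structure) (rho : nat -> M) (f : nat -> form) m n :
  sat rho (conj (map f (iota m n))) <->
  forall i, m <= i < m + n -> sat rho (f i).
Proof.
elim: n m => [|n IH] m; first by split=> [_ i|_ /=]; [lia|].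
rewrite [conj _]/= -/(conj _) sat_and IH; split.
  move=> [h1 h2] i hi; case: (ltngtP i m) => [|lt|->] //; first lia.
  by apply: h2; lia.
by move=> h; split=> [|i hi]; apply: h; lia.
Qed.

(* There is a class with exactly [n.+1] elements. *)
Definition exact_class (r n : nat) : form :=
  iter n.+1 Ex (And
    (conj [seq And (Rel r [:: Var 0; Var i])
                   (conj [seq Neg (Eq (Var j) (Var i)) | j <- iota 0 i])
          | i <- iota 0 n.+1])
    (All (Imp (Rel r [:: Var 1; Var 0])
       (Neg (conj [seq Neg (Eq (Var 0) (Var i.+1)) | i <- iota 0 n.+1]))))).

Lemma form_in_conj S l : form_in S (conj l) = all (form_in S) l.
Proof. by elim: l => //= phi l ->; rewrite !andbT. Qed.

Lemma form_bound_conj k l : form_bound k (conj l) = all (form_bound k) l.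
Proof. by elim: l => //= phi l ->; rewrite !andbT. Qed.

Lemma form_in_iter_ex S k phi : form_in S (iter k Ex phi) = form_in S phi.
Proof. by elim: k => //= k ->; rewrite !andbT. Qed.

Lemma form_bound_iter_ex m k phi :
  form_bound m (iter k Ex phi) = form_bound (m + k) phi.
Proof.
elim: k m => [|k IH] m; first by rewrite addn0.
by rewrite iterS /= !andbT IH addSnnS.
Qed.

Lemma all_map_iota T (f : nat -> T) (p : pred T) m n :
  (forall i, m <= i < m + n -> p (f i)) -> all p (map f (iota m n)).
Proof.
elim: n m => //= n IH m h; rewrite h ?IH //; last lia.
by move=> i hi; apply: h; lia.
Qed.

Lemma exact_class_sentence S r n : onth (rels S) r = Some 2 ->
  sentence S (exact_class r n).
Proof.
move=> rS; rewrite /sentence /exact_class form_in_iter_ex form_bound_iter_ex.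
rewrite [form_in _ _]/= [form_bound _ _]/= !andbT -!/(conj _) add0n.
rewrite !form_in_conj !form_bound_conj rS eqxx.
do 3?[apply/andP; split] => //; apply: all_map_iota => i hi //.
- rewrite [form_in _ _]/= !andbT -/(conj _) form_in_conj rS eqxx.
  by apply: all_map_iota => j.
- rewrite [form_bound _ _]/= !andbT -/(conj _) form_bound_conj.
  apply/andP; split; first by lia.
  by apply: all_map_iota => j hj /=; lia.
- by rewrite /=; lia.
Qed.

Lemma truth_exact_class a r n : truth a (exact_class r n) <-> a n.
Proof.
rewrite /truth /exact_class sat_iter_ex.
(* A canonical coordinate within class [m]: equality of elements becomes equality of numbers, and
   classes can be counted. *)
pose c m z := if a m then minn (R z) m else R z.
have sameE m z z' : L z = m -> L z' = m -> same a z z' = (c m z == c m z').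
  by move=> <- e; rewrite /same e eqxx /c; case: ifP.
split=> [[ys sz /sat_and[/sat_conj h1 h2]]|an].
  pose y i := nth pt ys i.
  have rhoE i : i < n.+1 -> env_cat ys (fun=> pt : Mod a) i = y i.
    by move=> lti; apply: env_cat_lt; rewrite sz.
  set rho := env_cat ys _ in rhoE h1 h2.
  pose m := L (y 0).
  have hcl i : i < n.+1 -> L (y i) = m.
    move=> lti; have /sat_and[/=] := h1 i lti.
    by rewrite !rhoE // => ->.
  have hne i j : i < n.+1 -> j < i -> same a (y j) (y i) = false.
    move=> lti ltj; have /sat_and[_ /sat_conj/(_ j ltj) /=] := h1 i lti.
    rewrite !rhoE //; last by apply: ltn_trans lti.
    by move/negP/negbTE.
  have cover z : L z = m -> exists2 i, i < n.+1 & same a z (y i).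
    move=> zm; apply: NNPP => no; apply: (h2 z); first by rewrite /= rhoE.
    rewrite -/(@sat (Mod a) (scons z rho) _); apply/sat_conj => i lti.
    rewrite sat_neg /= rhoE // => zi; apply: no; by exists i.
  pose cs := [seq c m (y i) | i <- iota 0 n.+1].
  have ucs : uniq cs.
    apply/(uniqP 0) => i j; rewrite !inE size_map size_iota => lti ltj.
    rewrite !(nth_map 0) ?size_iota // !nth_iota // !add0n => e.
    have s : same a (y i) (y j) by rewrite (sameE m) ?hcl // e.
    case: (ltngtP i j) => // lt.
      by rewrite hne in s.
    by rewrite same_symE hne in s.
  have ccs z : L z = m -> c m z \in cs.
    move=> zm; have [i lti zi] := cover z zm; apply/mapP; exists i.
      by rewrite mem_iota.
    by apply/eqP; rewrite -sameE ?hcl.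
  (* In an infinite class every number is a coordinate, which the [n.+1] entries of [cs] cannot
     cover. *)
  case am : (a m); last first.
    have [|k [_ _]] := @avoid cs 0 n.+2; first by rewrite size_map size_iota.
    by have := ccs (npair m k) (npairL _ _); rewrite /c am npairR => ->.
  suff e : n.+1 = m.+1 by rewrite -(succn_inj e) in am.
  have -> : n.+1 = size cs by rewrite size_map size_iota.
  rewrite -(size_iota 0 m.+1); apply/eqP; rewrite eqn_leq.
  apply/andP; split; apply: uniq_leq_size => //; try exact: iota_uniq.
    move=> k /mapP[i _ ->]; rewrite mem_iota /c am /=; lia.
  move=> k; rewrite mem_iota => /andP[_ ltk].
  have := ccs (npair m k) (npairL _ _).
  by rewrite /c am npairR (minn_idPl _).
pose ys := [seq npair n i | i <- iota 0 n.+1].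
have sz : size ys = n.+1 by rewrite size_map size_iota.
exists ys => //.
have rhoE i : i < n.+1 -> env_cat ys (fun=> pt : Mod a) i = npair n i.
  move=> lti; rewrite (env_cat_lt pt) ?sz // (nth_map 0) ?size_iota //.
  by rewrite nth_iota.
have sE i j : i < n.+1 -> j < n.+1 -> same a (npair n i) (npair n j) = (i == j).
  rewrite /same !npairE eqxx an /= => lti ltj.
  by rewrite !(minn_idPl _).
set rho := env_cat ys _ in rhoE *.
apply/sat_and; split.
  apply/sat_conj => i lti.
  apply/sat_and; split; first by rewrite /= !rhoE // !npairE.
  apply/sat_conj => j ltj.
  rewrite sat_neg /= !rhoE //; last by lia.
  by rewrite sE //; lia.
move=> z zn h; rewrite /= rhoE // npairE in zn.
have ltz : minn (R z) n < n.+1 by lia.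
have : ~ same a z (rho (minn (R z) n)).
  rewrite -/(@sat (Mod a) (scons z rho) _) in h.
  move/sat_conj: h => h; apply/negP/negP => s.
  by apply: (h (minn (R z) n)).
by apply; rewrite rhoE // /same -zn !npairE eqxx an -minnA minnn /=.
Qed.

(** * Syntactic functions on codes *)

Lemma npair00 : npair 0 0 = 0.
Proof. by []. Qed.

Lemma npair_ger a b : b <= npair a b.
Proof. exact: leq_trans (leq_addl _ _) (npair_ge a b). Qed.

Lemma npair_gtr a b : b < npair a.+1 b.
Proof. by have := npair_ge a.+1 b; lia. Qed.

Definition ctail (l : nat) : nat := ncase l 0 (fun k => R k).
Definition cdrop (l i : nat) : nat := iter i ctail l.
Definition cnth (l i : nat) : nat := ncase (cdrop l i) 0 (fun k => L k).
Definition conth (l i : nat) : nat := ncase (cdrop l i) 0 (fun k => (L k).+1).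

Lemma comp_cdrop : comp_fun (fun z => cdrop (L z) (R z)).
Proof. rewrite /cdrop /ctail; comp. Qed.
#[global] Hint Resolve comp_cdrop : comp.

Lemma comp_cnth : comp_fun (fun z => cnth (L z) (R z)).
Proof. rewrite /cnth; comp. Qed.

Lemma comp_conth : comp_fun (fun z => conth (L z) (R z)).
Proof. rewrite /conth; comp. Qed.
#[global] Hint Resolve comp_cnth comp_conth : comp.

Lemma cdropE s i : cdrop (code_seq s) i = code_seq (drop i s).
Proof.
elim: i s => [|i IH] s; first by rewrite drop0.
rewrite /cdrop iterSr; case: s => [|x s] /=.
  by rewrite -/(cdrop _ _) (IH [::]) drop_oversize.
by rewrite npairR; exact: IH.
Qed.

Lemma cnthE s i : cnth (code_seq s) i = nth 0 s i.
Proof.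
rewrite /cnth cdropE; elim: s i => [|x s IH] [|i] //=.
by rewrite npairL.
Qed.

Lemma conthE s i : conth (code_seq s) i = if onth s i is Some x then x.+1 else 0.
Proof.
rewrite /conth cdropE; elim: s i => [|x s IH] [|i] //=.
by rewrite npairL.
Qed.

(** The pattern of the recursions on codes below: recursive calls go through the oracle [g], and the
    code plus one is enough fuel because subcodes are smaller. *)
Definition csize_body (g : nat -> nat) (l : nat) : nat :=
  ncase l 0 (fun k => (g (R k)).+1).
Definition csize (l : nat) : nat := frec csize_body l.+1 l.

Lemma comp_csize_body : comp_op csize_body.
Proof. rewrite /csize_body; comp. Qed.
#[global] Hint Resolve comp_csize_body : comp.

Lemma comp_csize : comp_fun csize.
Proof. rewrite /csize; comp. Qed.
#[global] Hint Resolve comp_csize : comp.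

Lemma csizeE s : csize (code_seq s) = size s.
Proof.
suff H k : code_seq s < k -> frec csize_body k (code_seq s) = size s by exact: H.
elim: s k => [|x s IH] [|k] //= ltk; rewrite frecS /csize_body /= npairR IH //.
by have := npair_ger x (code_seq s); lia.
Qed.

Definition crcons_body (g : nat -> nat) (x : nat) : nat :=
  ncase (R x) (npair (L x) 0).+1
    (fun k => (npair (L k) (g (npair (L x) (R k)))).+1).
Definition crcons (l a : nat) : nat := frec crcons_body l.+1 (npair a l).

Lemma comp_crcons_body : comp_op crcons_body.
Proof. rewrite /crcons_body; comp. Qed.
#[global] Hint Resolve comp_crcons_body : comp.

Lemma comp_crcons : comp_fun (fun z => crcons (L z) (R z)).
Proof. rewrite /crcons; comp. Qed.
#[global] Hint Resolve comp_crcons : comp.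

Lemma crconsE s a : crcons (code_seq s) a = code_seq (rcons s a).
Proof.
suff H k : code_seq s < k ->
    frec crcons_body k (npair a (code_seq s)) = code_seq (rcons s a).
  exact: H.
elim: s k => [|x s IH] [|k] //= ltk; rewrite frecS /crcons_body !npairE //=.
by rewrite !npairE IH //; have := npair_ger x (code_seq s); lia.
Qed.

Definition ciota (m n : nat) : nat :=
  prec 0 (fun k r => (npair (m + n - k.+1) r).+1) n.

Lemma comp_ciota : comp_fun (fun z => ciota (L z) (R z)).
Proof. rewrite /ciota; comp. Qed.
#[global] Hint Resolve comp_ciota : comp.

Lemma ciotaE m n : ciota m n = code_seq (iota m n).
Proof.
rewrite /ciota; suff H k : k <= n ->
    prec 0 (fun k r => (npair (m + n - k.+1) r).+1) k =
    code_seq (iota (m + n - k) k).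
  by rewrite H // addnK.
elim: k => //= k IH lekn; rewrite IH; last by lia.
by have -> : m + n - k = (m + n - k.+1).+1 by lia.
Qed.

Definition cBot : nat := npair 0 0.
Definition cImp (a b : nat) : nat := npair 3 (npair a b).
Definition cAll (a : nat) : nat := npair 4 a.
Definition cNeg (a : nat) : nat := cImp a cBot.
Definition cAnd (a b : nat) : nat := cNeg (cImp a (cNeg b)).
Definition cEx (a : nat) : nat := cNeg (cAll (cNeg a)).

Lemma code_formE :
  (code_form Bot = npair 0 0) *
  (forall s t, code_form (Eq s t) = npair 1 (npair (code_term s) (code_term t))) *
  (forall r ts, code_form (Rel r ts) =
     npair 2 (npair r (code_seq (map code_term ts)))) *
  (forall p q, code_form (Imp p q) = npair 3 (npair (code_form p) (code_form q))) *
  (forall p, code_form (All p) = npair 4 (code_form p)).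
Proof. by []. Qed.

Lemma code_termE :
  (forall x, code_term (Var x) = npair 0 x) *
  (forall f ts, code_term (Fun f ts) =
     npair 1 (npair f (code_seq (map code_term ts)))).
Proof. by []. Qed.

#[local] Arguments code_form : simpl never.
#[local] Arguments code_term : simpl never.

(** The syntactic counterpart of expanding a structure by an empty relation [r]. *)
Fixpoint erase (r : nat) (phi : form) : form :=
  match phi with
  | Rel r' ts => if r' == r then Bot else Rel r' ts
  | Imp phi psi => Imp (erase r phi) (erase r psi)
  | All phi => All (erase r phi)
  | _ => phi
  end.

Definition cerase_body (g : nat -> nat) (x : nat) : nat :=
  if L (R x) == 2 then if L (R (R x)) == L x then cBot else R x
  else if L (R x) == 3 then
    cImp (g (npair (L x) (L (R (R x))))) (g (npair (L x) (R (R (R x)))))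
  else if L (R x) == 4 then cAll (g (npair (L x) (R (R x))))
  else R x.
Definition cerase (r n : nat) : nat := frec cerase_body n.+1 (npair r n).

Lemma comp_cerase_body : comp_op cerase_body.
Proof. rewrite /cerase_body /cImp /cAll; comp. Qed.
#[global] Hint Resolve comp_cerase_body : comp.

Lemma comp_cerase : comp_fun (fun z => cerase (L z) (R z)).
Proof. rewrite /cerase; comp. Qed.
#[global] Hint Resolve comp_cerase : comp.

Lemma code_imp_gt p q : code_form p < code_form (Imp p q) /\
  code_form q < code_form (Imp p q).
Proof.
have h1 := npair_ge 3 (npair (code_form p) (code_form q)).
have h2 := npair_ge (code_form p) (code_form q).
by rewrite code_formE; lia.
Qed.

Lemma code_all_gt p : code_form p < code_form (All p).
Proof. exact: npair_gtr. Qed.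

Lemma ceraseE r phi : cerase r (code_form phi) = code_form (erase r phi).
Proof.
suff H k : code_form phi < k ->
    frec cerase_body k (npair r (code_form phi)) = code_form (erase r phi).
  exact: H.
elim: phi k => [|s t|r' ts|p IHp q IHq|p IHp] [|k] // ltk;
  rewrite frecS {1}/cerase_body code_formE !npairE /= ?npairE //=.
- by case: eqP.
- have [ltp ltq] := code_imp_gt p q.
  by rewrite IHp ?IHq //; lia.
- by have lt := code_all_gt p; rewrite IHp //; lia.
Qed.

(* Recognizes the codes, bounded by [b], of formulas (mode 0), terms (mode 1) and
   lists of terms (mode 2) of the signature with code [S]; the argument is
   [npair mode (npair S (npair b n))]. *)
Definition cwf_body (g : nat -> nat) (x : nat) : nat :=
  if L x == 0 then
    if L (R (R (R x))) == 0 then R (R (R (R x))) == 0 : nat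
    else if L (R (R (R x))) == 1 then
      (g (npair 1 (npair (L (R x)) (npair (L (R (R x)))
           (L (R (R (R (R x)))))))) != 0) &&
      (g (npair 1 (npair (L (R x)) (npair (L (R (R x)))
           (R (R (R (R (R x)))))))) != 0) : nat
    else if L (R (R (R x))) == 2 then
      (conth (R (L (R x))) (L (R (R (R (R x))))) ==
        (csize (R (R (R (R (R x)))))).+1) &&
      (g (npair 2 (npair (L (R x)) (npair (L (R (R x)))
           (R (R (R (R (R x)))))))) != 0) : nat
    else if L (R (R (R x))) == 3 then
      (g (npair 0 (npair (L (R x)) (npair (L (R (R x)))
           (L (R (R (R (R x)))))))) != 0) &&
      (g (npair 0 (npair (L (R x)) (npair (L (R (R x)))
           (R (R (R (R (R x)))))))) != 0) : nat
    else if L (R (R (R x))) == 4 then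
      g (npair 0 (npair (L (R x)) (npair (L (R (R x))).+1
           (R (R (R (R x)))))))
    else 0
  else if L x == 1 then
    if L (R (R (R x))) == 0 then R (R (R (R x))) < L (R (R x)) : nat
    else if L (R (R (R x))) == 1 then
      (conth (L (L (R x))) (L (R (R (R (R x))))) ==
        (csize (R (R (R (R (R x)))))).+1) &&
      (g (npair 2 (npair (L (R x)) (npair (L (R (R x)))
           (R (R (R (R (R x)))))))) != 0) : nat
    else 0
  else
    ncase (R (R (R x))) 1 (fun m =>
      (g (npair 1 (npair (L (R x)) (npair (L (R (R x))) (L m)))) != 0) &&
      (g (npair 2 (npair (L (R x)) (npair (L (R (R x))) (R m)))) != 0) : nat).

Definition cwf (S b n : nat) : bool :=
  frec cwf_body n.+1 (npair 0 (npair S (npair b n))) != 0.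

Lemma comp_cwf_body : comp_op cwf_body.
Proof. rewrite /cwf_body; comp. Qed.
#[global] Hint Resolve comp_cwf_body : comp.

Lemma comp_cwf : comp_fun (fun z => cwf (L z) (L (R z)) (R (R z))).
Proof.
rewrite /cwf; comp.
Qed.
#[global] Hint Resolve comp_cwf : comp.

Lemma cwfP S b n : cwf (code_sig S) b n <->
  exists phi, [/\ n = code_form phi, form_in S phi & form_bound b phi].
Proof.
pose W k mode b n :=
  frec cwf_body k (npair mode (npair (code_sig S) (npair b n))) != 0.
rewrite -/(W n.+1 0 b n).
suff H k : (forall b n, n < k -> W k 0 b n <->
    exists phi, [/\ n = code_form phi, form_in S phi & form_bound b phi]) /\
  (forall b n, n < k -> W k 1 b n <->
    exists t, [/\ n = code_term t, term_in S t & term_bound b t]) /\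
  (forall b n, n < k -> W k 2 b n <->
    exists ts, [/\ n = code_seq (map code_term ts), all (term_in S) ts
      & all (term_bound b) ts]).
  by have [H0 _] := H n.+1; exact: H0.
elim: k {b n} => [|k [IH0 [IH1 IH2]]]; first by [].
have arity s i ts : (conth (code_seq s) i ==
    (csize (code_seq (map code_term ts))).+1) = (onth s i == Some (size ts)).
  by rewrite conthE csizeE size_map; case: onth.
have pairE n : exists t m, n = npair t m.
  by exists (L n), (R n); rewrite nunpairK.
split; [|split] => b n; have [t [m ->]] := pairE n.
- case: t => [|[|[|[|[|t]]]]] ltm;
    rewrite /W frecS {1}/cwf_body !npairE /= ?eqb0 ?negbK.
  + split=> [/eqP ->|]; first by exists Bot.
    by move=> [[|? ?|? ?|? ?|?] [/npair_inj[] // _ ->]].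
  + have [u [v e]] := pairE m; rewrite {m}e in ltm *.
    have h1 := npair_ge 1 (npair u v); have h2 := npair_ge u v.
    rewrite !npairE -!/(W _ _ _ _); split.
      move=> /andP[/IH1[|s [-> s1 s2]]]; first lia.
      move=> /IH1[|s' [-> s1' s2']]; first lia.
      by exists (Eq s s'); rewrite /= s1 s1' s2 s2'.
    move=> [[|s s'|? ?|? ?|?] [/npair_inj[] // _ /npair_inj[eu ev]]]; subst u v => /=.
    move=> /andP[s1 s1'] /andP[s2 s2']; apply/andP; split; apply/IH1; try lia.
      by exists s.
    by exists s'.
  + have [r [l e]] := pairE m; rewrite {m}e in ltm *.
    have h1 := npair_ge 2 (npair r l); have h2 := npair_ge r l.
    rewrite !npairE -!/(W _ _ _ _); split.
      move=> /andP[ar /IH2[|ts [e1 s1 s2]]]; first lia.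
      exists (Rel r ts); split=> //=; first by rewrite e1.
      by rewrite s1 -arity -e1 ar.
    move=> [[|? ?|r' ts|? ?|?] [/npair_inj[] // _ /npair_inj[er el]]]; subst r l => /=.
    move=> /andP[ar s1] s2; rewrite arity ar; apply/IH2; last by exists ts.
    lia.
  + have [u [v e]] := pairE m; rewrite {m}e in ltm *.
    have h1 := npair_ge 3 (npair u v); have h2 := npair_ge u v.
    rewrite !npairE -!/(W _ _ _ _); split.
      move=> /andP[/IH0[|s [-> s1 s2]]]; first lia.
      move=> /IH0[|s' [-> s1' s2']]; first lia.
      by exists (Imp s s'); rewrite /= s1 s1' s2 s2'.
    move=> [[|? ?|? ?|s s'|?] [/npair_inj[] // _ /npair_inj[eu ev]]]; subst u v => /=.
    move=> /andP[s1 s1'] /andP[s2 s2']; apply/andP; split; apply/IH0; try lia.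
      by exists s.
    by exists s'.
  + have h1 := npair_ge 4 m; rewrite -!/(W _ _ _ _); split.
      by move=> /IH0[|s [-> s1 s2]]; [lia|exists (All s)].
    move=> [[|? ?|? ?|? ?|s] [/npair_inj[] // _ em]]; subst m => /= s1 s2.
    by apply/IH0; [lia|exists s].
  + by split=> // -[[|? ?|? ?|? ?|?] [/npair_inj[]]].
- case: t => [|[|t]] ltm;
    rewrite /W frecS {1}/cwf_body !npairE /= ?eqb0 ?negbK.
  + split=> [ltmb|]; first by exists (Var m).
    by move=> [[x|? ?] [/npair_inj[] // _ ->]].
  + have [r [l e]] := pairE m; rewrite {m}e in ltm *.
    have h1 := npair_ge 1 (npair r l); have h2 := npair_ge r l.
    rewrite !npairE -!/(W _ _ _ _); split.
      move=> /andP[ar /IH2[|ts [e1 s1 s2]]]; first lia.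
      exists (Fun r ts); split=> //=; first by rewrite e1.
      by rewrite s1 -arity -e1 ar.
    move=> [[?|r' ts] [/npair_inj[] // _ /npair_inj[er el]]]; subst r l => /=.
    move=> /andP[ar s1] s2; rewrite arity ar; apply/IH2; last by exists ts.
    lia.
  + by split=> // -[[?|? ?] [/npair_inj[]]].
- case: (npair t m) => [|l] ltl; rewrite /W frecS {1}/cwf_body !npairE /=.
    by split=> // _; exists [::].
  have [u [v e]] := pairE l; rewrite {l}e in ltl *.
  have h := npair_ge u v; rewrite eqb0 negbK !npairE -!/(W _ _ _ _); split.
    move=> /andP[/IH1[|s [-> s1 s2]]]; first lia.
    move=> /IH2[|ts [-> s1' s2']]; first lia.
    by exists (s :: ts); rewrite /= s1 s1' s2 s2'.
  move=> [[|s ts] [] //= [/npair_inj[eu ev]]]; subst u v.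
  move=> /andP[s1 s1'] /andP[s2 s2']; apply/andP; split.
    by apply/IH1; [lia|exists s].
  by apply/IH2; [lia|exists ts].
Qed.

(** Numbers below [2 ^ m] stand for the finite 0-1 sequences of length [m], continued by zeros; so a
    bounded quantifier over numbers ranges over all of them. *)
Definition bit (s n : nat) : bool := odd (iter n half s).

Lemma comp_bit : comp_fun (fun z => bit (L z) (R z)).
Proof. rewrite /bit; comp. Qed.
#[global] Hint Resolve comp_bit : comp.

Lemma bit_ge s m n : s < 2 ^ m -> m <= n -> bit s n = false.
Proof.
move=> lts lemn; rewrite /bit -(subnK lemn) iterD.
have -> : iter m half s = 0.
  elim: m s lts {lemn} => [|m IH] s; first by rewrite expn0; case: s.
  by rewrite expnS iterSr => lts; apply: IH; lia.
suff -> : iter (n - m) half 0 = 0 by [].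
by elim: (n - m) => //= k ->.
Qed.

Lemma bits_ex (a : nat -> bool) m :
  exists2 s, s < 2 ^ m & forall n, n < m -> bit s n = a n.
Proof.
elim: m a => [|m IH] a; first by exists 0.
have [s lts sa] := IH (fun n => a n.+1); exists (a 0 + s.*2).
  by rewrite expnS; case: (a 0); lia.
move=> [|n] ltn; first by rewrite /bit /= oddD odd_double addbF oddb.
by rewrite /bit iterSr half_bit_double; exact: sa.
Qed.

Definition cvalue (env t : nat) : nat := if L t == 0 then cnth env (R t) else 0.

(** The minimum is spelled out as a double truncated subtraction, and the conditional as a
    disjunction, to stay within the reach of [comp]. *)
Definition csame (s x y : nat) : bool :=
  (L x == L y) &&
  (bit s (L x) && (R x - (R x - L x) == R y - (R y - L x)) ||
   ~~ bit s (L x) && (R x == R y)).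

Lemma comp_cvalue : comp_fun (fun z => cvalue (L z) (R z)).
Proof. rewrite /cvalue; comp. Qed.

Lemma comp_csame : comp_fun (fun z => csame (L z) (L (R z)) (R (R z))).
Proof. rewrite /csame; comp. Qed.
#[global] Hint Resolve comp_cvalue comp_csame : comp.

Lemma csameE s x y : csame s x y = same (bit s) x y.
Proof.
rewrite /csame /same !minnE; case: (bit s (L x)) => //=.
by rewrite orbF.
Qed.

Lemma cvalueE env t : cvalue (code_seq env) (code_term t) = vval env t.
Proof. by case: t => [x|f ts]; rewrite /cvalue code_termE !npairE ?cnthE. Qed.

(* The argument is [npair (npair N s) (npair env n)]. *)
Definition csat_body (g : nat -> nat) (x : nat) : nat :=
  if L (R (R x)) == 1 then
    csame (R (L x)) (cvalue (L (R x)) (L (R (R (R x)))))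
      (cvalue (L (R x)) (R (R (R (R x))))) : nat
  else if L (R (R x)) == 2 then
    (csize (R (R (R (R x)))) == 2) &&
    (L (cvalue (L (R x)) (cnth (R (R (R (R x)))) 0)) ==
     L (cvalue (L (R x)) (cnth (R (R (R (R x)))) 1))) : nat
  else if L (R (R x)) == 3 then
    (g (npair (L x) (npair (L (R x)) (L (R (R (R x)))))) == 0) ||
    (g (npair (L x) (npair (L (R x)) (R (R (R (R x)))))) != 0) : nat
  else if L (R (R x)) == 4 then
    ball (L (L x)) (fun i => ball (L (L x)) (fun j =>
      g (npair (L x) (npair (npair (npair i j) (L (R x))).+1
           (R (R (R x))))) != 0)) : nat
  else 0.

Definition csat (N s n : nat) : bool :=
  frec csat_body n.+1 (npair (npair N s) (npair 0 n)) != 0.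

Lemma comp_csat_body : comp_op csat_body.
Proof. rewrite /csat_body; comp. Qed.
#[global] Hint Resolve comp_csat_body : comp.

Lemma comp_csat : comp_fun (fun z => csat (L z) (L (R z)) (R (R z))).
Proof. rewrite /csat; comp. Qed.
#[global] Hint Resolve comp_csat : comp.

Lemma csatP N s phi :
  csat N s (code_form phi) <-> bsat (bit s) (below (Some N)) [::] phi.
Proof.
suff H k env : code_form phi < k ->
    frec csat_body k (npair (npair N s) (npair (code_seq env) (code_form phi))) != 0
    <-> bsat (bit s) (below (Some N)) env phi.
  exact: (H _ [::]).
elim: phi k env => [|u v|r ts|p IHp q IHq|p IHp] [|k] // env ltk;
  rewrite frecS {1}/csat_body code_formE !npairE /= ?eqb0 ?negbK.
- by [].
- by rewrite csameE !cvalueE.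
- rewrite csizeE size_map !cnthE.
  case: ts ltk => [|u [|v [|? ?]]] //= _.
  by rewrite !cvalueE; split=> /eqP.
- have [ltp ltq] := code_imp_gt p q.
  rewrite -(IHp k env); last by lia.
  rewrite -(IHq k env); last by lia.
  split=> [/orP[/eqP -> //|]//|h]; apply/orP.
  by case: (eqVneq (frec _ _ _) 0) => [|/h]; [left|right].
- have lt := code_all_gt p; split=> [/ballP h x /andP[x1 x2]|h].
    have /ballP/(_ _ x2) := h _ x1; rewrite nunpairK => hx.
    by apply/(IHp k (x :: env)); first lia.
  apply/ballP => i lti; apply/ballP => j ltj.
  apply/(IHp k (npair i j :: env)); first lia.
  by apply: h; rewrite !npairE lti.
Qed.

(* Renaming of the variables according to the list [xs], below [d] binders;
   the argument is [npair mode (npair d (npair xs n))]. *)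
Definition cren_body (g : nat -> nat) (x : nat) : nat :=
  if L x == 0 then
    if L (R (R (R x))) == 1 then
      npair 1 (npair
        (g (npair 1 (npair (L (R x)) (npair (L (R (R x)))
              (L (R (R (R (R x)))))))))
        (g (npair 1 (npair (L (R x)) (npair (L (R (R x)))
              (R (R (R (R (R x))))))))))
    else if L (R (R (R x))) == 2 then
      npair 2 (npair (L (R (R (R (R x)))))
        (g (npair 2 (npair (L (R x)) (npair (L (R (R x)))
              (R (R (R (R (R x))))))))))
    else if L (R (R (R x))) == 3 then
      npair 3 (npair
        (g (npair 0 (npair (L (R x)) (npair (L (R (R x)))
              (L (R (R (R (R x)))))))))
        (g (npair 0 (npair (L (R x)) (npair (L (R (R x)))
              (R (R (R (R (R x))))))))))
    else if L (R (R (R x))) == 4 then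
      npair 4 (g (npair 0 (npair (L (R x)).+1 (npair (L (R (R x)))
        (R (R (R (R x))))))))
    else cBot
  else if L x == 1 then
    if L (R (R (R x))) == 0 then
      npair 0 (if R (R (R (R x))) < L (R x) then R (R (R (R x)))
               else cnth (L (R (R x))) (R (R (R (R x))) - L (R x)) + L (R x))
    else
      npair 1 (npair (L (R (R (R (R x)))))
        (g (npair 2 (npair (L (R x)) (npair (L (R (R x)))
              (R (R (R (R (R x))))))))))
  else ncase (R (R (R x))) 0 (fun m =>
    (npair (g (npair 1 (npair (L (R x)) (npair (L (R (R x))) (L m)))))
           (g (npair 2 (npair (L (R x)) (npair (L (R (R x))) (R m)))))).+1).

Definition cinst (n xs : nat) : nat :=
  frec cren_body n.+1 (npair 0 (npair 0 (npair xs n))).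

Lemma comp_cren_body : comp_op cren_body.
Proof. rewrite /cren_body /cBot; comp. Qed.
#[global] Hint Resolve comp_cren_body : comp.

Lemma comp_cinst : comp_fun (fun z => cinst (L z) (R z)).
Proof. rewrite /cinst; comp. Qed.
#[global] Hint Resolve comp_cinst : comp.

Lemma iter_up d (s : nat -> nat) x : iter d up (fun x => Var (s x)) x =
  Var (if x < d then x else s (x - d) + d).
Proof.
elim: d x => [|d IH] x; first by rewrite /= subn0 addn0.
case: x => [|x] //=; rewrite IH /lift_term /= subSS ltnS.
by case: ltnP => // _; rewrite addnS.
Qed.

Lemma cinstE phi xs :
  cinst (code_form phi) (code_seq xs) = code_form (inst phi xs).
Proof.
pose s d := iter d up (fun x => Var (nth 0 xs x)).
have args ts k d :
    forall_terms (fun t => forall k, code_term t < k ->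
      frec cren_body k (npair 1 (npair d (npair (code_seq xs) (code_term t)))) =
      code_term (subst_term (s d) t)) ts ->
    code_seq (map code_term ts) < k ->
    frec cren_body k
      (npair 2 (npair d (npair (code_seq xs) (code_seq (map code_term ts))))) =
    code_seq (map code_term (map (subst_term (s d)) ts)).
  elim: ts k => [|t ts IH] [|k] //= hts ltk; rewrite frecS {1}/cren_body !npairE //=.
  have h := npair_ge (code_term t) (code_seq (map code_term ts)).
  rewrite !npairE IH //; [|exact: hts.2|by lia].
  by rewrite hts.1 //; lia.
have Ht t d k : code_term t < k ->
    frec cren_body k (npair 1 (npair d (npair (code_seq xs) (code_term t)))) =
    code_term (subst_term (s d) t).
  elim/nested_term_ind: t k => [x|f ts IH] [|k] // ltk;
    rewrite frecS {1}/cren_body code_termE !npairE /=.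
    by rewrite /s iter_up cnthE code_termE.
  have h1 := npair_ge 1 (npair f (code_seq (map code_term ts))).
  have h2 := npair_ge f (code_seq (map code_term ts)).
  rewrite code_termE in ltk.
  by rewrite ?npairE args ?code_termE //; lia.
have Hts ts d k : code_seq (map code_term ts) < k ->
    frec cren_body k
      (npair 2 (npair d (npair (code_seq xs) (code_seq (map code_term ts))))) =
    code_seq (map code_term (map (subst_term (s d)) ts)).
  by apply: args; apply: forall_terms_all => t k'; exact: Ht.
suff H k d : code_form phi < k ->
    frec cren_body k (npair 0 (npair d (npair (code_seq xs) (code_form phi)))) =
    code_form (subst_form (s d) phi).
  exact: (H _ 0).
elim: phi k d => [|u v|r ts|p IHp q IHq|p IHp] [|k] // d ltk;
  rewrite frecS {1}/cren_body; rewrite code_formE in ltk *; rewrite !npairE /=.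
- by [].
- have h1 := npair_ge 1 (npair (code_term u) (code_term v)).
  have h2 := npair_ge (code_term u) (code_term v).
  by rewrite ?npairE !Ht //; lia.
- have h1 := npair_ge 2 (npair r (code_seq (map code_term ts))).
  have h2 := npair_ge r (code_seq (map code_term ts)).
  by rewrite ?npairE Hts //; lia.
- have h1 := npair_ge 3 (npair (code_form p) (code_form q)).
  have h2 := npair_ge (code_form p) (code_form q).
  by rewrite ?npairE IHp ?IHq //; lia.
- have h1 := npair_ge 4 (code_form p).
  by rewrite ?npairE IHp //; lia.
Qed.

(* A translation is coded by [npair dom (npair eq (npair funs rels))]. *)
Definition cdom (I : nat) : nat := cinst (L I) (npair 0 0).+1.
Definition ceq (I x y : nat) : nat :=
  cinst (L (R I)) (npair x (npair y 0).+1).+1.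
Definition cexD (I a : nat) : nat := cEx (cAnd (cdom I) a).

Lemma comp_cdom : comp_fun cdom.
Proof. rewrite /cdom; comp. Qed.

Lemma comp_ceq : comp_fun (fun z => ceq (L z) (L (R z)) (R (R z))).
Proof. rewrite /ceq; comp. Qed.
#[global] Hint Resolve comp_cdom comp_ceq : comp.

Lemma comp_cexD : comp_fun (fun z => cexD (L z) (R z)).
Proof. rewrite /cexD /cEx /cAll /cAnd /cNeg /cImp /cBot; comp. Qed.
#[global] Hint Resolve comp_cexD : comp.

(* Translates formulas (mode 0), and computes the graphs of terms (mode 1) and
   of lists of terms (mode 2); the argument is
   [npair mode (npair I (npair (npair d y) n))]. *)
Definition ctr_body (g : nat -> nat) (x : nat) : nat :=
  if L x == 0 then
    if L (R (R (R x))) == 1 then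
      cexD (L (R x)) (cAnd
        (g (npair 1 (npair (L (R x)) (npair (npair 1 0)
              (L (R (R (R (R x)))))))))
        (g (npair 1 (npair (L (R x)) (npair (npair 1 0)
              (R (R (R (R (R x))))))))))
    else if L (R (R (R x))) == 2 then
      iter (csize (R (R (R (R (R x)))))) (cexD (L (R x))) (cAnd
        (g (npair 2 (npair (L (R x)) (npair
              (npair (csize (R (R (R (R (R x)))))) 0)
              (R (R (R (R (R x)))))))))
        (cinst (cnth (R (R (R (L (R x))))) (L (R (R (R (R x))))))
               (ciota 0 (csize (R (R (R (R (R x)))))))))
    else if L (R (R (R x))) == 3 then
      cImp
        (g (npair 0 (npair (L (R x)) (npair (L (R (R x)))
              (L (R (R (R (R x)))))))))
        (g (npair 0 (npair (L (R x)) (npair (L (R (R x)))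
              (R (R (R (R (R x)))))))))
    else if L (R (R (R x))) == 4 then
      cAll (cImp (cdom (L (R x)))
        (g (npair 0 (npair (L (R x)) (npair (L (R (R x)))
              (R (R (R (R x)))))))))
    else cBot
  else if L x == 1 then
    if L (R (R (R x))) == 0 then
      ceq (L (R x)) (R (R (R (R x))) + L (L (R (R x)))) (R (L (R (R x))))
    else
      iter (csize (R (R (R (R (R x)))))) (cexD (L (R x))) (cAnd
        (g (npair 2 (npair (L (R x)) (npair
              (npair (L (L (R (R x))) + csize (R (R (R (R (R x)))))) 0)
              (R (R (R (R (R x)))))))))
        (cinst (cnth (L (R (R (L (R x))))) (L (R (R (R (R x))))))
           (crcons (ciota 0 (csize (R (R (R (R (R x)))))))
              (R (L (R (R x))) + csize (R (R (R (R (R x)))))))))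
  else ncase (R (R (R x))) (cNeg cBot) (fun m => cAnd
    (g (npair 1 (npair (L (R x)) (npair (L (R (R x))) (L m)))))
    (g (npair 2 (npair (L (R x)) (npair
          (npair (L (L (R (R x)))) (R (L (R (R x)))).+1) (R m)))))).

Definition ctr (I n : nat) : nat :=
  frec ctr_body n.+1 (npair 0 (npair I (npair 0 n))).

Lemma comp_ctr_body : comp_op ctr_body.
Proof. rewrite /ctr_body /cAll /cAnd /cNeg /cImp /cBot; comp. Qed.
#[global] Hint Resolve comp_ctr_body : comp.

Lemma comp_ctr : comp_fun (fun z => ctr (L z) (R z)).
Proof. rewrite /ctr; comp. Qed.
#[global] Hint Resolve comp_ctr : comp.

(** A finite list codes a function on all symbols: past its end [cnth] returns [0], which is the
    code of [Bot]. *)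
Record represents (I : nat) (J : translation) : Prop := Represents {
  rep_dom : L I = code_form (tr_dom J);
  rep_eq : L (R I) = code_form (tr_eq J);
  rep_fun : forall f, cnth (L (R (R I))) f = code_form (tr_fun J f);
  rep_rel : forall r, cnth (R (R (R I))) r = code_form (tr_rel J r)
}.

Section Translate.
Variables (I : nat) (J : translation).
Hypothesis IJ : represents I J.

Lemma cdomE : cdom I = code_form (dom_at J 0).
Proof. by rewrite /cdom (rep_dom IJ) (cinstE _ [:: 0]). Qed.

Lemma ceqE x y : ceq I x y = code_form (eq_at J x y).
Proof. by rewrite /ceq (rep_eq IJ) (cinstE _ [:: x; y]). Qed.

Lemma cexDE phi : cexD I (code_form phi) = code_form (exD J phi).
Proof. by rewrite /cexD cdomE. Qed.

Lemma iter_cexD k phi :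
  iter k (cexD I) (code_form phi) = code_form (iter k (exD J) phi).
Proof. by elim: k => //= k ->; exact: cexDE. Qed.

Lemma cAndE p q : cAnd (code_form p) (code_form q) = code_form (And p q).
Proof. by []. Qed.

Lemma ctrE phi : ctr I (code_form phi) = code_form (tr_form J phi).
Proof.
have args ts k d i :
    forall_terms (fun t => forall k d y, code_term t < k ->
      frec ctr_body k (npair 1 (npair I (npair (npair d y) (code_term t)))) =
      code_form (tr_graph J d t y)) ts ->
    code_seq (map code_term ts) < k ->
    frec ctr_body k (npair 2 (npair I (npair (npair d i)
      (code_seq (map code_term ts))))) =
    code_form (conj_args (tr_graph J d) ts i).
  elim: ts k i => [|t ts IH] [|k] i //= hts ltk; rewrite frecS {1}/ctr_body !npairE //=.
  have h := npair_ge (code_term t) (code_seq (map code_term ts)).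
  rewrite !npairE IH //; [|exact: hts.2|by lia].
  by rewrite hts.1 //; lia.
have Ht t k d y : code_term t < k ->
    frec ctr_body k (npair 1 (npair I (npair (npair d y) (code_term t)))) =
    code_form (tr_graph J d t y).
  elim/nested_term_ind: t k d y => [x|f ts IH] [|k] // d y ltk;
    rewrite frecS {1}/ctr_body code_termE !npairE /=.
    exact: ceqE.
  have h1 := npair_ge 1 (npair f (code_seq (map code_term ts))).
  have h2 := npair_ge f (code_seq (map code_term ts)).
  rewrite code_termE in ltk; rewrite ?npairE args //; last by lia.
  rewrite csizeE size_map ciotaE crconsE (rep_fun IJ) cinstE cAndE.
  exact: iter_cexD.
have Hts ts k d i : code_seq (map code_term ts) < k ->
    frec ctr_body k (npair 2 (npair I (npair (npair d i)
      (code_seq (map code_term ts))))) =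
    code_form (conj_args (tr_graph J d) ts i).
  by apply: args; apply: forall_terms_all => t k' d' y; exact: Ht.
suff H k d : code_form phi < k ->
    frec ctr_body k (npair 0 (npair I (npair d (code_form phi)))) =
    code_form (tr_form J phi).
  exact: H.
elim: phi k d => [|u v|r ts|p IHp q IHq|p IHp] [|k] // d ltk;
  rewrite frecS {1}/ctr_body; rewrite code_formE in ltk *; rewrite !npairE /=.
- by [].
- have h1 := npair_ge 1 (npair (code_term u) (code_term v)).
  have h2 := npair_ge (code_term u) (code_term v).
  rewrite !Ht; try lia.
  by rewrite cAndE cexDE.
- have h1 := npair_ge 2 (npair r (code_seq (map code_term ts))).
  have h2 := npair_ge r (code_seq (map code_term ts)).
  rewrite ?npairE Hts; last by lia.
  rewrite csizeE size_map ciotaE (rep_rel IJ) cinstE cAndE.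
  exact: iter_cexD.
- have h1 := npair_ge 3 (npair (code_form p) (code_form q)).
  have h2 := npair_ge (code_form p) (code_form q).
  by rewrite IHp ?IHq //; lia.
- have h1 := npair_ge 4 (code_form p).
  by rewrite IHp ?cdomE //; lia.
Qed.

End Translate.

(* Here [R j] codes a translation and [L j] bounds its free variables. *)
Definition cvalid (S j : nat) : bool :=
  [&& cwf S (L j) (L (R j)), cwf S (L j) (L (R (R j))),
      ball (csize (L (R (R (R j)))))
        (fun i => cwf S (L j) (cnth (L (R (R (R j)))) i))
    & ball (csize (R (R (R (R j)))))
        (fun i => cwf S (L j) (cnth (R (R (R (R j)))) i))].

Lemma comp_cvalid : comp_fun (fun z => cvalid (L z) (R z)).
Proof. rewrite /cvalid; comp. Qed.
#[global] Hint Resolve comp_cvalid : comp.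

Lemma code_seq_surj l : exists s, l = code_seq s.
Proof.
elim/ltn_ind: l => -[|l] IH; first by exists [::].
have [|s e] := IH (R l).
  by have := npair_ger (L l) (R l); rewrite nunpairK; lia.
by exists (L l :: s); rewrite /= -e nunpairK.
Qed.

Lemma valid_represents S j : cvalid (code_sig S) j ->
  exists J, represents (R j) J.
Proof.
have form_list l : ball (csize l) (fun i => cwf (code_sig S) (L j) (cnth l i)) ->
    exists F : nat -> form, forall i, cnth l i = code_form (F i).
  move=> /ballP h; apply: (choice (fun i phi => cnth l i = code_form phi)) => i.
  have [s e] := code_seq_surj l; case: (ltnP i (csize l)) => [/h|].
    by move=> /cwfP[phi [-> _ _]]; exists phi.
  by rewrite e csizeE cnthE => ge; exists Bot; rewrite nth_default.
move=> /and4P[/cwfP[d [hd _ _]] /cwfP[q [hq _ _]] /form_list[F hF] /form_list[G hG]].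
by exists (Translation d q F G).
Qed.

Lemma onth_lt (s : seq nat) i : i < size s -> exists n, onth s i = Some n.
Proof. by elim: s i => // x s IH [|i] /=; [exists x|exact: IH]. Qed.

Lemma tr_form_agree S J J' phi : tr_dom J = tr_dom J' -> tr_eq J = tr_eq J' ->
  (forall f n, onth (funs S) f = Some n -> tr_fun J f = tr_fun J' f) ->
  (forall r n, onth (rels S) r = Some n -> tr_rel J r = tr_rel J' r) ->
  form_in S phi -> tr_form J phi = tr_form J' phi.
Proof.
move=> hd he hf hr.
have exE p : exD J p = exD J' p by rewrite /exD /dom_at hd.
have iexE k p : iter k (exD J) p = iter k (exD J') p.
  by elim: k => //= k ->.
have args ts d i :
    forall_terms (fun t => forall d y, tr_graph J d t y = tr_graph J' d t y) ts ->
    conj_args (tr_graph J d) ts i = conj_args (tr_graph J' d) ts i.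
  by elim: ts i => //= t ts IH i [-> /IH ->].
have Ht t d y : term_in S t -> tr_graph J d t y = tr_graph J' d t y.
  elim/nested_term_ind: t d y => [x|f ts IH] d y /=; first by rewrite /eq_at he.
  move=> /andP[/eqP fS tsS]; rewrite iexE (hf _ _ fS) args //.
  by apply: all_terms tsS; apply: sub_terms IH => t ht tS d' y'; exact: ht.
elim: phi => [|u v|r ts|p IHp q IHq|p IHp] //=.
- by move=> /andP[uS vS]; rewrite exE !Ht.
- move=> /andP[/eqP rS tsS]; rewrite iexE (hr _ _ rS) args //.
  apply: all_terms tsS; apply: forall_terms_all => t tS d y; exact: Ht.
- by move=> /andP[/IHp -> /IHq ->].
- by move=> /IHp ->; rewrite /allD /dom_at hd.
Qed.

(** Finiteness of the signature matters here: on formulas of [S0] a translation is determined by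
    finitely many formulas, which one number can list. *)
Lemma represented S0 S J : wf_translation J S0 S ->
  exists j J', [/\ cvalid (code_sig S) j, represents (R j) J'
    & forall phi, form_in S0 phi -> tr_form J phi = tr_form J' phi].
Proof.
move=> [/andP[dS _] /andP[qS _] fS rS].
pose F := [seq tr_fun J f | f <- iota 0 (size (funs S0))].
pose G := [seq tr_rel J r | r <- iota 0 (size (rels S0))].
have [b hb] := forms_bound_ex (tr_dom J :: tr_eq J :: F ++ G).
pose j := npair b (npair (code_form (tr_dom J)) (npair (code_form (tr_eq J))
  (npair (code_seq (map code_form F)) (code_seq (map code_form G))))).
pose J' := Translation (tr_dom J) (tr_eq J) (nth Bot F) (nth Bot G).
have nthE H i : nth 0 (map code_form H) i = code_form (nth Bot H i).
  case: (ltnP i (size H)) => [lt|ge]; first exact: nth_map.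
  by rewrite !nth_default ?size_map.
have nthF i : i < size (funs S0) -> nth Bot F i = tr_fun J i.
  by move=> lt; rewrite (nth_map 0) ?size_iota // nth_iota.
have nthG i : i < size (rels S0) -> nth Bot G i = tr_rel J i.
  by move=> lt; rewrite (nth_map 0) ?size_iota // nth_iota.
have some_lt (s : seq nat) i n : onth s i = Some n -> i < size s.
  by elim: s i => [|x s IH] [|i] //= /IH.
exists j, J'; split.
- move: hb; rewrite /= all_cat => /and4P[hd hq hF hG].
  have nth_bound H i : all (form_bound b) H -> i < size H -> form_bound b (nth Bot H i).
    by elim: H i => //= p H IH [|i] /andP[hp hH] //= /(IH _ hH).
  rewrite /cvalid /j !npairE; apply/and4P; split.
  + by apply/cwfP; exists (tr_dom J).
  + by apply/cwfP; exists (tr_eq J).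
  + apply/ballP => i; rewrite csizeE cnthE nthE size_map => lti.
    have lti' := lti; rewrite size_map size_iota in lti'.
    have [n hn] := onth_lt lti'.
    apply/cwfP; exists (nth Bot F i); split=> //; last exact: nth_bound.
    by rewrite nthF //; have /andP[] := fS _ _ hn.
  + apply/ballP => i; rewrite csizeE cnthE nthE size_map => lti.
    have lti' := lti; rewrite size_map size_iota in lti'.
    have [n hn] := onth_lt lti'.
    apply/cwfP; exists (nth Bot G i); split=> //; last exact: nth_bound.
    by rewrite nthG //; have /andP[] := rS _ _ hn.
- by split; rewrite /j ?npairE // => i; rewrite cnthE nthE.
- move=> phi phiS; apply: tr_form_agree phiS => // i n /some_lt lt /=.
    by rewrite nthF.
  by rewrite nthG.
Qed.

(** * The meet of a theory and a theory of equivalence relations *)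

(** The new symbol comes last, so that the old ones keep their numbers and formulas of [S] need no
    renaming. *)
Definition add_rel (S : signature) : signature :=
  Signature (funs S) (rcons (rels S) 2).

Definition new_rel (S : signature) : nat := size (rels S).

Lemma onth_rcons (s : seq nat) a i :
  onth (rcons s a) i = if i == size s then Some a else onth s i.
Proof. by elim: s i => [|x s IH] [|i] //=; case: i. Qed.

Lemma onth_size (s : seq nat) : onth s (size s) = None.
Proof. by elim: s. Qed.

Lemma onth_add_rel S : onth (rels (add_rel S)) (new_rel S) = Some 2.
Proof. by rewrite onth_rcons eqxx. Qed.

Lemma term_in_add_rel S t : term_in (add_rel S) t = term_in S t.
Proof.
elim/nested_term_ind: t => //= f ts IH; congr andb.
by elim: ts IH => //= t ts IHts [-> /IHts ->].
Qed.

Lemma form_in_add_rel S phi : form_in S phi -> form_in (add_rel S) phi.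
Proof.
elim: phi => [|u v|r ts|p IHp q IHq|p IHp] //=.
- by rewrite !term_in_add_rel.
- move=> /andP[rS tsS]; rewrite onth_rcons; case: (r =P _) => [e|_].
    by rewrite e onth_size in rS.
  by rewrite rS (eq_all (@term_in_add_rel S)).
- by move=> /andP[/IHp -> /IHq].
Qed.

Lemma form_in_erase S phi :
  form_in (add_rel S) phi -> form_in S (erase (new_rel S) phi).
Proof.
elim: phi => [|u v|r ts|p IHp q IHq|p IHp] //=.
- by rewrite !term_in_add_rel.
- rewrite onth_rcons /new_rel; case: (r =P _) => //= _.
  by rewrite (eq_all (@term_in_add_rel S)).
- by move=> /andP[/IHp -> /IHq].
Qed.

Lemma form_bound_erase k r phi :
  form_bound k phi -> form_bound k (erase r phi).
Proof.
elim: phi k => [|u v|r' ts|p IHp q IHq|p IHp] k //=.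
- by case: ifP.
- by move=> /andP[/IHp -> /IHq].
- exact: IHp.
Qed.

Lemma sentence_erase S phi :
  sentence (add_rel S) phi -> sentence S (erase (new_rel S) phi).
Proof.
by move=> /andP[h1 h2]; rewrite /sentence form_in_erase // form_bound_erase.
Qed.

Lemma erase_id S phi : form_in S phi -> erase (new_rel S) phi = phi.
Proof.
elim: phi => [|u v|r ts|p IHp q IHq|p IHp] //=.
- by move=> /andP[/eqP rS _]; case: (r =P _) rS => // ->; rewrite onth_size.
- by move=> /andP[/IHp -> /IHq ->].
- by move=> /IHp ->.
Qed.

Definition expand (r : nat) (M : structure) : structure := {|
  carrier := M;
  eqs := @eqs M;
  funs_of := @funs_of M;
  rels_of := fun r' xs => if r' == r then False else rels_of r' xs
|}.

Lemma value_expand r (M : structure) (rho : nat -> M) t :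
  @value (expand r M) rho t = value rho t.
Proof.
elim/nested_term_ind: t => //= f ts IH; congr funs_of.
exact: eq_map_terms.
Qed.

Lemma sat_expand r (M : structure) (rho : nat -> M) phi :
  @sat (expand r M) rho phi <-> sat rho (erase r phi).
Proof.
elim: phi rho => [|u v|r' ts|p IHp q IHq|p IHp] rho //=.
- by rewrite !value_expand.
- case: (r' =P r) => //= _.
  by rewrite (eq_map (@value_expand r M rho)).
- by rewrite IHp IHq.
- by split=> h x; apply/IHp; exact: h.
Qed.

Lemma expand_congruent S M : congruent S M ->
  congruent (add_rel S) (expand (new_rel S) M).
Proof.
have seqE xs ys : @eqs_seq (expand (new_rel S) M) xs ys -> @eqs_seq M xs ys.
  by elim: xs ys => [|x xs IH] [|y ys] //= [? /IH].
move=> [h1 h2 h3 h4 h5]; split=> //=.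
  by move=> f xs ys fS /seqE; exact: h4.
move=> r xs ys; rewrite onth_rcons /new_rel; case: (r =P _) => // _ rS /seqE.
exact: h5.
Qed.

Lemma thm_complete (U : theory) phi : sentence (sig U) phi ->
  (forall M : structure, congruent (sig U) M -> models M U ->
     forall rho : nat -> M, sat rho phi) -> U phi.
Proof.
move=> phiS h; apply: thm_closed => //.
apply: completeness h; first exact: (@thm_sentence U).
by case/andP: phiS.
Qed.

Lemma sat_closed (M : structure) (rho rho' : nat -> M) phi :
  form_bound 0 phi -> sat rho phi -> sat rho' phi.
Proof. by move=> b h; apply/(@eq_sat _ rho' rho 0 phi). Qed.

Section Meet.
Variables (U : theory) (C : (nat -> bool) -> Prop).
Let S := sig U.

Definition meet_thm (phi : form) : Prop :=
  [/\ sentence (add_rel S) phi, U (erase (new_rel S) phi)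
    & forall a, C a -> truth a phi].

Lemma Mod_models a : C a -> models (Mod a) meet_thm.
Proof.
move=> Ca phi [/andP[_ b] _ /(_ a Ca) h] rho.
exact: sat_closed b h.
Qed.

Lemma expand_models M : models M U -> models (expand (new_rel S) M) meet_thm.
Proof. by move=> MU phi [_ Uphi _] rho; rewrite sat_expand; exact: MU. Qed.

Lemma meet_sentence phi : meet_thm phi -> sentence (add_rel S) phi.
Proof. by case. Qed.

(** Membership is truth in two families of models of the meet, the expanded models of [U] and the
    [Mod a], so soundness preserves it; completeness returns from models of [U] to theorems of
    [U]. *)
Lemma meet_closed phi : sentence (add_rel S) phi ->
  provable (add_rel S) meet_thm phi -> meet_thm phi.
Proof.
move=> phiS Tphi; split=> //.
  apply: thm_complete; first exact: sentence_erase.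
  move=> M MS MU rho; rewrite -sat_expand.
  exact: (provable_sound (expand_congruent MS) (expand_models MU) Tphi).
move=> a Ca.
exact: (provable_sound (Mod_congruent (add_rel S) a) (Mod_models Ca) Tphi).
Qed.

Definition meet : theory :=
  {| sig := add_rel S; thm := meet_thm; thm_sentence := meet_sentence;
     thm_closed := meet_closed |}.

Lemma meet_proves a phi : C a -> proves meet phi ->
  forall rho : nat -> Mod a, sat rho phi.
Proof.
move=> Ca; apply: provable_sound; first exact: Mod_congruent.
exact: Mod_models.
Qed.

End Meet.

(** * Interpreting the meet *)

Definition arity (S : signature) (f : nat) : nat := odflt 0 (onth (funs S) f).
Definition rarity (S : signature) (r : nat) : nat := odflt 0 (onth (rels S) r).

Definition id_tr (S : signature) : translation := {|
  tr_dom := Top;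
  tr_eq := Eq (Var 0) (Var 1);
  tr_fun := fun f => Eq (Fun f (map Var (iota 0 (arity S f)))) (Var (arity S f));
  tr_rel := fun r => if r == new_rel S then Bot
                     else Rel r (map Var (iota 0 (rarity S r)))
|}.

Lemma all_var_in S (xs : seq nat) : all (term_in S) (map Var xs).
Proof. by elim: xs. Qed.

Lemma id_tr_wf S : wf_translation (id_tr S) (add_rel S) S.
Proof.
split=> //=.
- move=> f n fS; rewrite /arity fS /= size_map size_iota eqxx all_var_in /=.
  by rewrite ltnSn andbT; apply: all_map_iota => i /=; lia.
- move=> r n; rewrite onth_rcons /new_rel /rarity; case: (r =P _) => //= _ rS.
  rewrite rS /= size_map size_iota eqxx all_var_in /=.
  by apply: all_map_iota => i /=; lia.
Qed.

Lemma form_in_inst S phi xs : form_in S phi -> form_in S (inst phi xs).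
Proof. exact: form_in_subst. Qed.

Lemma form_in_exD S J phi : form_in S (tr_dom J) -> form_in S phi ->
  form_in S (exD J phi).
Proof. by move=> hd hp; rewrite /= form_in_inst // hp. Qed.

Lemma form_in_iter_exD S J k phi : form_in S (tr_dom J) -> form_in S phi ->
  form_in S (iter k (exD J) phi).
Proof. by move=> hd hp; elim: k => // k; exact: form_in_exD. Qed.

Lemma form_in_tr S0 S J phi : wf_translation J S0 S -> form_in S0 phi ->
  form_in S (tr_form J phi).
Proof.
move=> [/andP[hd _] /andP[he _] hf hr].
have args ts d i :
    forall_terms (fun t => forall d y, form_in S (tr_graph J d t y)) ts ->
    form_in S (conj_args (tr_graph J d) ts i).
  by elim: ts i => //= t ts IH i [-> /IH ->].
have Ht t d y : term_in S0 t -> form_in S (tr_graph J d t y).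
  elim/nested_term_ind: t d y => [x|f ts IH] d y; first by move=> _; exact: form_in_inst.
  move=> /andP[/eqP fS tsS]; apply: form_in_iter_exD => //.
  rewrite [form_in _ _]/= !andbT args ?form_in_inst //.
    by have /andP[] := hf _ _ fS.
  by apply: all_terms tsS; apply: sub_terms IH => t ht tS d' y'; exact: ht.
elim: phi => [|u v|r ts|p IHp q IHq|p IHp] //.
- move=> /andP[uS vS]; apply: form_in_exD => //.
  by rewrite [form_in _ _]/= !Ht.
- move=> /andP[/eqP rS tsS]; apply: form_in_iter_exD => //.
  rewrite [form_in _ _]/= !andbT args ?form_in_inst //.
    by have /andP[] := hr _ _ rS.
  by apply: all_terms tsS; apply: forall_terms_all => t tS d y; exact: Ht.
- by move=> /andP[/IHp h1 /IHq h2]; rewrite /= h1.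
- by move=> /IHp h; rewrite /= form_in_inst.
Qed.

Lemma form_in_imps S l phi :
  form_in S (imps l phi) = all (form_in S) l && form_in S phi.
Proof. by elim: l => //= psi l ->; rewrite andbA. Qed.

Lemma form_in_doms S J n : form_in S (tr_dom J) -> all (form_in S) (doms J n).
Proof. by move=> h; apply: all_map_iota => i _; exact: form_in_inst. Qed.

Lemma sat_imps (M : structure) (rho : nat -> M) l phi :
  sat rho (imps l phi) <->
  ((forall psi, List.In psi l -> sat rho psi) -> sat rho phi).
Proof.
elim: l => [|psi l IH] /=; first by split=> [h _|]; [|apply].
rewrite IH; split=> [h hl|h hp hl].
  by apply: h => [|chi hc]; apply: hl; [left|right].
by apply: h => chi [<-|/hl].
Qed.

Lemma sat_inst (M : structure) (rho : nat -> M) phi xs :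
  sat rho (inst phi xs) <-> sat (fun x => rho (nth 0 xs x)) phi.
Proof. exact: sat_subst. Qed.

Section Identity.
Variables (S : signature) (M : structure).
Hypothesis MS : congruent S M.
Let J := id_tr S.

Lemma sat_exD (rho : nat -> M) phi :
  sat rho (exD J phi) <-> exists x, sat (scons x rho) phi.
Proof.
rewrite /exD sat_ex; split=> -[x]; first by move=> /sat_and[_ h]; exists x.
by move=> h; exists x; apply/sat_and; split=> //=.
Qed.

Lemma sat_iter_exD (rho : nat -> M) k phi : sat rho (iter k (exD J) phi) <->
  exists2 ys : seq M, size ys = k & sat (env_cat ys rho) phi.
Proof.
rewrite -sat_iter_ex; elim: k rho => [|k IH] rho //.
by rewrite !iterS sat_exD sat_ex; split=> -[x /IH h]; exists x.
Qed.

Lemma env_cat_iota (ys : seq M) rho : map (env_cat ys rho) (iota 0 (size ys)) = ys.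
Proof.
elim: ys => //= y ys IH; congr cons.
by rewrite (iotaDl 1 0) -map_comp -[RHS]IH.
Qed.

Lemma sat_args (rho rho' : nat -> M) d ts i :
  forall_terms (fun t => forall y, sat rho' (tr_graph J d t y) <->
    eqs (value rho t) (rho' y)) ts ->
  sat rho' (conj_args (tr_graph J d) ts i) <->
  eqs_seq (map (value rho) ts) (map rho' (iota i (size ts))).
Proof.
elim: ts i => [|t ts IH] i; first by split=> // _ /=.
by move=> [h1 h2]; rewrite [conj_args _ _ _]/= sat_and h1 IH.
Qed.

Lemma map_value_var (rho : nat -> M) xs :
  map (value rho) (map Var xs) = map rho xs.
Proof. by rewrite -map_comp. Qed.

Lemma map_nth_iota (rho : nat -> M) (xs : seq nat) n : size xs = n ->
  map (fun i => rho (nth 0 xs i)) (iota 0 n) = map rho xs.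
Proof.
move=> <-; rewrite (map_comp rho (nth 0 xs)); congr map.
exact: (mkseq_nth 0).
Qed.

Lemma sat_tr_graph (rho : nat -> M) d t y : term_in S t ->
  sat rho (tr_graph J d t y) <-> eqs (value (fun x => rho (x + d)) t) (rho y).
Proof.
elim/nested_term_ind: t rho d y => [x|f ts IH] rho d y; first by rewrite sat_inst.
move=> /andP[/eqP fS tsS]; rewrite [tr_graph _ _ _ _]/= sat_iter_exD.
set rd := fun x => rho (x + d).
have argsE (ys : seq M) : size ys = size ts ->
    sat (env_cat ys rho) (conj_args (tr_graph J (d + size ts)) ts 0) <->
    eqs_seq (map (value rd) ts) ys.
  move=> sz; rewrite (@sat_args rd) -?sz ?env_cat_iota //.
  apply: all_terms tsS; apply: sub_terms IH => t ht tS z.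
  rewrite ht // sz; suff -> : (fun x => env_cat ys rho (x + (d + size ts))) = rd by [].
  by apply: functional_extensionality => x; rewrite addnA -sz env_cat_ge.
have funE (ys : seq M) : size ys = size ts ->
    sat (env_cat ys rho) (inst (tr_fun J f) (rcons (iota 0 (size ts)) (y + size ts)))
    <-> eqs (funs_of f ys) (rho y).
  move=> sz; rewrite sat_inst /= /arity fS /= map_value_var.
  have -> : [seq env_cat ys rho (nth 0 (rcons (iota 0 (size ts)) (y + size ts)) i)
      | i <- iota 0 (size ts)] = ys.
    rewrite -[RHS](env_cat_iota ys rho) sz; apply/eq_in_map => i.
    rewrite mem_iota => /andP[_ hi]; congr env_cat.
    by rewrite nth_rcons size_iota hi nth_iota.
  by rewrite nth_rcons size_iota ltnn eqxx -sz env_cat_ge.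
split.
  move=> [ys sz /sat_and[/(argsE _ sz) h1 /(funE _ sz) h2]] /=.
  apply: (eqs_trans MS) h2; apply: (funs_congr MS) h1.
  by rewrite size_map.
move=> h; exists (map (value rd) ts); first by rewrite size_map.
apply/sat_and; split; last by apply/funE; rewrite ?size_map.
apply/argsE; first by rewrite size_map.
by elim: (ts) => //= t ts' IHts; split=> //; exact: (eqs_refl MS).
Qed.

(** Eliminating function symbols by quantified values changes the formula even under the identity
    translation, so the agreement with [erase] is semantic only. *)
Lemma sat_id_tr (rho : nat -> M) phi : form_in (add_rel S) phi ->
  sat rho (tr_form J phi) <-> sat rho (erase (new_rel S) phi).
Proof.
elim: phi rho => [|u v|r ts|p IHp q IHq|p IHp] rho //.
- move=> /andP[]; rewrite !term_in_add_rel => uS vS.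
  rewrite sat_exD; have E x w : term_in S w ->
      sat (scons x rho) (tr_graph J 1 w 0) <-> eqs (value rho w) x.
    move=> wS; rewrite sat_tr_graph //.
    suff -> : (fun z => scons x rho (z + 1)) = rho by [].
    by apply: functional_extensionality => z; rewrite addn1.
  split=> [[x /sat_and[/(E _ _ uS) h1 /(E _ _ vS) h2]]|h].
    exact: (eqs_trans MS) h1 (eqs_sym MS h2).
  exists (value rho v); apply/sat_and; split; first exact/E.
  by apply/E => //; exact: (eqs_refl MS).
- rewrite [form_in _ _]/= onth_rcons (eq_all (@term_in_add_rel S)).
  move=> /andP[rS tsS]; rewrite [tr_form _ _]/= sat_iter_exD.
  rewrite [erase _ _]/= -/(new_rel S) in rS *.
  case: (r =P new_rel S) rS => [_ _|_ /eqP rS]; first by split=> // -[ys _ /sat_and[_ /sat_inst]].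
  have argsE (ys : seq M) : size ys = size ts ->
      sat (env_cat ys rho) (conj_args (tr_graph J (size ts)) ts 0) <->
      eqs_seq (map (value rho) ts) ys.
    move=> sz; rewrite (@sat_args rho) -?sz ?env_cat_iota //.
    apply: all_terms tsS; apply: forall_terms_all => t tS z.
    rewrite sat_tr_graph //.
    suff -> : (fun x => env_cat ys rho (x + size ys)) = rho by [].
    by apply: functional_extensionality => x; rewrite env_cat_ge.
  have relE (ys : seq M) : size ys = size ts ->
      sat (env_cat ys rho) (inst (Rel r (map Var (iota 0 (rarity S r)))) (iota 0 (size ts)))
      <-> rels_of r ys.
    move=> sz; rewrite sat_inst /= /rarity rS /= map_value_var.
    by rewrite map_nth_iota ?size_iota // -sz env_cat_iota.
  split.
    move=> [ys sz /sat_and[/(argsE _ sz) h1 /(relE _ sz) h2]] /=.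
    apply: (rels_congr MS) h2; first by rewrite sz.
    by elim: (ts) (ys) h1 => [|t ts' IHts] [|y ys'] //= [/(eqs_sym MS) ? /IHts].
  move=> h; exists (map (value rho) ts); first by rewrite size_map.
  apply/sat_and; split; last by apply/relE; rewrite ?size_map.
  apply/argsE; first by rewrite size_map.
  by elim: (ts) => //= t ts' IHts; split=> //; exact: (eqs_refl MS).
- by move=> /andP[pS qS]; rewrite /= -IHp // -IHq.
- move=> pS; rewrite /= /dom_at; split=> h x.
    by apply/IHp => //; apply: h.
  by move=> _; apply/IHp => //; exact: h.
Qed.

End Identity.

Lemma In_cat_map_iota (M : structure) (rho : nat -> M) (l l' : seq form)
    (f : nat -> form) m n :
  (forall psi, List.In psi (l ++ map f (iota m n) ++ l') -> sat rho psi) ->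
  (forall i, m <= i < m + n -> sat rho (f i)) /\
  (forall psi, List.In psi l' -> sat rho psi).
Proof.
move=> h; split=> [i hi|psi hl].
  apply: h; apply/In_cat; right; apply/In_cat; left.
  elim: n m hi => [|n IH] m hi /=; first by lia.
  case: (ltngtP i m) => [|lt|->]; [lia|right; apply: IH; lia|by left].
by apply: h; apply/In_cat; right; apply/In_cat; right.
Qed.

Lemma sat_congr_ax (S : signature) (M : structure) (rho : nat -> M) phi n :
  congruent S M -> form_in S phi -> sat rho (congr_ax (id_tr S) phi n).
Proof.
move=> MS phiS; apply/sat_imps => /In_cat_map_iota[h1 h2].
apply/sat_inst; have /sat_inst : sat rho (inst phi (iota 0 n)).
  by apply: h2; left.
apply: (sat_congr MS _ phiS) => x; case: (ltnP x n) => [ltx|gex].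
  rewrite !nth_iota // add0n.
  by have := h1 x ltx; rewrite sat_inst.
by rewrite !nth_default ?size_iota //; exact: (eqs_refl MS).
Qed.

Lemma sat_total_ax (S : signature) (M : structure) (rho : nat -> M) f n :
  congruent S M -> onth (funs S) f = Some n ->
  sat rho (total_ax (id_tr S) f n).
Proof.
move=> MS fS; apply/sat_imps => _; apply/sat_exD.
exists (funs_of f (map rho (iota 0 n))).
rewrite sat_inst /= /arity fS /= map_value_var.
rewrite nth_rcons size_iota ltnn eqxx /=.
have -> : [seq scons (funs_of f (map rho (iota 0 n))) rho
    (nth 0 (rcons (iota 1 n) 0) i) | i <- iota 0 n] = map rho (iota 0 n).
  apply/eq_in_map => i; rewrite mem_iota => /andP[_ hi].
  by rewrite nth_rcons size_iota hi nth_iota.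
exact: (eqs_refl MS).
Qed.

Lemma sat_unique_ax (S : signature) (M : structure) (rho : nat -> M) f n :
  congruent S M -> onth (funs S) f = Some n ->
  sat rho (unique_ax (id_tr S) f n).
Proof.
move=> MS fS; apply/sat_imps => h; apply/sat_inst.
have graph m : sat rho (inst (tr_fun (id_tr S) f) (rcons (iota 0 n) m)) ->
    eqs (funs_of f (map rho (iota 0 n))) (rho m).
  rewrite sat_inst /= /arity fS /= map_value_var.
  rewrite nth_rcons size_iota ltnn eqxx.
  congr (eqs (funs_of f _) _); apply/eq_in_map => i.
  rewrite mem_iota => /andP[_ hi].
  by rewrite nth_rcons size_iota hi nth_iota.
have h1 : eqs (funs_of f (map rho (iota 0 n))) (rho n).
  by apply/graph/h; apply/In_cat; right; left.
have h2 : eqs (funs_of f (map rho (iota 0 n))) (rho n.+1).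
  by apply/graph/h; apply/In_cat; right; right; left.
exact: (eqs_trans MS) (eqs_sym MS h1) h2.
Qed.

Lemma meet_interpretable (U : theory) C : interpretable (meet U C) U.
Proof.
pose S := sig U; exists (id_tr S).
have [/andP[hd _] /andP[he _] hf hr] := id_tr_wf S.
have prove phi : form_in S phi ->
    (forall M : structure, congruent S M -> models M U ->
      forall rho : nat -> M, sat rho phi) -> proves U phi.
  by move=> phiS h; apply: completeness h; first exact: (@thm_sentence U).
have congr_in phi n : form_in S phi -> form_in S (congr_ax (id_tr S) phi n).
  move=> phiS; rewrite /congr_ax form_in_imps !all_cat form_in_doms //=.
  rewrite !form_in_inst // !andbT; apply: all_map_iota => i _.
  exact: form_in_inst.
split; first exact: id_tr_wf.
split.
  apply: prove => // M MS _ rho; apply/sat_imps => _; apply/sat_inst.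
  exact: (eqs_refl MS).
split; first by apply: prove => [|M MS _ rho]; [exact: congr_in|exact: sat_congr_ax].
split.
  move=> r n rS; have /andP[rS' _] := hr _ _ rS.
  by apply: prove => [|M MS _ rho]; [exact: congr_in|exact: sat_congr_ax].
split.
  move=> f n fS; have /andP[fS' _] := hf _ _ fS; split.
  - by apply: prove => [|M MS _ rho]; [exact: congr_in|exact: sat_congr_ax].
  - apply: prove => [|M MS _ rho]; last exact: sat_total_ax.
    by rewrite /total_ax form_in_imps form_in_doms // form_in_exD // form_in_inst.
  - apply: prove => [|M MS _ rho]; last exact: sat_unique_ax.
    rewrite /unique_ax form_in_imps all_cat form_in_doms // andTb.
    apply/andP; split; last exact: form_in_inst.
    by apply/and3P; split=> //; exact: form_in_inst.
move=> phi [/andP[phiS phib] Uphi _]; apply: prove.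
  exact: form_in_tr (id_tr_wf S) phiS.
move=> M MS MU rho; apply/sat_id_tr => //; exact: MU.
Qed.

(** * The construction *)

Definition meet_sig (e : nat) : nat := npair (L (L e)) (crcons (R (L e)) 2).

(* Some theorem of the theory with index [e], found within [N] steps, has a
   translation that fails in [Mod (bit s)], and in all the [Mod a] such that [a]
   agrees with [bit s] below [N]. *)
Definition kills (e s j N : nat) : bool :=
  bex N (fun c => [&& stops (R e) c N, 2 * ctr (R j) c + 4 <= N
                    & ~~ csat N s (ctr (R j) c)]).

(** All patterns [s] of values below [m] are treated at once, since the values at earlier locations
    depend on halting computations and cannot be computed. *)
Definition good (e m N : nat) : bool :=
  ball (2 ^ m) (fun s => ball m.+1 (fun j =>
    ~~ cvalid (meet_sig e) j || kills e s j N)).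

(* The coding locations are the [N] such that [good e m N], where [m] is the
   successor of the previous location; elements [a] of the class [coding e]
   vanish outside of them.  So, whatever the values of [a] at the locations below
   [m], the first [m.+1] translations have been refuted before [a N] matters.
   The left component is a bound for the coding locations below [N], the right
   one is their number. *)
Definition state (e N : nat) : nat :=
  prec 0 (fun N st => if good e (L st) N then npair N.+1 (R st).+1 else st) N.

Definition loc (e N : nat) : bool := good e (L (state e N)) N.
Definition idx (e N : nat) : nat := R (state e N).

(** An effectively closed class: every violation shows at a finite stage. Where the program
    diverges, both values of [a N] are allowed, so the halting problem need not be decided. *)
Definition coding (e : nat) (a : nat -> bool) : Prop :=
  forall N, if loc e N
    then forall k, stops (idx e N) (idx e N) k ->
           a N = (outp (idx e N) (idx e N) k == 0)
    else a N = false.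

Definition refuted (e s t : nat) : bool :=
  bex t (fun N =>
    [&& loc e N, stops (idx e N) (idx e N) t
      & ~~ (bit s N == (outp (idx e N) (idx e N) t == 0))]
    || ~~ loc e N && bit s N).

(** A finite certificate that [n] codes a theorem of the meet. Its last clause is compactness: at
    stage [t], every string of [t] bits has either left the class visibly or makes the sentence
    true. *)
Definition check (e n t : nat) : bool :=
  [&& cwf (meet_sig e) 0 n, stops (R e) (cerase (csize (R (L e))) n) t,
      2 * n + 4 <= t & ball (2 ^ t) (fun s => refuted e s t || csat t s n)].

Lemma comp_meet_sig : comp_fun meet_sig.
Proof. rewrite /meet_sig; comp. Qed.
#[global] Hint Resolve comp_meet_sig : comp.

Lemma comp_kills :
  comp_fun (fun z => kills (L z) (L (R z)) (L (R (R z))) (R (R (R z)))).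
Proof. rewrite /kills; comp. Qed.
#[global] Hint Resolve comp_kills : comp.

Lemma comp_good : comp_fun (fun z => good (L z) (L (R z)) (R (R z))).
Proof. rewrite /good; comp. Qed.
#[global] Hint Resolve comp_good : comp.

Lemma comp_state : comp_fun (fun z => state (L z) (R z)).
Proof. rewrite /state; comp. Qed.
#[global] Hint Resolve comp_state : comp.

Lemma comp_loc : comp_fun (fun z => loc (L z) (R z)).
Proof. rewrite /loc; comp. Qed.

Lemma comp_idx : comp_fun (fun z => idx (L z) (R z)).
Proof. rewrite /idx; comp. Qed.
#[global] Hint Resolve comp_loc comp_idx : comp.

Lemma comp_refuted : comp_fun (fun z => refuted (L z) (L (R z)) (R (R z))).
Proof. rewrite /refuted; comp. Qed.
#[global] Hint Resolve comp_refuted : comp.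

Lemma comp_check : comp_fun (fun z => check (L z) (L (R z)) (R (R z))).
Proof. rewrite /check; comp. Qed.
#[global] Hint Resolve comp_check : comp.

Lemma csat_truth N s a phi : (forall n, n < N -> a n = bit s n) ->
  2 * code_form phi + 4 <= N -> csat N s (code_form phi) <-> truth a phi.
Proof. by move=> as_ le; rewrite csatP (truth_bsat as_ le). Qed.

Lemma csat_bit N s phi : 2 * code_form phi + 4 <= N ->
  csat N s (code_form phi) <-> truth (bit s) phi.
Proof. exact: csat_truth. Qed.

Lemma cwf_sentence S n : cwf (code_sig S) 0 n <->
  exists2 phi, n = code_form phi & sentence S phi.
Proof.
rewrite cwfP; split=> [[phi [-> h1 h2]]|[phi -> /andP[h1 h2]]]; exists phi => //.
by rewrite /sentence h1.
Qed.

Lemma eventually_all n (P : nat -> nat -> Prop) :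
  (forall x, x < n -> exists m, forall t, m <= t -> P x t) ->
  exists m, forall t, m <= t -> forall x, x < n -> P x t.
Proof.
elim: n => [|n IH] h; first by exists 0.
have [|m hm] := IH; first by move=> x ltx; apply: h; lia.
have [m' hm'] := h n (ltnSn n); exists (m + m') => t le x.
rewrite ltnS leq_eqVlt => /orP[/eqP ->|]; first by apply: hm'; lia.
by apply: hm; lia.
Qed.

(* The least element of [coding e]. *)
Definition coding_min (e N : nat) : bool :=
  loc e N && (if excluded_middle_informative
    (exists k, stops (idx e N) (idx e N) k && (outp (idx e N) (idx e N) k == 0))
    then true else false).

Lemma coding_minP e N k : loc e N -> stops (idx e N) (idx e N) k ->
  coding_min e N = (outp (idx e N) (idx e N) k == 0).
Proof.
rewrite /coding_min => -> sk /=.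
destruct (excluded_middle_informative _) as [[k' h]|no].
  by have /andP[sk' ok'] := h; rewrite (outp_stable sk sk') ok'.
by apply/esym/negP => ok; apply: no; exists k; rewrite sk.
Qed.

Lemma coding_min_coding e : coding e (coding_min e).
Proof.
move=> N; case: ifP => locN; last by rewrite /coding_min locN.
by move=> k; exact: coding_minP.
Qed.

Lemma recursive_bool (b : nat -> bool) (X : nat -> Prop) :
  comp_fun (fun n => b n) -> (forall n, X n <-> b n) -> recursive X.
Proof.
move=> /comp_funP[p hp] Xb; exists p => n; have hpn := hp n.
split=> [/Xb bn|nX]; first by rewrite bn in hpn.
suff bn : b n = false by rewrite bn in hpn.
by apply/negP => /Xb.
Qed.

Lemma prv_valid S phi psi : form_in S phi -> form_in S psi ->
  (forall M : structure, congruent S M ->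
     forall rho : nat -> M, sat rho phi -> sat rho psi) ->
  prv S [:: phi] psi.
Proof.
move=> h1 h2 h; have [] : provable S (fun _ => False) (Imp phi psi).
  apply: completeness => //=; first by rewrite h1.
  by move=> M MS _ rho; exact: h.
move=> [|x G] hG; last by case: (hG x); left.
move=> /(@prv_weaken _ _ [:: phi])/prv_impE; apply; last exact: prv_ax0.
by [].
Qed.

(** * Existence of coding locations, failure of interpretability, enumeration of the meet *)

Section Construction.
Variables (U : theory) (p : prog).
Let S := sig U.
Let e := npair (code_sig S) (code_prog p).
Hypothesis pU : enumerates p (codes U).
Hypothesis URI : tRI U.

Lemma enum_stops phi : U phi <-> exists k, stops (R e) (code_form phi) k.
Proof.
have -> : U phi <-> codes U (code_form phi).
  by split=> [h|[psi h /code_form_inj ->]] //; exists phi.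
rewrite (pU _) /e npairR; split=> [[m /stopsP[k sk _]]|[k sk]].
  by exists k.
by exists (outp (code_prog p) (code_form phi) k); apply/stopsP; exists k.
Qed.

Lemma stops_enum c k : stops (R e) c k -> exists2 phi, U phi & c = code_form phi.
Proof.
rewrite /e npairR => sk; suff : codes U c by [].
apply/(pU _).2; exists (outp (code_prog p) c k).
by apply/stopsP; exists k.
Qed.

Lemma meet_sigE : meet_sig e = code_sig (add_rel S).
Proof. by rewrite /meet_sig /e /code_sig !npairE crconsE. Qed.

Lemma new_relE : csize (R (L e)) = new_rel S.
Proof. by rewrite /e /code_sig !npairE csizeE. Qed.

Lemma proves_thm phi : T_P U phi -> U phi.
Proof. by move=> [h1 h2]; exact: thm_closed. Qed.

(** Otherwise the sentences whose translation holds in [Mod (bit s)] would form a recursive set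
    contradicting that [U] is tRI. The translation commutes with the propositional connectives; this
    suffices, because a deduction of [psi] from [phi] becomes the theorem [Imp phi psi] of [U]. *)
Lemma truth_decided s I J : represents I J ->
  exists2 phi, U phi & ~ truth (bit s) (tr_form J phi).
Proof.
move=> IJ; apply: NNPP => no; have [_ _ []] := URI.
have hU phi : U phi -> truth (bit s) (tr_form J phi).
  by move=> Uphi; apply: NNPP => h; apply: no; exists phi.
exists (fun phi => sentence S phi /\ truth (bit s) (tr_form J phi)).
split; first by move=> phi [].
split.
  apply: (@recursive_bool (fun n => cwf (code_sig S) 0 n &&
    csat (2 * ctr I n + 4) s (ctr I n))); first by comp.
  move=> n; split.
    move=> [phi [h1 h2] ->]; apply/andP; split.
      by apply/cwf_sentence; exists phi.
    by rewrite (ctrE IJ); apply/csat_bit.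
  move=> /andP[/cwf_sentence[phi -> h1]]; rewrite (ctrE IJ) => h2.
  by exists phi => //; split=> //; apply/(csat_bit s (leqnn _)).
split; first by move=> phi h; split; [case: h|exact/hU/proves_thm].
split.
  move=> phi [[h1 h2] [_ h3]].
  have /hU : U (Neg phi) by apply: thm_closed => //; rewrite /sentence /= !andbT.
  by apply.
split.
  move=> phi psi [/andP[h1 h2] h3] [/andP[h4 h5] h6].
  split; first by rewrite /sentence /= h1 h2 h4 h5.
  by apply/sat_and.
move=> phi psi [h1 h2] h3 h4; split=> //.
have /hU : U (Imp phi psi).
  have /andP[p1 p2] := h1; have /andP[q1 q2] := h3.
  apply: thm_closed; first by rewrite /sentence /= p1 p2 q1 q2.
  by exists [::] => //; exact: prv_impI.
by apply.
Qed.

Lemma good_eventually m : exists N0, forall N, N0 <= N -> good e m N.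
Proof.
have [N0 hN0] : exists N0, forall N, N0 <= N -> forall s, s < 2 ^ m ->
    forall j, j < m.+1 -> ~~ cvalid (meet_sig e) j || kills e s j N.
  apply: eventually_all => s _; apply: eventually_all => j _.
  case: (boolP (cvalid _ j)) => [|_]; last by exists 0.
  rewrite meet_sigE => /valid_represents[J IJ] /=.
  have [phi Uphi nphi] := truth_decided s IJ.
  have [k sk] := (enum_stops phi).1 Uphi.
  (* The summands bound the code of the theorem, the time to enumerate it, and the part of [bit s]
     on which the truth of its translation depends. *)
  exists (code_form phi + k + (2 * code_form (tr_form J phi) + 4)) => N leN.
  apply/bexP; exists (code_form phi); first by lia.
  rewrite (ctrE IJ) (stops_mono _ sk) //=; last by lia.
  have leN' : 2 * code_form (tr_form J phi) + 4 <= N by lia.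
  by rewrite leN' /=; apply/negP => /(csat_bit s leN').
exists N0 => N leN; apply/ballP => s lts; apply/ballP => j ltj.
exact: hN0.
Qed.

Lemma stateS N :
  state e N.+1 = if loc e N then npair N.+1 (idx e N).+1 else state e N.
Proof. by []. Qed.

(** The search ends by [good_eventually]. Taking the least location keeps the state constant up to
    it, so that no index is skipped. *)
Lemma next_loc N0 : exists N, [/\ N0 <= N, loc e N & state e N = state e N0].
Proof.
have [N1 hN1] := good_eventually (L (state e N0)).
have ex : exists k, good e (L (state e N0)) (N0 + k).
  by exists N1; apply: hN1; lia.
case: (ex_minnP ex) => k gk mink.
have st l : l <= k -> state e (N0 + l) = state e N0.
  elim: l => [|l IH] ltl; first by rewrite addn0.
  rewrite addnS stateS IH; last by lia.
  case: ifP => // locl; have := mink l; rewrite /loc IH in locl; last by lia.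
  by move=> /(_ locl); lia.
by exists (N0 + k); rewrite /loc st //; split=> //; lia.
Qed.

Lemma loc_large j : exists2 N, loc e N & j <= L (state e N).
Proof.
(* Two locations are needed: the translations refuted at a location are bounded by the previous
   one. *)
have [N1 [le1 loc1 _]] := next_loc j.
have [N2 [_ loc2 st]] := next_loc N1.+1.
by exists N2 => //; rewrite st stateS loc1 npairL; lia.
Qed.

Lemma loc_idx i : exists2 N, loc e N & idx e N = i.
Proof.
elim: i => [|i [N locN iN]].
  have [N [_ locN st]] := next_loc 0; exists N => //.
  by rewrite /idx st /state /= -npair00 npairR.
have [N' [_ locN' st]] := next_loc N.+1; exists N' => //.
by rewrite /idx st stateS locN npairR -iN.
Qed.

Lemma loc_gap N n : L (state e N) <= n -> n < N -> loc e n = false.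
Proof.
elim: N => // N IH; rewrite stateS; case: ifP => [_|locN].
  by rewrite npairL; lia.
by move=> le; rewrite ltnS leq_eqVlt => /orP[/eqP ->|/(IH le)].
Qed.

Definition weaker : theory := meet U (coding e).

(** An interpretation would make the translations of all theorems of [U] true in
    [Mod (coding_min e)], a model of the meet. But a location whose predecessor exceeds the code [j]
    of the translation certifies that one of them fails there. *)
Lemma not_interpretable : ~ interpretable U weaker.
Proof.
move=> [J [wfJ [_ [_ [_ [_ hJ]]]]]].
have [j [J' [vj jJ' JJ']]] := represented wfJ.
have [N locN lej] := loc_large j; set m := L (state e N) in lej.
have Ca := coding_min_coding e.
have [s lts sa] := bits_ex (coding_min e) m.
(* There is no location from [m] up to [N], so the class element vanishes there, as do the bits of
   [s < 2 ^ m]. *)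
have agree n : n < N -> coding_min e n = bit s n.
  move=> ltn; case: (ltnP n m) => [/sa //|ge].
  by rewrite (bit_ge lts ge) /coding_min (loc_gap ge ltn).
have /ballP/(_ s lts)/ballP/(_ j) := locN.
rewrite ltnS meet_sigE vj /= => /(_ lej)/bexP[c ltc].
move=> /and3P[/stops_enum[phi Uphi ->] leN /negP]; apply.
rewrite (ctrE jJ') in leN *; apply/(csat_truth agree leN).
rewrite -JJ'; last by have /andP[] := thm_sentence Uphi.
exact: (meet_proves Ca (hJ _ Uphi)).
Qed.

(** The truth of [phi] depends on the first [N0] values only. A pattern [tau] of [N0] bits that
    falsifies a theorem [phi] extends to no element of the class, so it is refuted at some stage;
    the finitely many patterns then have a common stage. *)
Lemma weaker_enum n : codes weaker n <-> exists t, check e n t.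
Proof.
split=> [[phi [phiS Uphi Tphi] ->] {n}|[t]]; last first.
  move=> /and4P[]; rewrite meet_sigE new_relE => /cwf_sentence[phi -> phiS].
  rewrite ceraseE => /stops_enum[psi Upsi /code_form_inj epsi] lent /ballP h.
  exists phi => //; split; rewrite ?epsi // => a Ca.
  have [s lts sa] := bits_ex a t.
  have as_ k : k < t -> a k = bit s k by move=> /sa.
  apply/(csat_truth as_ lent); have /orP[/bexP[N ltN]|//] := h s lts.
  have := Ca N; rewrite as_ //; case: (loc e N) => [hN|->] //=.
  by rewrite orbF => /andP[/hN ->]; rewrite eqxx.
set n := code_form phi; pose N0 := 2 * n + 4.
have [k sk] := (enum_stops (erase (new_rel S) phi)).1 Uphi.
pose dead tau t := forall s, (forall i, i < N0 -> bit s i = bit tau i) ->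
  refuted e s t.
have [m hm] : exists m, forall t, m <= t -> forall tau, tau < 2 ^ N0 ->
    dead tau t \/ truth (bit tau) phi.
  apply: eventually_all => tau _.
  case: (classic (truth (bit tau) phi)) => [h|h]; first by exists 0; right.
  (* Continuing [tau] by an element of the class forces the violation below [N0]; the same violation
     then refutes every string that begins like [tau]. *)
  pose a i := if i < N0 then bit tau i else coding_min e i.
  have : ~ coding e a.
    move=> /Tphi h'; apply: h; rewrite (@truth_agree _ a) // => i lti.
    by rewrite /a /N0 lti.
  move=> nC; have [N hN] := not_all_ex_not _ _ nC.
  have ltN : N < N0.
    rewrite ltnNge; apply/negP => ge; apply: hN.
    have aN : a N = coding_min e N by rewrite /a ltnNge ge.
    by rewrite aN; exact: coding_min_coding.
  have aN : a N = bit tau N by rewrite /a ltN.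
  rewrite aN in hN; case: ifP hN => locN hN.
    have [l hl] := not_all_ex_not _ _ hN.
    have [sl /eqP ol] := imply_to_and _ _ hl.
    exists (N.+1 + l) => t let_; left=> s hs; apply/bexP; exists N; first by lia.
    have st := stops_mono (leq_trans (leq_addl _ _) let_) sl.
    rewrite locN st /= -(outp_stable sl st) hs //.
    by apply/orP; left; apply/eqP.
  exists N.+1 => t let_; left=> s hs; apply/bexP; exists N; first by lia.
  by rewrite locN hs //=; case: (bit tau N) hN.
exists (m + k + N0); apply/and4P; split.
- by rewrite meet_sigE; apply/cwf_sentence; exists phi.
- by rewrite new_relE ceraseE; apply: stops_mono sk; lia.
- by rewrite -/N0; lia.
apply/ballP => s lts; apply/orP.
have [tau lttau htau] := bits_ex (bit s) N0.
have [|d|h] := hm (m + k + N0) _ tau lttau; first by lia.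
  by left; apply: d => i lti; rewrite htau.
right; apply/csat_bit; first by rewrite -/n -/N0; lia.
by rewrite (@truth_agree _ (bit tau)) // => i lti; rewrite htau.
Qed.

End Construction.

(** * Essential undecidability of the meet *)

Lemma sentence_imp S phi psi :
  sentence S (Imp phi psi) = sentence S phi && sentence S psi.
Proof. by rewrite /sentence /= andbACA. Qed.

Lemma sentence_neg S phi : sentence S (Neg phi) = sentence S phi.
Proof. by rewrite /sentence /= !andbT. Qed.

Lemma sentence_and S phi psi :
  sentence S (And phi psi) = sentence S phi && sentence S psi.
Proof. by rewrite /And sentence_neg sentence_imp sentence_neg. Qed.

Lemma congruent_reduct S (M : structure) : congruent (add_rel S) M -> congruent S M.
Proof.
move=> [h1 h2 h3 h4 h5]; split=> // r xs ys rS; apply: h5.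
rewrite onth_rcons; case: (r =P _) => // er.
by rewrite er onth_size in rS.
Qed.

Lemma sentence_add_rel S phi : sentence S phi -> sentence (add_rel S) phi.
Proof. by move=> /andP[h1 h2]; rewrite /sentence form_in_add_rel. Qed.

Section NoDecidableExtension.
Variables (U : theory) (p : prog).
Let S := sig U.
Let e := npair (code_sig S) (code_prog p).
Hypothesis pU : enumerates p (codes U).
Hypothesis URI : tRI U.

Variable X : form -> Prop.
Hypothesis XS : forall phi, X phi -> sentence (add_rel S) phi.
Hypothesis Xrec : recursive (codes X).
Hypothesis XT : forall phi, weaker U p phi -> X phi.
Hypothesis Xcons : ~ X Bot.
Hypothesis Xand : forall phi psi, X phi -> X psi -> X (And phi psi).
Hypothesis Xprv : forall phi psi, X phi -> sentence (add_rel S) psi ->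
  prv (add_rel S) [:: phi] psi -> X psi.

Lemma X_taut phi psi : X phi -> sentence (add_rel S) psi ->
  (forall M : structure, congruent (add_rel S) M ->
     forall rho : nat -> M, sat rho phi -> sat rho psi) -> X psi.
Proof.
move=> Xphi psiS h; apply: (Xprv Xphi psiS); apply: prv_valid h.
  by case/andP: (XS Xphi).
by case/andP: psiS.
Qed.

Lemma X_mp phi psi : X (Imp phi psi) -> X phi -> X psi.
Proof.
move=> h1 h2; apply: (X_taut (Xand h1 h2)).
  by have := XS h1; rewrite sentence_imp => /andP[].
by move=> M _ rho /sat_and[h]; apply: h.
Qed.

Lemma X_neg phi : X phi -> ~ X (Neg phi).
Proof. by move=> h /X_mp/(_ h). Qed.

(* This holds in the structures [Mod a], but not in the expansions of the models
   of [U]: it tells the two components of the meet apart. *)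
Definition nonempty_rel : form := Ex (Rel (new_rel S) [:: Var 0; Var 0]).

Lemma nonempty_rel_sentence : sentence (add_rel S) nonempty_rel.
Proof. by rewrite /sentence /= onth_rcons eqxx. Qed.

Lemma truth_nonempty_rel a : truth a nonempty_rel.
Proof. by apply/sat_ex; exists pt. Qed.

Lemma erase_nonempty_rel (M : structure) (rho : nat -> M) :
  ~ sat rho (erase (new_rel S) nonempty_rel).
Proof. by rewrite /= eqxx; apply; move=> x []. Qed.

(** The implication is vacuous in the expanded models of [U], where the new relation is empty.
    Hence, relative to [nonempty_rel], [X] contains whatever holds throughout the class;
    [weaker_thm] is the dual fact for [U]. *)
Lemma weaker_imp phi : sentence (add_rel S) phi ->
  (forall a, coding e a -> truth a phi) -> X (Imp nonempty_rel phi).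
Proof.
move=> phiS h; apply: XT.
have iS : sentence (add_rel S) (Imp nonempty_rel phi).
  by rewrite sentence_imp nonempty_rel_sentence.
split=> //; last by move=> a Ca _; exact: h.
apply: thm_complete; first exact: sentence_erase.
by move=> M _ _ rho /erase_nonempty_rel.
Qed.

Lemma weaker_thm phi : U phi -> X (Imp (Neg nonempty_rel) phi).
Proof.
move=> Uphi; apply: XT; have phiS := thm_sentence Uphi.
have iS : sentence (add_rel S) (Imp (Neg nonempty_rel) phi).
  by rewrite sentence_imp sentence_neg nonempty_rel_sentence sentence_add_rel.
split=> //; last by move=> a _ [] ; exact: truth_nonempty_rel.
apply: thm_complete; first exact: sentence_erase.
move=> M _ MU rho _; rewrite -/erase erase_id; last by case/andP: phiS.
exact: MU.
Qed.

Definition chi (n : nat) : bool :=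
  if excluded_middle_informative (codes X n) then true else false.

Lemma chiP n : chi n <-> codes X n.
Proof. by rewrite /chi; destruct (excluded_middle_informative _). Qed.

Lemma comp_chi : comp_fun (fun n => chi n).
Proof.
apply/comp_funP; have [q hq] := Xrec; exists q => n; have [h1 h2] := hq n.
case E: (chi n); first exact/h1/chiP.
by apply: h2 => /chiP; rewrite E.
Qed.

Lemma chi_code phi : chi (code_form phi) <-> X phi.
Proof.
rewrite chiP; split=> [[psi h /code_form_inj ->] //|h]; by exists phi.
Qed.

(** Otherwise [X] would contain all theorems of [U], and its restriction to the old signature would
    contradict that [U] is tRI. *)
Lemma X_nonempty_rel : ~ X (Neg nonempty_rel).
Proof.
move=> XP; have XU phi : U phi -> X phi by move=> /weaker_thm/X_mp; apply.
have [_ _ []] := URI; exists (fun phi => X phi /\ sentence S phi).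
split; first by move=> phi [].
split.
  have hc := comp_chi.
  apply: (@recursive_bool (fun n => chi n && cwf (code_sig S) 0 n)).
    by comp; exact: op_fun hc op_id.
  move=> n; split=> [[phi [h1 h2] ->]|/andP[/chiP[phi h1 ->] /cwf_sentence[psi]]].
    by apply/andP; split; [exact/chi_code|apply/cwf_sentence; exists phi].
  by move=> /code_form_inj <- h2; exists phi.
split; first by move=> phi h; split; [exact/XU/proves_thm|case: h].
split.
  move=> phi [[h1 _] [h2 h3]]; apply: (X_neg h1); apply: XU.
  by apply: thm_closed => //; rewrite sentence_neg.
split.
  move=> phi psi [h1 h2] [h3 h4]; split; first exact: Xand.
  by rewrite sentence_and h2.
move=> phi psi [h1 h2] psiS h3; split=> //.
apply: (X_taut h1); first exact: sentence_add_rel.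
move=> M MS rho hphi; apply: (soundness (congruent_reduct MS) h3).
by move=> chi' [<-|].
Qed.

(** Diagonalization: a decision procedure for [X] would predict the value coded at the location
    whose index is the code of a program built from that very procedure. *)
Lemma not_decidable : False.
Proof.
(* [w] pairs the location of index [i] with the code of a sentence equivalent to the value of [a]
   there. The sentence is searched for, by testing the equivalence on finite strings, instead of
   being computed; [exact_class] shows that the search succeeds. The strings are long enough both to
   decide the sentence and to contain the bit at the location. *)
pose Q i w := [&& loc e (L w), idx e (L w) == i,
  cwf (meet_sig e) 0 (R w) & ball (2 ^ (2 * R w + 4 + (L w).+1))
    (fun s => csat (2 * R w + 4 + (L w).+1) s (R w) == bit s (L w))].
have Qc : comp_fun (fun z => Q (L z) (R z)) by rewrite /Q; comp.
have [q [qh qQ]] := search Qc.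
have [r hr] : exists r, forall n, eval r n
    (chi (cImp (code_form nonempty_rel) (R n))).
  apply/comp_funP; have hc := comp_chi.
  by apply: op_fun hc _; rewrite /cImp; comp.
have Qex i : exists w, Q i w.
  have [N locN iN] := loc_idx pU URI i.
  have Er := onth_add_rel S.
  exists (npair N (code_form (exact_class (new_rel S) N))).
  rewrite /Q !npairE locN iN eqxx meet_sigE.
  have -> : cwf (code_sig (add_rel S)) 0 (code_form (exact_class (new_rel S) N)).
    apply/cwf_sentence; exists (exact_class (new_rel S) N) => //.
    exact: exact_class_sentence.
  apply/ballP => s _; apply/eqP; apply/idP/idP.
    by move=> /csat_bit => h; apply/(truth_exact_class _ (new_rel S)); apply: h; lia.
  move=> /(truth_exact_class _ (new_rel S)) h; apply/csat_bit => //; lia.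
(* On input [i], this program finds the sentence [psi] for the location of index [i] and outputs
   whether [Imp nonempty_rel psi] is in [X]; it is applied to its own code. *)
pose i := code_prog (PComp r q).
have [w qw] := (qh i).2 (Qex i).
have /and4P[locN /eqP iN] := qQ _ _ qw.
rewrite meet_sigE => /cwf_sentence[psi epsi psiS] /ballP hb.
set N := L w in locN iN hb *.
have hpsi a : truth a psi <-> a N.
  have [s lts sa] := bits_ex a (2 * R w + 4 + N.+1).
  have <- : csat (2 * R w + 4 + N.+1) s (R w) <-> truth a psi.
    rewrite epsi; apply: csat_truth; last by lia.
    by move=> n ltn; rewrite sa // epsi.
  by rewrite (eqP (hb s lts)) sa //; lia.
have hv : eval (PComp r q) i (chi (code_form (Imp nonempty_rel psi))).
  exists w => //; have -> : code_form (Imp nonempty_rel psi) =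
    cImp (code_form nonempty_rel) (R w) by rewrite epsi.
  exact: hr.
have /stopsP[k sk ok] := hv.
(* [coding] puts [1] exactly where the output is [0], so throughout the class [psi] has the truth
   value opposite to the prediction. *)
have aN a : coding e a -> a N = ~~ chi (code_form (Imp nonempty_rel psi)).
  move=> Ca; have := Ca N; rewrite locN iN => /(_ k sk) ->.
  by rewrite -/i ok; case: chi.
case E : (chi (code_form (Imp nonempty_rel psi))).
  have h1 : X (Imp nonempty_rel psi) by apply/chi_code.
  have h2 : X (Imp nonempty_rel (Neg psi)).
    apply: weaker_imp => [|a Ca]; first by rewrite sentence_neg.
    by move=> /hpsi; rewrite aN // E.
  apply: X_nonempty_rel; apply: (X_taut (Xand h1 h2)).
    by rewrite sentence_neg nonempty_rel_sentence.
  by move=> M _ rho /sat_and[g1 g2] hP; exact: (g2 hP (g1 hP)).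
suff /chi_code : X (Imp nonempty_rel psi) by rewrite E.
by apply: weaker_imp => // a Ca; apply/hpsi; rewrite aN // E.
Qed.

End NoDecidableExtension.

(** * An index of the meet, and the conclusion *)

Lemma comp_check_pair : comp_fun (fun z => check (L (L z)) (R (L z)) (R z)).
Proof. comp. Qed.

Theorem theorem5p6 :
  exists f : prog,
    forall (e : nat) (U : theory), theory_index e U -> tRI U ->
      exists (e' : nat) (T : theory),
        [/\ eval f e e', theory_index e' T, tRI T & strictly_interpretable T U].
Proof.
have [P [hP _]] := @search (fun z t => check (L z) (R z) t) comp_check_pair.
(* The enumeration of the meet is the fixed search [P] with [e] hard-wired as a constant program;
   [ck] computes the code of that constant, so the new index is computable from [e]. *)
pose ck e := prec (code_prog PZero)
  (fun _ c => npair 5 (npair (code_prog PSucc) c)) e.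
pose enum e := PComp P (PPair (kprog e) pid).
have ckE e : ck e = code_prog (kprog e) by rewrite /ck; elim: e => //= e ->.
have [f hf] : exists f, forall e, eval f e
    (npair (meet_sig e) (npair 5 (npair (code_prog P)
       (npair 4 (npair (ck e) (code_prog pid)))))).
  by apply/comp_funP; rewrite /ck; comp.
exists f => e U [p -> pU] URI; set e0 := npair _ _.
exists (npair (code_sig (add_rel (sig U))) (code_prog (enum e0))), (weaker U p).
have idx_T : theory_index (npair (code_sig (add_rel (sig U)))
    (code_prog (enum e0))) (weaker U p).
  exists (enum e0) => // n; rewrite (weaker_enum pU).
  have -> : halts (enum e0) n <-> halts P (npair e0 n).
    split=> [[m [z [a [b [ha hb ->]]]] hm]|[m hm]].
      have ea := @eval_fun (kprog e0) n a e0 ha (eval_kprog e0 n).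
      have eb := @eval_fun pid n b n hb (eval_pid n).
      by exists m; rewrite -ea -eb.
    exists m, (npair e0 n) => //; exists e0, n.
    by split=> //; [exact: eval_kprog|exact: eval_pid].
  by rewrite hP !npairE.
split=> //.
- by have := hf e0; rewrite ckE meet_sigE.
- split.
  + by move=> /(meet_proves (@coding_min_coding _))/(_ (fun=> pt)).
  + by exists (npair (code_sig (add_rel (sig U))) (code_prog (enum e0))).
  + move=> [X [XS [Xrec [XT [Xcons [Xand Xprv]]]]]].
    apply: (not_decidable pU URI XS Xrec _ _ Xand Xprv).
      move=> phi Tphi; apply: XT; split; first exact: thm_sentence.
      by exists [:: phi]; [move=> psi [<-|]|exact: prv_ax0].
    move=> XBot; apply: (Xcons Bot); split=> //; split=> //.
    by exists [::] => //; apply: prv_impI => //; exact: prv_ax0.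
- split; first exact: meet_interpretable.
  exact: not_interpretable pU URI.
Qed.
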